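(* Let $M$ be a connected split matroid of rank $k$ on the ground set $E=[n]$. Then the \texttt{cd}-index of its base polytope $\mathscr{P}(M)$ is \[ \Psi_{cd}(\mathscr{P}(M)) = \Psi_{cd}(\Delta_{k,n}) + \sum_{0 < r < h < n} \lambda(r,h)\bigl( \Psi_{cd}(\Lambda_{k-r,k,n-h,n}) - \Psi_{cd}(\Delta_{k,n}) \bigr) - \sum_{\mathbf r} \mu(\mathbf r)\, W(\mathbf r), \] where the last sum ranges over all $\mathbf r=(\alpha,\beta;a,b)$ with $0<\alpha<a<n$, $0<\beta<b<n$ and $(\alpha,a)\le(\beta,b)$ in the lexicographic order, and \[ W(\alpha,\beta,a,b)=\sum_{p=1}^{\alpha}\sum_{q=1}^{\beta}\sum_{i=p+1}^{a-\alpha+p}\sum_{j=q+1}^{b-\beta+q}\binom{a}{i}\binom{b}{j}\binom{a-i}{\alpha-p}\binom{b-j}{\beta-q}\,\Psi_{cd}(\Delta_{p,i}\times\Delta_{q,j})\cdot d\cdot\Psi_{cd}(\Delta_{1,n-i-j}). \]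
   Context: For a polytope $P$ of dimension $D$, its \texttt{ab}-index is $\Psi_{ab}(P)=\sum_{\mathcal F} w(\mathcal F)\in\mathbb Z\langle a,b\rangle$ (non-commuting variables), summed over all chains of faces $\varnothing\subset\sigma_1\subset\dots\subset\sigma_s\subset P$ of proper nonempty faces (including the empty chain), with $w(\mathcal F)=w_0\cdots w_{D-1}$, $w_i=b$ if $i\in\{\dim\sigma_1,\dots,\dim\sigma_s\}$ and $w_i=a-b$ otherwise. The \texttt{cd}-index $\Psi_{cd}(P)$ is the unique polynomial in non-commuting variables $c,d$ which becomes $\Psi_{ab}(P)$ under $c=a+b$, $d=ab+ba$. The hypersimplex $\Delta_{k,n}\subset\mathbb R^n$ is the convex hull of the indicator vectors $e_B=\sum_{i\in B}e_i$ of all $k$-subsets $B\subseteq[n]$; $\Delta_{p,i}\times\Delta_{q,j}$ is the Cartesian product polytope. $\Lambda_{k-r,k,n-h,n}$ denotes the polytope $\{x\in\Delta_{k,n}: \sum_{i=1}^h x_i\le r\}$ (base polytope of a cuspidal matroid). The base polytope $\mathscr P(M)$ is the convex hull of the indicator vectors of the bases of $M$. A cyclic flat is a flat that is a union of circuits. A pair $(F,G)$ of cyclic flats is modular if $\mathrm{rk}(F)+\mathrm{rk}(G)=\mathrm{rk}(F\cup G)+\mathrm{rk}(F\cap G)$. A subset $A\subseteq E$ is stressed if the restriction $M|A$ and the contraction $M/A$ are uniform; its cover is the family of $k$-subsets $B$ with $|B\cap A|\ge \mathrm{rk}(A)+1$; relaxing $A$ means replacing the bases $\mathcal B(M)$ by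 $\mathcal B(M)\cup$ cover of $A$. A connected matroid is split if relaxing all stressed subsets with nonempty cover yields a uniform matroid. $\lambda(r,h)$ is the number of proper nonempty cyclic flats of $M$ of rank $r$ and cardinality $h$. For a modular pair $(F,G)$ of distinct proper nonempty cyclic flats set $a=|F\setminus G|$, $b=|G\setminus F|$, $\alpha=\mathrm{rk}(F)-\mathrm{rk}(F\cap G)$, $\beta=\mathrm{rk}(G)-\mathrm{rk}(F\cap G)$; $\mu(\alpha,\beta;a,b)$ is the number of modular pairs of cyclic flats of $M$ with these parameters. *)

(* Defs.v *)
(* Rational coordinates: all polytopes here are 0/1-polytopes. *)
From HB Require Import structures.
From mathcomp Require Import all_boot all_order all_algebra.
From Stdlib Require Import ClassicalEpsilon.
Set Implicit Arguments. Unset Strict Implicit. Unset Printing Implicit Defensive.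
Import Order.TTheory GRing.Theory Num.Theory.
Local Open Scope ring_scope.

Section NC.
Variable X : eqType.
Definition ncpoly := seq (int * seq X).
Definition nccoef (p : ncpoly) (w : seq X) : int :=
  \sum_(m <- p | m.2 == w) m.1.
Definition nceq (p q : ncpoly) : Prop := forall w, nccoef p w = nccoef q w.
Definition ncone : ncpoly := [:: (1, [::])].
Definition ncletter (x : X) : ncpoly := [:: (1, [:: x])].
Definition ncadd (p q : ncpoly) : ncpoly := p ++ q.
Definition ncscale (z : int) (p : ncpoly) : ncpoly := [seq (z * m.1, m.2) | m <- p].
Definition ncsub (p q : ncpoly) : ncpoly := p ++ ncscale (-1) q.
Definition ncmul (p q : ncpoly) : ncpoly :=
  [seq (m.1 * m'.1, m.2 ++ m'.2) | m <- p, m' <- q].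
Definition ncprod (s : seq ncpoly) : ncpoly := foldr ncmul ncone s.
Definition ncsum (s : seq ncpoly) : ncpoly := flatten s.
End NC.

Inductive abL := La | Lb.
Inductive cdL := Lc | Ld.
Definition abL_comp : comparable abL. Proof. by move=> x y; rewrite /decidable; decide equality. Defined.
Definition cdL_comp : comparable cdL. Proof. by move=> x y; rewrite /decidable; decide equality. Defined.
HB.instance Definition _ := comparableMixin abL_comp.
HB.instance Definition _ := comparableMixin cdL_comp.

Definition va : ncpoly abL := ncletter La.
Definition vb : ncpoly abL := ncletter Lb.
Definition vc : ncpoly cdL := ncletter Lc.
Definition vd : ncpoly cdL := ncletter Ld.

Definition cd_letter_to_ab (x : cdL) : ncpoly abL :=
  match x with
  | Lc => ncadd va vb
  | Ld => ncadd (ncmul va vb) (ncmul vb va)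
  end.
Definition cd_to_ab (phi : ncpoly cdL) : ncpoly abL :=
  ncsum [seq ncscale m.1 (ncprod (map cd_letter_to_ab m.2)) | m <- phi].

(* Polytopes: P = conv { f t | t : T } in Q^n, for a finite type T.     *)
(* A nonempty face is identified with the set of indices t whose point  *)
(* maximizes some linear functional c (c = 0 gives P itself).           *)
Definition asb (P : Prop) : bool :=
  if excluded_middle_informative P then true else false.

Section Polytope.
Variables (n : nat) (T : finType) (f : T -> 'rV[rat]_n).

Definition dotv (c x : 'rV[rat]_n) : rat := (c *m x^T) 0 0.

Definition is_face (Y : {set T}) : Prop :=
  exists c : 'rV[rat]_n,
    Y = [set t | [forall u, dotv c (f u) <= dotv c (f t)]].

Definition proper_face (Y : {set T}) : bool :=
  [&& asb (is_face Y), Y != set0 & Y != [set: T]].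

Definition fdim (Y : {set T}) : nat :=
  if [pick t in Y] is Some t0 then
    \dim <<[seq f u - f t0 | u <- enum Y]>>%VS
  else 0%N.

Definition pdim : nat := fdim [set: T].

Definition is_chain (C : {set {set T}}) : bool :=
  [forall Y in C, proper_face Y] &&
  [forall Y in C, forall Y' in C, (Y \subset Y') || (Y' \subset Y)].

Definition chain_weight (C : {set {set T}}) : ncpoly abL :=
  let dims := [seq fdim Y | Y <- enum C] in
  ncprod [seq (if (i \in dims) then vb else ncsub va vb) | i <- iota 0 pdim].

Definition Psi_ab : ncpoly abL :=
  ncsum [seq chain_weight C | C <- enum [set C : {set {set T}} | is_chain C]].

(* The cd-index: the cd-polynomial which becomes Psi_ab under
   c = a + b, d = ab + ba (unique when it exists). *)
Definition Psi_cd : ncpoly cdL :=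
  epsilon (inhabits [::]) (fun phi => nceq (cd_to_ab phi) Psi_ab).
End Polytope.

Definition prod_pts (n1 n2 : nat) (T1 T2 : finType)
  (f1 : T1 -> 'rV[rat]_n1) (f2 : T2 -> 'rV[rat]_n2) : T1 * T2 -> 'rV[rat]_(n1 + n2) :=
  fun x => row_mx (f1 x.1) (f2 x.2).

Definition indic (n : nat) (B : {set 'I_n}) : 'rV[rat]_n :=
  \row_(i < n) (if i \in B then 1 else 0).

Definition hyp_pts (k n : nat) : {B : {set 'I_n} | #|B| == k} -> 'rV[rat]_n :=
  fun B => indic (val B).
Arguments hyp_pts k n : clear implicits.

(* Lambda_{k-r,k,n-h,n} = {x in Delta_{k,n} : x_1 + ... + x_h <= r}, given as
   the base polytope of the cuspidal matroid: conv of the e_B, |B| = k,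
   |B cap [h]| <= r.  (Coordinates 1..h are the indices 0..h-1 of 'I_n.) *)
Definition Lam_pts (k n r h : nat) :
  {B : {set 'I_n} | (#|B| == k) && (#|B :&: [set i : 'I_n | (i < h)%N]| <= r)%N} -> 'rV[rat]_n :=
  fun B => indic (val B).
Arguments Lam_pts k n r h : clear implicits.

Section Matroid.
Variables (n : nat) (Bs : {set {set 'I_n}}).

Definition is_matroid : Prop :=
  Bs != set0 /\
  forall B1 B2, B1 \in Bs -> B2 \in Bs -> forall x, x \in B1 :\: B2 ->
    exists2 y, y \in B2 :\: B1 & (y |: (B1 :\ x)) \in Bs.

Definition has_rank (k : nat) : Prop := forall B, B \in Bs -> #|B| = k.

Definition rk (A : {set 'I_n}) : nat := \max_(B in Bs) #|B :&: A|.

Definition indep (I : {set 'I_n}) : bool := [exists B in Bs, I \subset B].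

Definition circuit (C : {set 'I_n}) : bool :=
  ~~ indep C && [forall x in C, indep (C :\ x)].

Definition connected : bool :=
  [forall x, forall y, (x != y) ==> [exists C, circuit C && (x \in C) && (y \in C)]].

Definition flat (F : {set 'I_n}) : bool :=
  [forall x, (x \notin F) ==> (rk F < rk (x |: F))%N].

Definition cyclic_flat (F : {set 'I_n}) : bool :=
  flat F && [forall x in F, exists C, circuit C && (C \subset F) && (x \in C)].

Definition pne_cyclic_flat (F : {set 'I_n}) : bool :=
  [&& cyclic_flat F, F != set0 & F != [set: 'I_n]].

Definition lambda (r h : nat) : nat :=
  #|[set F : {set 'I_n} | pne_cyclic_flat F && (rk F == r) && (#|F| == h)]|.

Definition modular (F G : {set 'I_n}) : bool :=
  (rk F + rk G == rk (F :|: G) + rk (F :&: G))%N.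

Definition pair_params (F G : {set 'I_n}) : nat * nat * nat * nat :=
  (rk F - rk (F :&: G), rk G - rk (F :&: G), #|F :\: G|, #|G :\: F|)%N.

(* mu(alpha,beta;a,b): number of (unordered) modular pairs {F,G} of distinct
   proper nonempty cyclic flats having these parameters (in one of the two
   orders) *)
Definition mu (al be a b : nat) : nat :=
  #|[set X : {set {set 'I_n}} | [exists F, exists G,
      [&& X == [set F; G], F != G, pne_cyclic_flat F, pne_cyclic_flat G,
          modular F G & pair_params F G == (al, be, a, b)]]]|.

Definition uniform_on (X : {set 'I_n}) (Bs' : {set {set 'I_n}}) : bool :=
  [exists r : 'I_n.+1, Bs' == [set B : {set 'I_n} | (B \subset X) && (#|B| == r)]].

Definition restr_bases (A : {set 'I_n}) : {set {set 'I_n}} :=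
  [set I : {set 'I_n} | (I \subset A) && indep I && (#|I| == rk A)].

Definition contr_bases (A : {set 'I_n}) : {set {set 'I_n}} :=
  [set B :\: A | B in Bs & #|B :&: A| == rk A].

Definition stressed (A : {set 'I_n}) : bool :=
  uniform_on A (restr_bases A) && uniform_on (~: A) (contr_bases A).

Definition cover (k : nat) (A : {set 'I_n}) : {set {set 'I_n}} :=
  [set B : {set 'I_n} | (#|B| == k) && (rk A < #|B :&: A|)%N].

Definition relax_all (k : nat) : {set {set 'I_n}} :=
  Bs :|: \bigcup_(A | stressed A && (cover k A != set0)) cover k A.

Definition split_matroid (k : nat) : bool :=
  connected && (relax_all k == [set B : {set 'I_n} | #|B| == k]).

Definition base_pts : {B : {set 'I_n} | B \in Bs} -> 'rV[rat]_n :=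
  fun B => indic (val B).
End Matroid.
Arguments base_pts n Bs : clear implicits.
Arguments mu n Bs al be a b : clear implicits.
Arguments lambda n Bs r h : clear implicits.

Definition Wterm (n al be a b : nat) : ncpoly cdL :=
  ncsum [seq
    ncsum [seq
      ncsum [seq
        ncsum [seq
          ncscale ('C(a, i) * 'C(b, j) * 'C(a - i, al - p) * 'C(b - j, be - q))%N%:Z
            (ncprod [:: Psi_cd (prod_pts (hyp_pts p i) (hyp_pts q j)); vd;
                        Psi_cd (hyp_pts 1 (n - i - j))])
        | j <- iota q.+1 (b - be)]
      | i <- iota p.+1 (a - al)]
    | q <- iota 1 be]
  | p <- iota 1 al].

(* Main.v *)
(* The base polytope Q of a split matroid is the hypersimplex V cut by one half
   space |B & F| <= rk F per proper nonempty cyclic flat F.  The flags of Q and of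
   V are compared through the map from faces of Q to the smallest face of V
   containing them.  A face s of V that is cut by a single flat F contributes as
   in the polytope where only F is cut off, which gives the cuspidal terms.  The
   exceptional faces are those whose intersection with Q lies in the hyperplane
   of F: there the hyperplane of exactly one other flat G coincides with that of
   F, the pair (F, G) is modular, and s & Q is a product of two hypersimplices
   while the faces of V above s form the face lattice of a simplex.  Such a face
   is counted twice in the sum over the flats, and the excess telescopes to
   Psi(s & Q) d Psi(V / s).  The faces of this kind with given F and G are
   encoded by disjoint subsets of F - G and of G - F, whence the binomials. *)
Require Import Defs.
From Stdlib Require Import ClassicalEpsilon.
From HB Require Import structures.
From mathcomp Require Import all_boot all_order all_algebra.
From mathcomp Require Import finmap monalg zify lra.
Set Implicit Arguments. Unset Strict Implicit. Unset Printing Implicit Defensive.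
Import Order.TTheory GRing.Theory Num.Theory.
Local Open Scope ring_scope.

(** * Noncommutative polynomials *)

(** Everything rests on the inequality [#|F :&: G| + k <= rk F + rk G] for distinct flats: a vertex
    of V violates at most one half space, and it is on or beyond two hyperplanes only if the pair is
    modular and it lies on both. Moreover, a hyperplane that separates vertices of a face passes
    through one of them, so cutting creates no new vertices and every face is a set of k-sets. The
    letter d arises with e = a - b: a face that is cut twice contributes with the factor b(b + e) to
    each of its two one-flat polytopes, while in Q only be - eb is left after telescoping, and 2b(b
    + e) - (be - eb) = ab + ba. Connectedness keeps V itself from being exceptional. Since [Psi_cd]
    is a choice, the identity is proved for ab-indices and transferred back. This needs injectivity
    of the substitution and the existence of cd-indices over the integers, hence Euler's relation
    and a division by two. *)

Section Evaluation.
Variables (X : eqType) (R : pzRingType) (g : X -> R).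
Implicit Types p q : ncpoly X.

Definition ev p : R := \sum_(m <- p) (\prod_(x <- m.2) g x) *~ m.1.

Lemma ev_add p q : ev (ncadd p q) = ev p + ev q.
Proof. by rewrite /ev big_cat. Qed.

Lemma ev_scale z p : ev (ncscale z p) = ev p *~ z.
Proof.
rewrite /ev big_map mulrz_suml; apply: eq_bigr => m _ /=.
by rewrite mulrC mulrzA.
Qed.

Lemma ev_sub p q : ev (ncsub p q) = ev p - ev q.
Proof. by rewrite /ncsub -/(ncadd _ _) ev_add ev_scale mulrN1z. Qed.

Lemma ev_one : ev (ncone X) = 1.
Proof. by rewrite /ev big_seq1 big_nil. Qed.

Lemma ev_letter x : ev (ncletter x) = g x.
Proof. by rewrite /ev big_seq1 big_seq1. Qed.

Lemma ev_mul p q : ev (ncmul p q) = ev p * ev q.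
Proof.
rewrite /ev /ncmul big_allpairs_dep mulr_suml; apply: eq_bigr => m _.
rewrite mulr_sumr; apply: eq_bigr => m' _ /=.
by rewrite big_cat /= mulrzAr mulrzAl mulrzA.
Qed.

Lemma ev_sum s : ev (ncsum s) = \sum_(p <- s) ev p.
Proof.
elim: s => [|p s IH]; first by rewrite /ev !big_nil.
by rewrite big_cons -IH /ncsum /= -/(ncadd _ _) ev_add.
Qed.

Lemma ev_prod s : ev (ncprod s) = \prod_(p <- s) ev p.
Proof.
elim: s => [|p s IH]; first by rewrite big_nil ev_one.
by rewrite big_cons /= ev_mul IH.
Qed.

(** Like terms are collected over any duplicate-free list of words covering the support, so that
    evaluation depends on the coefficients only. *)
Lemma ev_nccoef p s : uniq s -> {subset map snd p <= s} ->
  ev p = \sum_(w <- s) (\prod_(x <- w) g x) *~ nccoef p w.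
Proof.
move=> us ps; under eq_bigr => w _ do rewrite /nccoef mulrz_sumr big_mkcond.
rewrite exchange_big /= /ev !big_seq; apply: eq_bigr => m m_in.
rewrite (bigD1_seq m.2) ?ps ?map_f //= eqxx [X in _ + X]big1 ?addr0 // => w.
by rewrite eq_sym => /negbTE ->.
Qed.

Lemma nceq_ev p q : nceq p q -> ev p = ev q.
Proof.
move=> E; pose s := undup (map snd p ++ map snd q).
rewrite !(@ev_nccoef _ s) ?undup_uniq //.
- by apply: eq_bigr => w _; rewrite E.
- by move=> w; rewrite mem_undup mem_cat orbC => ->.
- by move=> w; rewrite mem_undup mem_cat => ->.
Qed.

End Evaluation.

Lemma ev_cd_to_ab (R : pzRingType) (g : abL -> R) phi :
  ev g (cd_to_ab phi) = ev (fun x => ev g (cd_letter_to_ab x)) phi.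
Proof.
rewrite ev_sum big_map; apply: eq_bigr => m _.
by rewrite ev_scale ev_prod big_map.
Qed.

(** The free ring on two letters, as the monoid ring of a free monoid with letters coded by
    booleans. Here [nceq] becomes equality ([nceq_evab]), and later computations are ordinary ring
    rewriting. *)
Definition abring := {malg int[{fmonom bool}]}.
Definition abcode (x : abL) : bool := if x is La then true else false.
Definition abvar (x : abL) : abring := << FMonom [:: abcode x] >>%R.
Definition evab (p : ncpoly abL) : abring := ev abvar p.

Lemma abcode_inj : injective abcode.
Proof. by case; case. Qed.

Lemma mul_malgU (k l : {fmonom bool}) :
  << k >>%R * << l >>%R = << FMonom (k ++ l) >>%R :> abring.
Proof.
rewrite (malgMEw (msuppU_le (x := 1)) (msuppU_le (x := 1))) !big_seq_fset1.
by rewrite !mcoeffUU mulr1 /mmul /= fmmulE.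
Qed.

Lemma prod_abvar (w : seq abL) :
  \prod_(x <- w) abvar x = << FMonom (map abcode w) >>%R :> abring.
Proof.
elim: w => [|x w IH]; last by rewrite big_cons IH mul_malgU.
by rewrite big_nil /=; apply/malgP => k; rewrite mcoeff1 mcoeffU1 -fmoneE eq_sym.
Qed.

Lemma nccoef_evab p w : nccoef p w = (evab p)@_(FMonom (map abcode w)).
Proof.
rewrite /nccoef /evab /ev raddf_sum /= big_mkcond; apply: eq_bigr => m _.
rewrite prod_abvar raddfMz /= mcoeffU1.
have -> : (FMonom (map abcode m.2) == FMonom (map abcode w)) = (m.2 == w).
  by rewrite -val_eqE /= (inj_eq (inj_map abcode_inj)).
by case: eqP => _; rewrite ?mul0rz ?intz.
Qed.

Lemma nceq_evab p q : nceq p q <-> evab p = evab q.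
Proof.
split=> [E|E w]; last by rewrite !nccoef_evab E.
apply/malgP => -[s].
have -> : s = map abcode (map (fun c : bool => if c then La else Lb) s).
  by rewrite -map_comp; elim: s => //= -[] s <-.
by rewrite -!nccoef_evab E.
Qed.

(** * Words in c and d: divisibility of coefficients and injectivity of the substitution *)

Section CdWords.
Implicit Types (phi : ncpoly cdL) (w : seq cdL) (u : seq abL).

(** The left quotient by the letter [x]. A cd-polynomial is its constant term plus c and d times its
    two quotients ([ev_ofirst]), which permits induction on words. *)
Definition ofirst (x : cdL) phi : ncpoly cdL :=
  [seq (m.1, behead m.2) | m <- phi & ohead m.2 == Some x].

Lemma nccoef_ofirst x phi w : nccoef (ofirst x phi) w = nccoef phi (x :: w).
Proof.
rewrite /nccoef /ofirst big_map big_filter_cond.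
by apply: eq_bigl => -[z [|y v]].
Qed.

Lemma nccoef_cons x p u (g : abL) :
  nccoef (ncmul (ncletter g) p) (x :: u) = if x == g then nccoef p u else 0.
Proof.
rewrite /nccoef /ncmul /= cats0 big_map /=.
under eq_bigl => m do rewrite eqseq_cons eq_sym.
by case: eqP => _ /=; [apply: eq_bigr => m _; rewrite mul1r | rewrite big_pred0].
Qed.
Lemma nccoef_cons0 p (g : abL) : nccoef (ncmul (ncletter g) p) [::] = 0.
Proof. by rewrite /nccoef /ncmul /= cats0 big_map /= big_pred0. Qed.

Lemma nccoef_add (X : eqType) (p q : ncpoly X) v :
  nccoef (ncadd p q) v = nccoef p v + nccoef q v.
Proof. by rewrite /nccoef big_cat. Qed.

Lemma ev_ofirst (R : pzRingType) (g : cdL -> R) phi :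
  ev g phi = (nccoef phi [::])%:~R + (g Lc * ev g (ofirst Lc phi)
             + g Ld * ev g (ofirst Ld phi)).
Proof.
elim: phi => [|[z w] phi IH].
  by rewrite /nccoef /ev /= !big_nil !mulr0 !addr0.
have -> : ev g ((z, w) :: phi) = ev g [:: (z, w)] + ev g phi.
  by rewrite -ev_add.
have -> : nccoef ((z, w) :: phi) [::] = nccoef [:: (z, w)] [::] + nccoef phi [::].
  by rewrite -nccoef_add.
have E x : ofirst x ((z, w) :: phi) = ncadd (ofirst x [:: (z, w)]) (ofirst x phi).
  by rewrite /ofirst /=; case: ifP.
rewrite !E !ev_add !mulrDr intrD IH {IH E}.
set t1 := _ * ev g (ofirst Lc phi); set t2 := _ * ev g (ofirst Ld phi).
suff -> : ev g [:: (z, w)] = (nccoef [:: (z, w)] [::])%:~R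
   + (g Lc * ev g (ofirst Lc [:: (z, w)]) + g Ld * ev g (ofirst Ld [:: (z, w)])).
  rewrite addrACA; congr (_ + _); rewrite addrACA //.
case: w => [|[] w]; rewrite /ev /nccoef /ofirst /= ?big_cons ?big_nil /=
  ?big_nil ?mulr0 ?addr0 ?add0r //= ?big_cons ?mulrzAr //.
Qed.

Lemma nceq_ofirst phi : let C := cd_to_ab (ofirst Lc phi) in
  let D := cd_to_ab (ofirst Ld phi) in
  nceq (cd_to_ab phi) (ncadd (ncscale (nccoef phi [::]) (ncone _))
    (ncadd (ncadd (ncmul va C) (ncmul vb C))
           (ncadd (ncmul va (ncmul vb D)) (ncmul vb (ncmul va D))))).
Proof.
move=> C D; apply/nceq_evab; rewrite /evab.
rewrite [RHS]ev_add ev_scale ev_one [X in _ + X]ev_add.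
rewrite [X in _ + (X + _)]ev_add [X in _ + (_ + X)]ev_add !ev_mul.
rewrite ev_cd_to_ab ev_ofirst -!ev_cd_to_ab /cd_letter_to_ab 2!ev_add !ev_mul.
by rewrite !mulrDl !mulrA.
Qed.

Lemma nccoef_cd_to_ab phi u : let C := cd_to_ab (ofirst Lc phi) in
  let D := cd_to_ab (ofirst Ld phi) in
  nccoef (cd_to_ab phi) u = (nccoef phi [::]) * (u == [::])%:R
    + (nccoef (ncmul va C) u + nccoef (ncmul vb C) u
    + (nccoef (ncmul va (ncmul vb D)) u + nccoef (ncmul vb (ncmul va D)) u)).
Proof.
rewrite /= nceq_ofirst nccoef_add [X in _ + X]nccoef_add.
rewrite [X in _ + (X + _)]nccoef_add [X in _ + (_ + X)]nccoef_add.
congr (_ + _); rewrite {1}/nccoef /= big_cons big_nil /= mulr1 eq_sym.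
by case: eqP; rewrite ?addr0 ?mulr1 ?mulr0.
Qed.

Lemma nccoef_cd_to_ab0 phi : nccoef (cd_to_ab phi) [::] = nccoef phi [::].
Proof. by rewrite nccoef_cd_to_ab !nccoef_cons0 mulr1 !addr0. Qed.

Lemma nccoef_cd_to_ab1 phi x :
  nccoef (cd_to_ab phi) [:: x] = nccoef (cd_to_ab (ofirst Lc phi)) [::].
Proof.
rewrite nccoef_cd_to_ab !nccoef_cons !nccoef_cons0 mulr0 add0r.
by case: x => /=; rewrite ?addr0 ?add0r.
Qed.

(** An initial c = a + b consumes one arbitrary letter; an initial d = ab + ba consumes two letters,
    which have to differ. *)
Lemma nccoef_cd_to_ab2 phi x y u :
  nccoef (cd_to_ab phi) [:: x, y & u] = nccoef (cd_to_ab (ofirst Lc phi)) (y :: u)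
    + (if x == y then 0 else nccoef (cd_to_ab (ofirst Ld phi)) u).
Proof.
rewrite nccoef_cd_to_ab !nccoef_cons mulr0 add0r.
by case: x; case: y => /=; rewrite ?addr0 ?add0r.
Qed.

(* Only the words starting with [d] distinguish the coefficients of [a a u] and
   [b a u], so the coefficients of a cd-polynomial can be peeled off letter by
   letter, modulo any [N]. *)
Lemma dvd_nccoef_cd (N : int) phi :
  (forall u, (N %| nccoef (cd_to_ab phi) u)%Z) -> forall w, (N %| nccoef phi w)%Z.
Proof.
move=> H w; elim: w phi H => [|x w IH] phi H; first by rewrite -nccoef_cd_to_ab0.
have HD u : (N %| nccoef (cd_to_ab (ofirst Ld phi)) u)%Z.
  have := rpredB (H [:: Lb, La & u]) (H [:: La, La & u]).
  by rewrite !nccoef_cd_to_ab2 /= addr0 addrAC subrr add0r.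
rewrite -nccoef_ofirst; case: x; last exact: IH.
apply: IH => -[|y u]; first by rewrite -(nccoef_cd_to_ab1 phi La).
(* An initial d never produces a repeated letter, so the word with [y] doubled reads off the
   quotient by c alone. *)
by have := H [:: y, y & u]; rewrite nccoef_cd_to_ab2 eqxx addr0.
Qed.

(** The case N = 0 of [dvd_nccoef_cd], where divisibility means vanishing, applied to the
    difference. This is the uniqueness of the cd-index. *)
Lemma cd_to_ab_inj phi psi :
  nceq (cd_to_ab phi) (cd_to_ab psi) -> nceq phi psi.
Proof.
move=> E w; apply/eqP; rewrite -subr_eq0.
have D p q v : nccoef (ncsub p q) v = nccoef p v - nccoef q v :> int.
  rewrite /ncsub -/(ncadd _ _) nccoef_add; congr (_ + _).
  rewrite /nccoef /ncscale big_map -sumrN; apply: eq_bigr => m _.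
  by rewrite mulN1r.
have := @dvd_nccoef_cd 0 (ncsub phi psi) _ w; rewrite D dvd0z; apply => u.
have /nceq_evab := E; rewrite nccoef_evab /evab !ev_cd_to_ab ev_sub => ->.
by rewrite subrr mcoeff0.
Qed.

(** The case N = 2 of [dvd_nccoef_cd]. Stanley's recursion yields twice the flag index; this lemma
    keeps the cd-index over the integers. *)
Lemma halve_cd phi (x : abring) : x *+ 2 = evab (cd_to_ab phi) ->
  exists psi, evab (cd_to_ab psi) = x.
Proof.
move=> E; have ev2 w : (2 %| nccoef phi w)%Z.
  apply: dvd_nccoef_cd => u; rewrite nccoef_evab -E mcoeffMn.
  by apply/dvdzP; exists (x@_(FMonom (map abcode u))); rewrite mulr_natr.
(* Each word is listed once, so that its coefficient in [psi] is exactly the halved one. *)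
pose psi := [seq ((nccoef phi w %/ 2)%Z, w) | w <- undup (map snd phi)].
have psi2 : nceq (ncscale 2 psi) phi.
  move=> w; rewrite {1}/nccoef !big_map /=.
  have [w_in|w_out] := boolP (w \in undup (map snd phi)).
    rewrite (big_rem w) //= eqxx big1_seq ?addr0 => [|v /andP[/eqP ->]].
      by rewrite mulrC divzK.
    by rewrite mem_rem_uniqF ?undup_uniq.
  rewrite big1_seq => [|v /andP[/eqP -> v_in]]; last by rewrite v_in in w_out.
  rewrite /nccoef big1_seq // => m /andP[/eqP mw m_in].
  by rewrite mem_undup -mw map_f in w_out.
exists psi; have {E} : evab (cd_to_ab psi) *+ 2 = x *+ 2.
  by rewrite E /evab !ev_cd_to_ab -(nceq_ev _ psi2) ev_scale.
by move/malgP => E; apply/malgP => v; have := E v; rewrite !mcoeffMn => /pmulrnI; apply.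
Qed.
End CdWords.

(** * Flag generating functions of graded posets *)

Fact psi_key : unit. Proof. by []. Qed.

Section FlagSum.
Variables (R : pzRingType) (b e : R) (T : finType) (lt : rel T) (d : T -> nat).
Hypotheses (lt_irr : irreflexive lt) (lt_trans : transitive lt).
Implicit Types (P X : {set T}) (x y : T) (m D k : nat).

Definition below P x := [set y in P | lt y x].
Definition above P x := [set y in P | lt x y].

(** Chains are built from the top: [x] is the largest element, the ranks above it contribute [e],
    and the rest is a chain strictly below [x]. The argument [k] is fuel; [#|P|.+1] suffices because
    [below P x] is smaller than [P]. *)
Fixpoint psin k P m D : R :=
  if k is k'.+1 then
    e ^+ (D - m) + \sum_(x in P) psin k' (below P x) m (d x) * b * e ^+ (D - (d x).+1)
  else 0.

(* The generating function of the chains of [P], ranks running over [m, D):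
   each rank contributes the factor [b] if it occurs in the chain, else [e]. *)
Definition psi P m D := locked_with psi_key (psin #|P|.+1 P m D).

Lemma below_proper P x : x \in P -> (#|below P x| < #|P|)%N.
Proof.
move=> xP; apply: proper_card; apply/properP; split.
  by apply/subsetP => y; rewrite inE => /andP[].
by exists x; rewrite // inE lt_irr andbF.
Qed.

Lemma psinE k P m D : (#|P| < k)%N -> psin k P m D = psi P m D.
Proof.
move=> Pk; have [l El Pl] : exists2 l, psi P m D = psin l P m D & (#|P| < l)%N.
  by exists #|P|.+1; rewrite // /psi unlock.
rewrite {}El; elim: k l P D Pl Pk => [|k IH] [|l] P D //= Pl Pk; congr (_ + _).
apply: eq_bigr => x xP; have bx := below_proper xP; congr (_ * _ * _).
by apply: IH; [exact: leq_trans bx Pl | exact: leq_trans bx Pk].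
Qed.

Lemma psi_rec P m D : psi P m D =
  e ^+ (D - m) + \sum_(x in P) psi (below P x) m (d x) * b * e ^+ (D - (d x).+1).
Proof.
rewrite {1}/psi unlock /=; congr (_ + _); apply: eq_bigr => x xP.
by rewrite psinE ?below_proper.
Qed.

Lemma psi0 m D : psi set0 m D = e ^+ (D - m).
Proof. by rewrite psi_rec big_set0 addr0. Qed.

Lemma psi_ind (Q : {set T} -> Prop) :
  (forall P, (forall x, x \in P -> Q (below P x)) -> Q P) -> forall P, Q P.
Proof.
move=> H P; have [l] := ubnP #|P|; elim: l P => // l IH P Pl; apply: H => x xP.
by apply: IH; exact: leq_trans (below_proper xP) Pl.
Qed.

Lemma belowI P x y : lt x y -> below (below P y) x = below P x.
Proof.
move=> xy; apply/setP => z; rewrite !inE -andbA; congr (_ && _).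
by rewrite andbC; case zx: (lt z x) => //=; apply: lt_trans zx xy.
Qed.

Lemma belowD P X x : below (P :\: X) x = below P x :\: X.
Proof. by apply/setP => z; rewrite !inE andbA. Qed.

Lemma below_above P x y : below (above P x) y = above (below P y) x.
Proof. by apply/setP => z; rewrite !inE andbAC. Qed.

(* The chains meeting [X] are sorted by their largest element in [X]. *)
Lemma psi_split_top P X m D : X \subset P -> psi P m D = psi (P :\: X) m D
  + \sum_(x in X) psi (below P x) m (d x) * b * psi (above (P :\: X) x) (d x).+1 D.
Proof.
elim/psi_ind: P X D => P IH X D XP.
rewrite psi_rec [in RHS]psi_rec -addrA; congr (_ + _).
rewrite (bigID (mem X)) /= addrC.
under eq_bigl => x do rewrite andbC -in_setD.
(* For a largest element [y] outside [X], induction applies to the poset below [y]; the chains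
   meeting [X] there are then regrouped by their element [x] of [X]. *)
rewrite (eq_bigr (fun y => psi (below (P :\: X) y) m (d y) * b * e ^+ (D - (d y).+1) +
   \sum_(x in X | lt x y) psi (below P x) m (d x) * b *
     psi (above (below (P :\: X) y) x) (d x).+1 (d y) * b * e ^+ (D - (d y).+1))); last first.
  move=> y; rewrite inE => /andP[yX yP].
  have sX : X :&: below P y \subset below P y by apply: subsetIr.
  rewrite (IH y yP _ _ sX) !mulrDl !mulr_suml; congr (_ * _ * _ + _).
    congr (psi _ _ _); rewrite belowD; apply/setP => z; rewrite !inE.
    by case: (z \in X); case: (z \in P); case: (lt z y).
  rewrite (eq_bigl (fun x => (x \in X) && lt x y)); last first.
    move=> x; rewrite !inE; case: (boolP (x \in X)) => //= xX.
    by rewrite (subsetP XP).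
  apply: eq_bigr => x /andP[xX xy]; congr (_ * _ * psi (above _ x) _ _ * _ * _).
    by rewrite belowI.
  rewrite belowD; apply/setP => z; rewrite !inE.
  by case: (z \in X); case: (z \in P); case: (lt z y).
rewrite big_split /= -addrA; congr (_ + _).
have -> : \sum_(i in P | i \in X) psi (below P i) m (d i) * b * e ^+ (D - (d i).+1) =
   \sum_(i in X) psi (below P i) m (d i) * b * e ^+ (D - (d i).+1).
  apply: eq_bigl => x; rewrite andbC; case: (boolP (x \in X)) => //= xX.
  by rewrite (subsetP XP).
rewrite (exchange_big_dep (mem X)) /=; last by move=> i j _ /andP[].
rewrite -big_split /=; apply: eq_bigr => x xX.
rewrite [in RHS](psi_rec (above _ _)) mulrDr addrC; congr (_ + _).
rewrite mulr_sumr; apply: eq_big => [y|y _]; first by rewrite !inE xX.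
by rewrite -below_above !mulrA.
Qed.

(** The dual of [psi_split_top]: chains meeting [X] are sorted by their smallest element in [X]. The
    induction still removes the largest element of a chain, since [psi] unfolds from the top
    only. *)
Lemma psi_split_low P X m D : X \subset P -> psi P m D = psi (P :\: X) m D
  + \sum_(x in X) psi (below (P :\: X) x) m (d x) * b * psi (above P x) (d x).+1 D.
Proof.
elim/psi_ind: P X D => P IH X D XP.
rewrite psi_rec [in RHS]psi_rec -addrA; congr (_ + _).
rewrite (eq_bigr (fun y => psi (below (P :\: X) y) m (d y) * b * e ^+ (D - (d y).+1) +
   \sum_(x in X | lt x y) psi (below (P :\: X) x) m (d x) * b *
     psi (above (below P y) x) (d x).+1 (d y) * b * e ^+ (D - (d y).+1))); last first.
  move=> y yP.
  have sX : X :&: below P y \subset below P y by apply: subsetIr.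
  rewrite (IH y yP _ _ sX) !mulrDl !mulr_suml; congr (_ * _ * _ + _).
    congr (psi _ _ _); rewrite belowD; apply/setP => z; rewrite !inE.
    by case: (z \in X); case: (z \in P); case: (lt z y).
  rewrite (eq_bigl (fun x => (x \in X) && lt x y)); last first.
    move=> x; rewrite !inE; case: (boolP (x \in X)) => //= xX.
    by rewrite (subsetP XP).
  apply: eq_bigr => x /andP[xX xy]; congr (psi _ _ _ * _ * _ * _ * _).
  apply/setP => z; rewrite !inE; case zx: (lt z x); rewrite ?andbF // ?andbT.
  by rewrite (lt_trans zx xy); case: (z \in X); case: (z \in P).
rewrite big_split /= (bigID (mem X)) /= -addrA addrCA; congr (_ + _).
  by apply: eq_bigl => x; rewrite inE andbC.
have -> : \sum_(i in P | i \in X) psi (below (P :\: X) i) m (d i) * b * e ^+ (D - (d i).+1) =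
   \sum_(i in X) psi (below (P :\: X) i) m (d i) * b * e ^+ (D - (d i).+1).
  apply: eq_bigl => x; rewrite andbC; case: (boolP (x \in X)) => //= xX.
  by rewrite (subsetP XP).
rewrite (exchange_big_dep (mem X)) /=; last by move=> i j _ /andP[].
rewrite -big_split /=; apply: eq_bigr => x xX.
rewrite [in RHS](psi_rec (above _ _)) mulrDr; congr (_ + _).
rewrite mulr_sumr; apply: eq_big => [y|y _]; first by rewrite !inE xX.
by rewrite -below_above !mulrA.
Qed.

Lemma psi_shift_low P m D : (m < D)%N -> {in P, forall x, (m < d x)%N} ->
  psi P m D = e * psi P m.+1 D.
Proof.
elim/psi_ind: P D => P IH D mD dP; rewrite psi_rec [in RHS]psi_rec mulrDr.
rewrite -exprS -subSn // subSS; congr (_ + _).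
rewrite mulr_sumr; apply: eq_bigr => x xP; rewrite !mulrA; congr (_ * _ * _).
by apply: IH => //; [exact: dP | move=> y; rewrite inE => /andP[/dP]].
Qed.

Lemma psi_shift_high P m D : (m <= D)%N -> {in P, forall x, (d x < D)%N} ->
  psi P m D.+1 = psi P m D * e.
Proof.
move=> mD dP; rewrite !psi_rec mulrDl -exprSr -subSn //; congr (_ + _).
rewrite mulr_suml; apply: eq_bigr => x xP; rewrite -[in RHS]mulrA -exprSr -subSn //; exact: dP.
Qed.

(** A minimum can be added to or removed from any chain independently of the rest, so its rank
    contributes [e + b]. *)
Lemma psi_bottom P x D : x \in P -> (d x < D)%N ->
  {in P, forall y, y != x -> lt x y /\ (d x < d y)%N} ->
  psi P (d x) D = (e + b) * psi (above P x) (d x).+1 D.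
Proof.
move=> xP dxD H; have sP : [set x] \subset P by rewrite sub1set.
have PE : P :\: [set x] = above P x.
  apply/setP => y; rewrite !inE; have [->|yx] := eqVneq y x; first by rewrite lt_irr andbF.
  by case: (boolP (y \in P)) => //= yP; case: (H y yP yx) => ->.
rewrite (psi_split_low _ _ sP) big_set1 PE mulrDl; congr (_ + _).
  apply: psi_shift_low => // y; rewrite inE => /andP[yP xy].
  by case: (H y yP) => //; apply: contraTneq xy => ->; rewrite lt_irr.
have -> : below (above P x) x = set0.
  apply/setP => y; rewrite !inE; apply/negP => /andP[/andP[_ xy] yx].
  by have := lt_trans xy yx; rewrite lt_irr.
by rewrite psi0 subnn mul1r.
Qed.

Definition chain (C : {set T}) :=
  [forall x in C, forall y in C, [|| x == y, lt x y | lt y x]].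
Definition flagwt m D (C : {set T}) : R :=
  \prod_(i <- iota m (D - m)) (if i \in [seq d x | x <- enum C] then b else e).

Lemma chainP (C : {set T}) : reflect {in C &, forall x y, [|| x == y, lt x y | lt y x]} (chain C).
Proof.
apply: (iffP forall_inP) => H x.
  by move=> y xC yC; exact: (forall_inP (H x xC)).
by move=> xC; apply/forall_inP => y yC; apply: H.
Qed.

Lemma flagwt_add m D P x (C : {set T}) : {in P &, forall y z, lt y z -> (d y < d z)%N} ->
  x \in P -> C \subset below P x -> (m <= d x < D)%N ->
  flagwt m D (x |: C) = flagwt m (d x) C * b * e ^+ (D - (d x).+1).
Proof.
move=> dP xP CP /andP[mx xD]; rewrite /flagwt.
have memE i : (i \in [seq d z | z <- enum (x |: C)]) =
    (i == d x) || (i \in [seq d z | z <- enum C]).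
  apply/mapP/orP => [[z]|[/eqP ->|/mapP[z zC ->]]].
  - rewrite mem_enum => /setU1P[-> ->|zC ->]; [by left | right].
    by rewrite map_f // mem_enum.
  - by exists x; rewrite // mem_enum setU11.
  by exists z; rewrite // mem_enum setU1r //; rewrite mem_enum in zC.
have Clt i : i \in [seq d z | z <- enum C] -> (i < d x)%N.
  case/mapP => z; rewrite mem_enum => /(subsetP CP); rewrite inE => /andP[zP zx] ->.
  exact: dP.
have -> : (D - m = (d x - m) + (D - (d x).+1).+1)%N.
  by rewrite -subSn // subSS addnC addnBA // subnK // ltnW.
rewrite iotaD big_cat /= subnKC // big_cons memE eqxx /= -mulrA; congr (_ * (_ * _)).
  rewrite !big_seq; apply: eq_bigr => i; rewrite mem_iota subnKC // => /andP[_ ix].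
  by rewrite memE ltn_eqF.
rewrite big_seq (eq_bigr (fun=> e)) => [|i]; last first.
  rewrite mem_iota memE => /andP[xi _]; rewrite gtn_eqF //=.
  by case: ifP => // /Clt /ltn_geF; rewrite ltnW.
by rewrite -big_seq big_const_seq count_predT size_iota iter_mulr_1.
Qed.

(** Ties the recursion to the literal sum over chains by grouping the nonempty chains according to
    their largest element. *)
Lemma sum_flagwt m D P : {in P &, forall y z, lt y z -> (d y < d z)%N} ->
  {in P, forall x, (m <= d x < D)%N} ->
  \sum_(C : {set T} | (C \subset P) && chain C) flagwt m D C = psi P m D.
Proof.
elim/psi_ind: P D => P IH D lt_d dP.
have chain0 : chain set0 by apply/chainP => x; rewrite inE.
rewrite (bigD1 set0) ?sub0set //= psi_rec; congr (_ + _).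
  rewrite /flagwt enum_set0 /= big_const_seq count_predT size_iota.
  by rewrite iter_mulr_1.
(* The largest element of [C]; it is the one of maximal rank, so it exists and is unique in a
   nonempty chain. *)
pose top (C : {set T}) x := (x \in C) && [forall y in C, (y == x) || lt y x].
have topP (C : {set T}) : (C \subset P) && chain C -> C != set0 -> exists2 x, x \in C &
    forall z, top C z = (z == x).
  case/andP => CP /chainP chC /set0Pn[x0 x0C].
  case: (@arg_maxnP _ x0 (mem C) d x0C) => x xC xmax; exists x => // z.
  apply/andP/eqP => [[zC /forall_inP/(_ x xC)]|->].
    case/predU1P => // xz; have := lt_d x z (subsetP CP x xC) (subsetP CP z zC) xz.
    by rewrite ltnNge (xmax z zC : (d z <= d x)%N).
  split=> //; apply/forall_inP => y yC; case/or3P: (chC y x yC xC) => [->||xy] //.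
    by move=> ->; rewrite orbT.
  have := lt_d x y (subsetP CP x xC) (subsetP CP y yC) xy.
  by rewrite ltnNge (xmax y yC : (d y <= d x)%N).
rewrite (eq_bigr (fun C => \sum_(x in P | top C x) flagwt m D C)); last first.
  move=> C /andP[CPch C0]; have [x xC tE] := topP C CPch C0.
  rewrite (eq_bigl (pred1 x)) ?big_pred1_eq // => z /=; rewrite tE.
  by case: eqP => [->|]; rewrite ?andbF // andbT (subsetP (proj1 (andP CPch))).
rewrite (exchange_big_dep (mem P)) /=; last by move=> C x _ /andP[].
apply: eq_bigr => x xP.
have sbP : below P x \subset P by apply/subsetP => y; rewrite inE => /andP[].
rewrite -IH //; first last.
- by move=> y; rewrite inE => /andP[yP yx]; case/andP: (dP y yP) => -> _; exact: lt_d.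
- by move=> y z /(subsetP sbP) yP /(subsetP sbP); apply: lt_d.
rewrite !mulr_suml (reindex_onto (fun C => x |: C) (fun C => C :\ x)) /=; last first.
  by move=> C /andP[_ /andP[_ /andP[xC _]]]; rewrite setD1K.
apply: eq_big => [C|C]; last first.
  case/andP => /andP[/andP[/andP[xCP _] _] /andP[_ /andP[_ tC]]] /eqP CE.
  apply: (@flagwt_add _ _ P) => //; last exact: dP.
  apply/subsetP => y yC; rewrite inE (subsetP xCP) ?setU1r //=.
  move/forall_inP: tC => /(_ y); rewrite setU1r // => /(_ isT)/predU1P[yx|//].
  by move: yC; rewrite -CE yx !inE eqxx.
have -> : (x |: C != set0) by apply/set0Pn; exists x; rewrite setU11.
rewrite andbT xP /= /top setU11 /=; apply/idP/idP.
  case/andP => /andP[/andP[xCP chC] tC] /eqP CE.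
  have Cb : C \subset below P x.
    apply/subsetP => y yC; rewrite inE (subsetP xCP) ?setU1r //=.
    move/forall_inP: tC => /(_ y); rewrite setU1r // => /(_ isT)/predU1P[yx|//].
    by move: yC; rewrite -CE yx !inE eqxx.
  rewrite Cb; apply/chainP => y z yC zC; apply: (chainP _ chC); exact: setU1r.
case/andP => Cb /chainP chC.
have xC : x \notin C by apply/negP => /(subsetP Cb); rewrite inE lt_irr andbF.
have bx y : y \in C -> lt y x by move/(subsetP Cb); rewrite inE => /andP[].
rewrite setU1K // eqxx andbT subUset sub1set xP (subset_trans Cb sbP) /=.
apply/andP; split; last first.
  by apply/forall_inP => y /setU1P[->|/bx ->]; rewrite ?eqxx ?orbT.
apply/chainP => y z /setU1P[->|yC] /setU1P[->|zC]; rewrite ?eqxx // ?bx ?orbT //.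
exact: chC.
Qed.

End FlagSum.

(** The translation of ranks by [s] is there for the faces above a given face, whose ranks do not
    start at 0. *)
Lemma psi_iso (R : pzRingType) (b e : R) (T1 T2 : finType) (lt1 : rel T1) (lt2 : rel T2)
    (d1 : T1 -> nat) (d2 : T2 -> nat) (h : T1 -> T2) (s : nat) (P : {set T1}) m D :
    irreflexive lt1 -> irreflexive lt2 ->
    {in P &, injective h} -> {in P &, forall x y, lt2 (h x) (h y) = lt1 x y} ->
    {in P, forall x, d1 x = s + d2 (h x)}%N ->
  psi b e lt1 d1 P (s + m) (s + D) = psi b e lt2 d2 (h @: P) m D.
Proof.
move=> irr1 irr2; elim/(psi_ind irr1): P D => P IH D inj_h lt_h d_h.
rewrite !psi_rec // subnDl big_imset //=; congr (_ + _).
apply: eq_bigr => x xP; rewrite d_h // -addnS subnDl; congr (_ * _ * _).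
have sP : {subset below lt1 P x <= P} by move=> y; rewrite inE => /andP[].
rewrite IH //; try by move=> y z /sP yP /sP zP; auto.
  congr (psi _ _ _ _ _ _ _); apply/setP => y; apply/imsetP/idP.
    by case=> z; rewrite inE => /andP[zP zx] ->; rewrite inE imset_f //= lt_h.
  rewrite inE => /andP[/imsetP[z zP ->]]; rewrite lt_h // => zx.
  by exists z; rewrite // inE zP.
by move=> y /sP /d_h.
Qed.

Lemma psi_iso0 (R : pzRingType) (b e : R) (T1 T2 : finType) (lt1 : rel T1) (lt2 : rel T2)
    (d1 : T1 -> nat) (d2 : T2 -> nat) (h : T1 -> T2) (P : {set T1}) m D :
    irreflexive lt1 -> irreflexive lt2 ->
    {in P &, injective h} -> {in P &, forall x y, lt2 (h x) (h y) = lt1 x y} ->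
    {in P, forall x, d1 x = d2 (h x)} ->
  psi b e lt1 d1 P m D = psi b e lt2 d2 (h @: P) m D.
Proof. exact: (@psi_iso R b e T1 T2 lt1 lt2 d1 d2 h 0%N P m D). Qed.

(** * Faces of polytopes and Euler's relation *)

Section LinearForms.
Variable n : nat.
Implicit Types (c x y : 'rV[rat]_n) (U W : {vspace 'rV[rat]_n}).

Lemma dotvE c x : dotv c x = \sum_i c 0 i * x 0 i.
Proof. by rewrite /dotv mxE; apply: eq_bigr => i _; rewrite mxE. Qed.

Lemma dotvDr c x y : dotv c (x + y) = dotv c x + dotv c y.
Proof. by rewrite /dotv linearD /= mulmxDr mxE. Qed.
Lemma dotvZr a c x : dotv c (a *: x) = a * dotv c x.
Proof. by rewrite /dotv linearZ /= -scalemxAr mxE. Qed.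
Lemma dotvBr c x y : dotv c (x - y) = dotv c x - dotv c y.
Proof. by rewrite dotvDr -scaleN1r dotvZr mulN1r. Qed.
Lemma dotvDl c c' x : dotv (c + c') x = dotv c x + dotv c' x.
Proof. by rewrite /dotv mulmxDl mxE. Qed.
Lemma dotvZl a c x : dotv (a *: c) x = a * dotv c x.
Proof. by rewrite /dotv -scalemxAl mxE. Qed.
Lemma dotvBl c c' x : dotv (c - c') x = dotv c x - dotv c' x.
Proof. by rewrite dotvDl -scaleN1r dotvZl mulN1r. Qed.
Lemma dotv0l x : dotv 0 x = 0.
Proof. by rewrite /dotv mul0mx mxE. Qed.

Lemma dotv_span c (s : seq 'rV[rat]_n) x :
  (forall y, y \in s -> dotv c y = 0) -> x \in <<s>>%VS -> dotv c x = 0.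
Proof.
move=> cs; rewrite -[s]/(val (in_tuple s)) => /coord_span ->.
elim/big_ind: _ => [|y z Ey Ez|i _].
- by rewrite -(scale0r 0) dotvZr mul0r.
- by rewrite dotvDr Ey Ez addr0.
by rewrite dotvZr cs ?mulr0 // mem_nth // size_tuple.
Qed.

(** Project along [U] onto a complement and take a coordinate in which the image of [x] does not
    vanish. *)
Lemma dotv_sep U x : x \notin U ->
  exists2 c, forall y, y \in U -> dotv c y = 0 & dotv c x != 0.
Proof.
move=> xU; pose p y := y - projv U y.
have [j pj] : exists j, p x 0 j != 0.
  apply/existsP; rewrite -negb_forall; apply: contra xU => /forallP px.
  have /eqP : p x = 0 by apply/rowP => j; rewrite (eqP (px j)) mxE.
  by rewrite subr_eq0 => /eqP ->; apply: memv_proj.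
pose c : 'rV[rat]_n := \row_i p (delta_mx 0 i) 0 j.
have cE y : dotv c y = p y 0 j.
  rewrite dotvE [in RHS](row_sum_delta y) /p linear_sum -sumrB summxE.
  by apply: eq_bigr => i _; rewrite linearZ /= -scalerBr mulrC !mxE.
by exists c => [y yU|]; rewrite cE // /p projv_id // subrr mxE.
Qed.

Lemma dim_add_vline x U : x \notin U -> \dim (<[x]> + U) = (\dim U).+1.
Proof.
move=> xU; have x0 : x != 0 by apply: contraNneq xU => ->; rewrite mem0v.
rewrite dimv_disjoint_sum ?dim_vline ?x0 //; apply/eqP; rewrite -subv0.
apply/subvP => y; rewrite memv_cap memv0 => /andP[/vlineP[a ->]].
apply: contraLR; rewrite scaler_eq0 negb_or => /andP[a0 _].
by apply: contra xU => /(memvZ a^-1); rewrite scalerA mulVf // scale1r.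
Qed.

Lemma dim_add_vline_le x U : (\dim (<[x]> + U) <= (\dim U).+1)%N.
Proof.
have := (dimv_add_leqif <[x]> U).1; rewrite dim_vline => /leq_trans; apply.
by case: (x == 0) => /=; rewrite ?add0n ?add1n.
Qed.

End LinearForms.

(** The quantitative part of the perturbation arguments: on a finite set a large multiple of a
    positive function dominates any other. *)
Lemma exists_large (T : finType) (A : {set T}) (g h : T -> rat) :
  {in A, forall u, 0 < h u} -> exists2 N, 0 < N & {in A, forall u, g u < N * h u}.
Proof.
(* The leading 1 makes the estimate strict and covers an empty [A]. *)
move=> h0; exists (1 + \sum_(u in A) `|g u| / h u) => [|u uA].
  by rewrite ltr_wpDr // sumr_ge0 // => u uA; rewrite divr_ge0 // ltW // h0.
rewrite (bigD1 u) //= -ltr_pdivrMr ?h0 // addrCA.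
apply: (@le_lt_trans _ _ (`|g u| / h u)).
  by rewrite ler_pM2r ?invr_gt0 ?h0 // ler_norm.
rewrite ltrDl ltr_wpDr // sumr_ge0 // => v /andP[vA _].
by rewrite divr_ge0 // ltW // h0.
Qed.

Lemma asbP (P : Prop) : reflect P (asb P).
Proof. by rewrite /asb; case: excluded_middle_informative => ?; constructor. Qed.

Section Faces.
Variables (n : nat) (T : finType) (f : T -> 'rV[rat]_n).
Implicit Types (V Y Z : {set T}) (c : 'rV[rat]_n) (M : rat).

(** Faces are taken of an arbitrary family [V] of indices, so that a face can serve as a polytope in
    turn. The empty face is not among the [faces] of a nonempty [V]. *)
Definition argm V c := [set t in V | [forall u in V, dotv c (f u) <= dotv c (f t)]].
Definition faces V := [set Y | asb (exists c, Y = argm V c)].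
Definition pfaces V := faces V :\ V.

Lemma argmP V c : V != set0 -> exists M,
  {in V, forall u, (dotv c (f u) <= M) /\ ((dotv c (f u) == M) = (u \in argm V c))}.
Proof.
case/set0Pn => t0 t0V; exists (dotv c (f [arg max_(t > t0 in V) dotv c (f t)]%O)).
case: arg_maxP => // t tV tmax u uV; split; first exact: tmax.
rewrite inE uV; apply/eqP/forall_inP => [-> v vV|H]; first exact: tmax.
by apply: le_anti; rewrite H // andbT; apply: tmax.
Qed.

(** The certificate for faces used throughout: a bound valid on [V] and attained exactly on [Y]. *)
Lemma argm_eq V c M Y : Y != set0 -> Y \subset V ->
  {in V, forall u, (dotv c (f u) <= M) /\ ((dotv c (f u) == M) = (u \in Y))} ->
  argm V c = Y.
Proof.
case/set0Pn => y yY YV H; have yM : dotv c (f y) = M.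
  by apply/eqP; case: (H y (subsetP YV y yY)) => _ ->.
apply/setP => t; rewrite inE; have [tV|] /= := boolP (t \in V); last first.
  by move=> tV; apply/esym/negbTE; apply: contra tV; apply: (subsetP YV).
have [tM <-] := H t tV; apply/forall_inP/eqP => [Ht|-> u /H[]//].
by apply: le_anti; rewrite tM -yM Ht // (subsetP YV).
Qed.

Lemma argm_sub V c : argm V c \subset V.
Proof. by apply/subsetP => t; rewrite inE => /andP[]. Qed.

Lemma argm_neq0 V c : V != set0 -> argm V c != set0.
Proof.
move=> V0; have [M HM] := argmP c V0; case/set0Pn: (V0) => t0 t0V.
apply/set0Pn; exists [arg max_(t > t0 in V) dotv c (f t)]%O.
case: arg_maxP => // t tV tmax.
by rewrite inE tV; apply/forall_inP => u uV; apply: tmax.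
Qed.

Lemma facesP V Y : reflect (exists c, Y = argm V c) (Y \in faces V).
Proof. by rewrite inE; apply: asbP. Qed.

Lemma faces_sub V Y : Y \in faces V -> Y \subset V.
Proof. by case/facesP => c ->; apply: argm_sub. Qed.

Lemma faces_neq0 V Y : V != set0 -> Y \in faces V -> Y != set0.
Proof. by move=> V0 /facesP[c ->]; apply: argm_neq0. Qed.

Lemma faces_refl V : V \in faces V.
Proof.
apply/facesP; exists 0; apply/esym/setP => t; rewrite inE.
by rewrite andb_idr // => _; apply/forall_inP => u _; rewrite !dotv0l.
Qed.

Lemma faces_restrict V Y Z : Y != set0 -> Y \in faces V -> Y \subset Z -> Z \subset V ->
  Y \in faces Z.
Proof.
move=> Y0 /facesP[c Ec] YZ ZV; apply/facesP; exists c.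
have V0 : V != set0 by case/set0Pn: Y0 => y /(subsetP YZ)/(subsetP ZV) ?; apply/set0Pn; exists y.
have [M HM] := argmP c V0; apply/esym; apply: (@argm_eq _ _ M) => // u /(subsetP ZV).
by rewrite Ec; apply: HM.
Qed.

(** If [c1] cuts out [Z] in [V] and [c2] cuts out [Y] in [Z], then [N c1 + c2] cuts out [Y] in [V]
    for large [N]. *)
Lemma faces_trans V Y Z : V != set0 -> Z \in faces V -> Y \in faces Z -> Y \in faces V.
Proof.
move=> V0 ZV YZ; have Z0 := faces_neq0 V0 ZV; have Y0 := faces_neq0 Z0 YZ.
have sZV := faces_sub ZV; have sYZ := faces_sub YZ.
case/facesP: ZV => c1 E1; case/facesP: YZ => c2 E2.
have [M1 H1] := argmP c1 V0; have [M2 H2] := argmP c2 Z0.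
rewrite -E1 in H1; rewrite -E2 in H2.
pose g u := dotv c2 (f u) - M2; pose h u := M1 - dotv c1 (f u).
have [u|N N0 HN] := @exists_large _ (V :\: Z) g h.
  rewrite inE => /andP[uZ uV]; have [le1 eq1] := H1 u uV.
  by rewrite subr_gt0 lt_neqAle le1 eq1 uZ.
apply/facesP; exists (N *: c1 + c2); apply/esym.
apply: (@argm_eq _ _ (N * M1 + M2)) => // [|u uV]; first exact: subset_trans sYZ sZV.
rewrite dotvDl dotvZl; have [uZ|uZ] := boolP (u \in Z).
  have [_] := H1 u uV; rewrite uZ => /eqP ->; have [le2 <-] := H2 u uZ.
  by rewrite lerD2l (inj_eq (addrI _)).
have := HN u; rewrite inE uZ uV /g /h mulrBr => /(_ isT) lt12.
have lt3 : N * dotv c1 (f u) + dotv c2 (f u) < N * M1 + M2 by lra.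
rewrite (ltW lt3) lt_eqF //; split=> //; apply/esym/negbTE.
by apply: contra uZ; apply: (subsetP sYZ).
Qed.

Lemma faces_faces V Z : V != set0 -> Z \in faces V ->
  faces Z = [set Y in faces V | Y \subset Z].
Proof.
move=> V0 ZV; have Z0 := faces_neq0 V0 ZV; apply/setP => Y; rewrite in_set.
apply/idP/andP => [YZ|[YV YZ]]; first by rewrite (faces_trans V0 ZV) // (faces_sub YZ).
by apply: faces_restrict YZ (faces_sub ZV); first exact: faces_neq0 YV.
Qed.

Lemma pfaces_faces V Z : V != set0 -> Z \in faces V ->
  pfaces Z = [set Y in pfaces V | Y \proper Z].
Proof.
move=> V0 ZV; rewrite /pfaces (faces_faces V0 ZV); apply/setP => Y.
rewrite in_setD1 in_set [RHS]in_set in_setD1 properEneq [RHS]andbC -!andbA.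
case: (boolP (Y != Z)) => //= YZ; case: (boolP (Y \subset Z)) => sYZ; rewrite ?andbF // andbT /=.
case: eqVneq => //= YV; apply: contraNF YZ => _; rewrite eqEsubset sYZ.
by rewrite YV (faces_sub ZV).
Qed.

(** The base point picked in [fdim] is immaterial: differences to one point are combinations of
    differences to another. *)
Lemma fdimE Y t0 : t0 \in Y ->
  fdim f Y = \dim <<[seq f u - f t0 | u <- enum Y]>>%VS.
Proof.
rewrite /fdim; case: pickP => [t1 t1Y t0Y|/(_ t0) /= -> //]; congr (\dim _).
suff H t t' : t \in Y -> t' \in Y -> (<<[seq (f u - f t)%R | u <- enum Y]>> <=
     <<[seq (f u - f t')%R | u <- enum Y]>>)%VS.
  by apply/eqP; rewrite eqEsubv !H.
move=> tY t'Y; apply/span_subvP => x /mapP[u]; rewrite mem_enum => uY {x}->.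
rewrite -(subrKA (f t')) -[f t' - _]opprB.
have inW v : v \in Y -> f v - f t' \in <<[seq (f u - f t')%R | u <- enum Y]>>%VS.
  by move=> vY; apply/memv_span/mapP; exists v; rewrite ?mem_enum.
by apply: memvD; rewrite ?memvN inW.
Qed.

Lemma fdim0 : fdim f set0 = 0%N.
Proof. by rewrite /fdim; case: pickP => // x; rewrite inE. Qed.

Lemma fdimS Y Z : Y \subset Z -> (fdim f Y <= fdim f Z)%N.
Proof.
move=> YZ; have [->|[t0 tY]] := set_0Vmem Y; first by rewrite fdim0.
rewrite (fdimE tY) (fdimE (subsetP YZ t0 tY)); apply/dimvS/sub_span => x /mapP[u].
by rewrite mem_enum => /(subsetP YZ) uZ {x}->; apply/mapP; exists u; rewrite ?mem_enum.
Qed.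

(** The functional [c] vanishes on all directions of [Y] but not on the direction towards [z]. *)
Lemma fdim_lt Y Z c M z : Y != set0 -> Y \subset Z ->
  {in Y, forall u, dotv c (f u) = M} -> z \in Z -> dotv c (f z) != M ->
  (fdim f Y < fdim f Z)%N.
Proof.
case/set0Pn => t0 tY YZ cY zZ cz.
rewrite (fdimE tY) (fdimE (subsetP YZ t0 tY)) ltn_neqAle andbC dimvS /=; last first.
  apply/sub_span => x /mapP[u].
  by rewrite mem_enum => /(subsetP YZ) uZ {x}->; apply/mapP; exists u; rewrite ?mem_enum.
set W := <<_>>%VS; set W' := <<_>>%VS; apply/negP => /eqP dW.
have WW' : (W <= W')%VS.
  apply/sub_span => x /mapP[u].
  by rewrite mem_enum => /(subsetP YZ) uZ {x}->; apply/mapP; exists u; rewrite ?mem_enum.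
have /eqP E : W == W' by rewrite eqEdim WW' dW leqnn.
have : f z - f t0 \in W by rewrite E; apply/memv_span/mapP; exists z; rewrite ?mem_enum.
move/dotv_span => /(_ c) => H; move: cz; rewrite -(cY t0 tY) -subr_eq0 -dotvBr H ?eqxx //.
by move=> x /mapP[u]; rewrite mem_enum => uY {x}->; rewrite dotvBr !cY ?subrr.
Qed.

Lemma fdim_face_lt V Y Z : V != set0 -> Y \in faces V -> Y \proper Z -> Z \subset V ->
  (fdim f Y < fdim f Z)%N.
Proof.
move=> V0 YV /properP[YZ [z zZ zY]] ZV; case/facesP: (YV) => c Ec.
have [M HM] := argmP c V0; rewrite -Ec in HM.
apply: (@fdim_lt _ _ c M z) => // [|u uY|]; first exact: faces_neq0 YV.
  by apply/eqP; rewrite (HM u _).2 ?uY // (subsetP (faces_sub YV)).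
by rewrite (HM z _).2 // (subsetP ZV).
Qed.

End Faces.

(** * Euler characteristics of cones of linear forms *)

Section ConeEuler.
Variables (n : nat) (T : finType) (v : T -> 'rV[rat]_n).
Implicit Types (X Y Z M P N : {set T}) (w : T).

Definition rk_at X : nat := \dim <<[seq v t | t <- enum X]>>%VS.

Definition signed (Z P N : {set T}) := exists c,
  [/\ {in Z, forall t, dotv c (v t) = 0}, {in P, forall t, 0 < dotv c (v t)}
    & {in N, forall t, dotv c (v t) < 0}].

(* Up to sign, the Euler characteristic of the cone of the linear forms that
   vanish on [Y], are positive on [P] and nonpositive on [M]: its open cells are
   indexed by the subset [X] of [M] on which the form vanishes. *)
Definition euler_cone Y P M : int :=
  \sum_(X : {set T} | X \subset M)
     (if asb (signed (Y :|: X) P (M :\: X)) then (-1) ^+ rk_at (Y :|: X) else 0).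

Lemma dim_setU1 w X : <<[seq v t | t <- enum (w |: X)]>>%VS =
  (<[v w]> + <<[seq v t | t <- enum X]>>)%VS.
Proof.
rewrite -span_cons; apply/eq_span => x; rewrite inE.
apply/mapP/predU1P => [[t]|[->|/mapP[t]]].
- rewrite mem_enum => /setU1P[->|tX] ->; [by left | right].
  by apply/mapP; exists t; rewrite ?mem_enum.
- by exists w; rewrite // mem_enum setU11.
- by rewrite mem_enum => tX ->; exists t; rewrite // mem_enum setU1r.
Qed.

Lemma mem_span_at X t : t \in X -> v t \in <<[seq v t | t <- enum X]>>%VS.
Proof. by move=> tX; apply/memv_span/mapP; exists t; rewrite ?mem_enum. Qed.

(** By independence some form [c1] vanishes on [Z] but not at [w]. Adding it to or subtracting it
    from a large multiple of [c] moves to either side of the hyperplane of [w] without disturbing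
    the other strict signs. *)
Lemma signed_perturb w Z P N : signed Z P N ->
  v w \notin <<[seq v t | t <- enum Z]>>%VS -> signed (w |: Z) P N ->
  signed Z P (w |: N) /\ signed Z (w |: P) N.
Proof.
move=> _ wZ [c [cZ cP cN]].
have [c1 c1Z c1w] := dotv_sep wZ.
wlog c1w0 : c1 c1Z c1w / 0 < dotv c1 (v w).
  move=> H; have := c1w; rewrite neq_lt => /orP[c1n|]; last exact: H.
  apply: (H (-1 *: c1)) => [y yZ||]; rewrite dotvZl mulN1r ?oppr_eq0 ?oppr_gt0 //.
  by rewrite c1Z ?oppr0.
have [t|K K0 HK] := @exists_large _ (P :|: N) (fun t => `|dotv c1 (v t)|)
    (fun t => `|dotv c (v t)|).
  by rewrite inE normr_gt0 neq_lt => /orP[/cP|/cN] ->; rewrite ?orbT.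
have cw : dotv c (v w) = 0 by apply: cZ; rewrite setU11.
have c0 t : t \in Z -> dotv c (v t) = 0 by move=> tZ; apply: cZ; rewrite setU1r.
have d0 t : t \in Z -> dotv c1 (v t) = 0 by move=> tZ; apply: c1Z; apply: mem_span_at.
have KP t : t \in P -> `|dotv c1 (v t)| < K * dotv c (v t).
  by move=> tP; have := HK t; rewrite inE tP (gtr0_norm (cP t tP)); apply.
have KN t : t \in N -> `|dotv c1 (v t)| < - (K * dotv c (v t)).
  by move=> tN; have := HK t; rewrite inE tN orbT (ltr0_norm (cN t tN)) mulrN; apply.
have bnd (x y : rat) : `|x| < y -> - y < x /\ x < y by rewrite ltr_norml => /andP.
split.
  exists (K *: c - c1); split=> t.
  - by move=> tZ; rewrite dotvBl dotvZl c0 ?d0 // mulr0 subrr.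
  - by move=> /KP/bnd[_]; rewrite dotvBl dotvZl subr_gt0.
  - case/setU1P => [->|/KN/bnd[]]; rewrite dotvBl dotvZl.
      by rewrite cw mulr0 sub0r oppr_lt0.
    by rewrite opprK subr_lt0.
exists (K *: c + c1); split=> t.
- by move=> tZ; rewrite dotvDl dotvZl c0 ?d0 // mulr0 addr0.
- case/setU1P => [->|/KP/bnd[H _]]; rewrite dotvDl dotvZl.
    by rewrite cw mulr0 add0r.
  by rewrite -(ltrD2l (K * dotv c (v t))) subrr in H.
- by move=> /KN/bnd[_]; rewrite dotvDl dotvZl -subr_gt0 => H; lra.
Qed.

(** Cells are convex: the combination of both forms with positive weights that vanishes at [w] keeps
    the other signs. *)
Lemma signed_convex w Z P N : signed Z P (w |: N) -> signed Z (w |: P) N ->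
  signed (w |: Z) P N.
Proof.
move=> [c [cZ cP cN]] [c' [cZ' cP' cN']].
have cw : dotv c (v w) < 0 by apply: cN; rewrite setU11.
have cw' : 0 < dotv c' (v w) by apply: cP'; rewrite setU11.
exists (dotv c' (v w) *: c - dotv c (v w) *: c'); split=> t.
- case/setU1P => [->|tZ]; rewrite dotvBl !dotvZl; first by rewrite mulrC subrr.
  by rewrite (cZ t tZ) (cZ' t tZ) !mulr0 subrr.
- move=> tP; rewrite dotvBl !dotvZl subr_gt0 (@lt_trans _ _ 0) //.
    by rewrite nmulr_rlt0 // (cP' t) // setU1r.
  by rewrite mulr_gt0 // (cP t).
- move=> tN; rewrite dotvBl !dotvZl subr_lt0 (@lt_trans _ _ 0) //.
    by rewrite pmulr_rlt0 // (cN t) // setU1r.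
  by rewrite nmulr_rgt0 // (cN' t).
Qed.

Lemma signed_w w Z P N : signed Z P N ->
  [\/ signed (w |: Z) P N, signed Z P (w |: N) | signed Z (w |: P) N].
Proof.
move=> [c [cZ cP cN]]; have [cw|cw|cw] := ltgtP (dotv c (v w)) 0.
- by apply: Or32; exists c; split=> // t /setU1P[->|/cN].
- by apply: Or33; exists c; split=> // t /setU1P[->|/cP].
- by apply: Or31; exists c; split=> // t /setU1P[->|/cZ].
Qed.

Lemma signedS Z P N (Z' P' N' : {set T}) : Z' \subset Z -> P' \subset P -> N' \subset N ->
  signed Z P N -> signed Z' P' N'.
Proof.
move=> sZ sP sN [c [cZ cP cN]]; exists c.
by split=> t; [move/(subsetP sZ)/cZ | move/(subsetP sP)/cP | move/(subsetP sN)/cN].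
Qed.

(* An open cell is either not met, contained in, or cut by a hyperplane into two
   cells of the same dimension and one of dimension one less. *)
Lemma cell_subdivision w Z P N :
  (if asb (signed (w |: Z) P N) then (-1) ^+ rk_at (w |: Z) else 0) +
  (if asb (signed Z P (w |: N)) then (-1) ^+ rk_at Z else 0) =
  (if asb (signed Z P N) then (-1) ^+ rk_at Z else 0) -
  (if asb (signed Z (w |: P) N) then (-1) ^+ rk_at Z else 0) :> int.
Proof.
have S0 : signed (w |: Z) P N -> signed Z P N by apply: signedS => //; apply: subsetUr.
have SN : signed Z P (w |: N) -> signed Z P N by apply: signedS => //; apply: subsetUr.
have SP : signed Z (w |: P) N -> signed Z P N by apply: signedS => //; apply: subsetUr.
(* If [v w] depends on [Z], every form of the cell vanishes at [w]: both open sides are empty and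
   the rank is unchanged. *)
have [wZ|wZ] := boolP (v w \in <<[seq v t | t <- enum Z]>>%VS).
  have rkE : rk_at (w |: Z) = rk_at Z.
    by rewrite /rk_at dim_setU1; congr (\dim _); apply/addv_idPr; rewrite -memvE.
  have zero c : {in Z, forall t, dotv c (v t) = 0} -> dotv c (v w) = 0.
    move=> cZ; apply: dotv_span wZ => y /mapP[t]; rewrite mem_enum => tZ ->; exact: cZ.
  have -> : asb (signed Z P (w |: N)) = false.
    apply/asbP => -[c [cZ _ cN]]; have := cN w; rewrite setU11 zero // ltxx.
    by move/(_ isT).
  have -> : asb (signed Z (w |: P) N) = false.
    apply/asbP => -[c [cZ cP _]]; have := cP w; rewrite setU11 zero // ltxx.
    by move/(_ isT).
  rewrite rkE addr0 subr0; congr (if _ then _ else _); apply/asbP/asbP => // H.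
  case: (signed_w w H) => // -[c [cZ cP cN]].
    by have := cN w; rewrite setU11 zero // ltxx => /(_ isT).
  by have := cP w; rewrite setU11 zero // ltxx => /(_ isT).
(* In the independent case the section by the hyperplane has opposite sign, and if it is nonempty
   then so are both sides. *)
have rkE : rk_at (w |: Z) = (rk_at Z).+1 by rewrite /rk_at dim_setU1 dim_add_vline.
rewrite rkE exprS mulN1r.
case: (asbP (signed Z P N)) => [H|nH]; last first.
  by do !case: asbP => ?; rewrite ?addr0 ?subr0 //; case: nH; auto.
case: (asbP (signed (w |: Z) P N)) => [H0|nH0].
  have [HN HP] := signed_perturb H wZ H0.
  by rewrite (introT (asbP _) HN) (introT (asbP _) HP) addNr subrr.
case: (asbP (signed Z P (w |: N))) => [HN|nHN].
  case: (asbP (signed Z (w |: P) N)) => [HP|]; last by rewrite subr0 add0r.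
  by case: nH0; apply: signed_convex.
case: (asbP (signed Z (w |: P) N)) => [HP|nHP]; first by rewrite [in RHS]subrr.
by case: (signed_w w H).
Qed.

(** The cone with [w] nonpositive is the cone without condition at [w] minus the part with [w]
    positive; cell by cell this is [cell_subdivision]. *)
Lemma euler_cone_rec w Y P M : w \notin M -> w \notin Y ->
  euler_cone Y P (w |: M) = euler_cone Y P M - euler_cone Y (w |: P) M.
Proof.
move=> wM wY; rewrite /euler_cone (bigID (fun X => w \in X)) /=.
rewrite (reindex_onto (fun X => w |: X) (fun X => X :\ w)) /=; last first.
  by move=> X /andP[_ wX]; rewrite setD1K.
rewrite -sumrB.
have E1 X : (w |: X \subset w |: M) && (w \in w |: X) && ((w |: X) :\ w == X) =
    (X \subset M).
  rewrite setU11 andbT subUset sub1set setU11 /=; apply/andP/idP => [[XM /eqP XE]|XM].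
    rewrite -XE; apply/subsetP => t; rewrite !inE => /andP[tw]; rewrite (negbTE tw) => tX.
    by have := subsetP XM t tX; rewrite !inE (negbTE tw).
  have wX : w \notin X by apply: contra wM; apply: (subsetP XM).
  by rewrite setU1K // (subset_trans XM (subsetUr _ _)) eqxx.
rewrite (eq_bigl _ _ E1).
have E2 X : (X \subset w |: M) && (w \notin X) = (X \subset M).
  apply/andP/idP => [[XM wX]|XM].
    apply/subsetP => t tX; have := subsetP XM t tX.
    by case/setU1P => // tw; rewrite tw (negbTE wX) in tX.
  by rewrite (subset_trans XM (subsetUr _ _)); split=> //; apply: contra wM; apply: (subsetP XM).
rewrite (eq_bigl _ _ E2) -big_split /=; apply: eq_bigr => X XM.
have wX : w \notin X by apply: contra wM; apply: (subsetP XM).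
rewrite -cell_subdivision setUCA; congr (_ + _).
  have -> : (w |: M) :\: (w |: X) = M :\: X; last by [].
  apply/setP => t; rewrite !inE; case: eqP => [->|] //=; by rewrite (negbTE wM) andbF.
have -> : (w |: M) :\: X = w |: (M :\: X); last by [].
by apply/setP => t; rewrite !inE; case: eqP => [->|] //=; rewrite wX.
Qed.

Lemma euler_cone0 Y P : signed Y P set0 -> euler_cone Y P set0 = (-1) ^+ rk_at Y.
Proof.
move=> H; rewrite /euler_cone (big_pred1 set0) => [|X]; last by rewrite subset0.
by rewrite setU0 setD0 (introT (asbP _) H).
Qed.

(** By [euler_cone_rec] and induction both terms vanish, or, for a single [w], both equal
    [(-1) ^+ rk_at Y]. That all conditions can be made positive at once ensures that the cones at
    the bottom of the recursion are nonempty. *)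
Lemma euler_cone_eq0 Y P M : signed Y (P :|: M) set0 -> [disjoint Y & M] ->
  M != set0 -> euler_cone Y P M = 0.
Proof.
have [k] := ubnP #|M|; elim: k P M => // k IH P M Mk H dYM M0.
have [w wM] := set0Pn _ M0.
have wY : w \notin Y by rewrite (disjointFl dYM wM).
have MwE : M = w |: (M :\ w) by rewrite setD1K.
rewrite {1}MwE euler_cone_rec ?setD11 //.
have [M1|M1] := eqVneq (M :\ w) set0.
  rewrite M1 !euler_cone0 ?subrr //; apply: signedS H => //; last exact: subsetUl.
  by rewrite subUset subsetUl sub1set inE wM orbT.
have sM : M :\ w \subset M by apply: subD1set.
have dM : [disjoint Y & M :\ w].
  by rewrite disjoint_sym; apply: disjointWl sM _; rewrite disjoint_sym.
have lM : (#|M :\ w| < k)%N by rewrite (cardsD1 w M) wM in Mk.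
rewrite !IH ?subrr //; apply: signedS H => //.
  by rewrite !subUset subsetUl sub1set inE wM orbT subsetU ?sM ?orbT.
by rewrite subUset subsetUl subsetU ?sM ?orbT.
Qed.

End ConeEuler.

(** * Euler's relation for the faces of a polytope *)

Section PolytopeEuler.
Variables (n : nat) (T : finType) (f : T -> 'rV[rat]_n).
Implicit Types (V X Y Z : {set T}).

(** Points are lifted to height one, which turns affine functions into linear forms. The rank of a
    nonempty set is its dimension plus one, and the empty face has rank 0, in accordance with
    dimension -1. *)
Definition homog (t : T) : 'rV[rat]_(1 + n) := row_mx 1%:M (f t).

Lemma dotv_homog (c : 'rV[rat]_(1 + n)) t :
  dotv c (homog t) = lsubmx c 0 0 + dotv (rsubmx c) (f t).
Proof.
rewrite /dotv -{1}[c]hsubmxK /homog tr_row_mx mul_row_col mxE; congr (_ + _).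
by rewrite trmx1 mulmx1.
Qed.

Lemma rk_at_homog X t0 : t0 \in X -> rk_at homog X = (fdim f X).+1.
Proof.
move=> tX; rewrite (fdimE f tX) /rk_at.
pose phi : 'Hom('rV[rat]_n, 'rV[rat]_(1 + n)) := linfun (mulmxr (row_mx 0 1%:M)).
have phiE x : phi x = row_mx 0 x by rewrite lfunE /= mul_mx_row mulmx0 mulmx1.
set W := <<_>>%VS; set U := <<_>>%VS.
have dU : \dim (phi @: U) = \dim U.
  apply: limg_dim_eq; apply/eqP; rewrite -subv0; apply/subvP => x.
  rewrite memv_cap memv0 memv_ker phiE => /andP[_ /eqP].
  by rewrite -row_mx0 => /eq_row_mx[_ ->].
have -> : W = (<[homog t0]> + phi @: U)%VS.
  rewrite limg_span -map_comp -span_cons; apply/eqP; rewrite eqEsubv.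
  have hE u : homog u - homog t0 = phi (f u - f t0).
    by rewrite phiE /homog opp_row_mx add_row_mx subrr.
  apply/andP; split; apply/span_subvP => x.
    case/mapP => u; rewrite mem_enum => uX ->; rewrite -(subrK (homog t0) (homog u)).
    rewrite addrC memvD //; first by rewrite memv_span // mem_head.
    by rewrite memv_span // inE; apply/orP; right; apply/mapP; exists u; rewrite ?mem_enum.
  have hX u : u \in X -> homog u \in W.
    by move=> uX; apply/memv_span/mapP; exists u; rewrite ?mem_enum.
  rewrite inE => /predU1P[->|/mapP[u]]; first exact: hX.
  by rewrite mem_enum => uX ->; rewrite /= -hE memvB ?hX.
rewrite dim_add_vline ?dU //; apply/negP => /memv_imgP[x _].
rewrite phiE => /eq_row_mx[/matrixP/(_ 0 0)].
by rewrite !mxE eqxx => /eqP; rewrite oner_eq0.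
Qed.

Lemma rk_at_set0 : rk_at homog set0 = 0%N.
Proof. by rewrite /rk_at enum_set0 /= span_nil dimv0. Qed.

Lemma signed_face V Z : Z != set0 -> Z \subset V ->
  signed homog Z set0 (V :\: Z) <-> Z \in faces f V.
Proof.
move=> Z0 ZV; split.
  case=> c [cZ _ cN]; apply/facesP; exists (rsubmx c); apply/esym.
  apply: (@argm_eq _ _ _ _ _ (- lsubmx c 0 0)) => // u uV.
  have [uZ|uZ] := boolP (u \in Z).
    by have /eqP := cZ u uZ; rewrite dotv_homog addrC addr_eq0 => /eqP ->; rewrite eqxx.
  have := cN u; rewrite inE uZ uV dotv_homog => /(_ isT) H.
  by rewrite lt_eqF ?ltW //; lra.
move=> ZF; have V0 : V != set0.
  by apply: contraNneq Z0 => V0; rewrite -subset0 -V0.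
case/facesP: (ZF) => c Ec; have [M HM] := argmP f c V0; rewrite -Ec in HM.
have cE u : dotv (row_mx (- M)%:M c) (homog u) = dotv c (f u) - M.
  by rewrite dotv_homog row_mxKl row_mxKr mxE mulr1n addrC.
exists (row_mx (- M)%:M c); split=> t; rewrite ?inE //.
  move=> tZ; rewrite cE; have [_] := HM t (subsetP ZV t tZ).
  by rewrite tZ => /eqP ->; rewrite subrr.
case/andP => tZ tV; rewrite cE subr_lt0 lt_neqAle.
by have [-> ->] := HM t tV; rewrite tZ.
Qed.

(** The cells of the cone of forms vanishing on [Y] and nonpositive on [V :\: Y] are indexed by the
    faces between [Y] and [V], the empty face included when [Y] is empty. *)
Lemma euler_sum V Y : V != set0 -> Y \proper V -> (Y \in faces f V) || (Y == set0) ->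
  \sum_(X : {set T} | (Y \subset X) && (X \subset V))
    (if (X \in faces f V) || (X == set0) then (-1) ^+ rk_at homog X else 0) = 0 :> int.
Proof.
move=> V0 /[dup] YV /properP[sYV [w wV wY]] Yf.
have H : signed homog Y (set0 :|: (V :\: Y)) set0.
  rewrite set0U; case/orP: Yf => [YF|/eqP Y0].
    have Y0 := faces_neq0 V0 YF.
    case/(signed_face Y0 sYV): YF => c [cZ _ cN].
    (* A supporting form of [Y], negated, is positive on the rest of [V]. *)
    exists (-1 *: c); split=> t tY; rewrite ?inE // dotvZl mulN1r.
    - by rewrite cZ ?oppr0.
    - by rewrite oppr_gt0 cN.
    - by rewrite inE in tY.
  (* For empty [Y] the constant form 1 is positive everywhere. *)
  exists (row_mx 1%:M 0); rewrite Y0; split=> t; rewrite ?inE // => _.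
  by rewrite dotv_homog row_mxKl row_mxKr dotv0l addr0 mxE ltr01.
have dY : [disjoint Y & V :\: Y] by rewrite -setI_eq0 setIDA setIC -setIDA setDv setI0.
have VY0 : V :\: Y != set0 by apply/set0Pn; exists w; rewrite inE wY.
rewrite -[RHS](euler_cone_eq0 H dY VY0) /euler_cone.
rewrite (reindex_onto (fun X => Y :|: X) (fun X => X :\: Y)) /=; last first.
  move=> X /andP[YX _]; apply/setP => t; rewrite !inE.
  by case: (boolP (t \in Y)) => //= /(subsetP YX) ->.
apply: eq_big => [X|X].
  rewrite subsetUl subUset sYV /= setDUl setDv set0U.
  apply/andP/idP => [[XV /eqP XE]|XV]; first by rewrite -XE setSD.
  rewrite (subset_trans XV) ?subsetDl //; split=> //; apply/eqP/setDidPl.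
  by apply: disjointWl XV _; rewrite disjoint_sym.
case/andP => /andP[_ sV] _; congr (if _ then _ else _); rewrite setDDl.
have [->|X0] := eqVneq (Y :|: X) set0; last first.
  by rewrite orbF; apply/idP/asbP => /(signed_face X0 sV).
(* The empty face is cut out by the constant form -1. *)
rewrite orbT; apply/esym/asbP; exists (row_mx (-1)%:M 0).
split=> t; rewrite ?inE // => _.
by rewrite dotv_homog row_mxKl row_mxKr dotv0l addr0 mxE mulr1n oppr_lt0 ltr01.
Qed.

(** The case [Y = set0] of [euler_sum], with the term of the empty face moved to the other side. *)
Lemma euler_faces V : V != set0 -> \sum_(X in faces f V) (-1) ^+ fdim f X = 1 :> int.
Proof.
move=> V0; have := @euler_sum V set0 V0; rewrite properEneq eq_sym V0 sub0set eqxx orbT.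
move/(_ isT isT); rewrite (bigD1 set0) ?sub0set //= eqxx orbT rk_at_set0.
rewrite expr0 => /(canRL (addKr _)); rewrite addr0 => E; apply: oppr_inj; rewrite -[RHS]E -sumrN.
rewrite -big_mkcondr /=; apply: eq_big => [X|X XF].
  rewrite sub0set /=; case: (boolP (X \in faces f V)) => [XF|] /=; last first.
    by case: (X == set0); rewrite ?andbF.
  by rewrite (faces_neq0 V0 XF) (faces_sub XF).
by have /set0Pn[t tX] := faces_neq0 V0 XF; rewrite (rk_at_homog tX) exprS mulN1r.
Qed.

Lemma euler_interval V Y : V != set0 -> Y \in pfaces f V ->
  \sum_(X in faces f V | Y \subset X) (-1) ^+ fdim f X = 0 :> int.
Proof.
move=> V0; rewrite in_setD1 => /andP[YV YF]; have Y0 := faces_neq0 V0 YF.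
have pY : Y \proper V by rewrite properEneq YV (faces_sub YF).
have := euler_sum V0 pY; rewrite YF => /(_ isT) E; apply: oppr_inj; rewrite oppr0 -[RHS]E -sumrN.
rewrite -big_mkcondr /=; apply: eq_big => [X|X /andP[XF _]].
  case: (boolP (Y \subset X)) => YX /=; rewrite ?andbF // andbT.
  have -> : (X == set0) = false.
    by apply: contraNF Y0 => /eqP X0; rewrite -subset0 -X0.
  by rewrite orbF; case: (boolP (X \in faces f V)) => [/faces_sub ->|]; rewrite ?andbF.
by have /set0Pn[t tX] := faces_neq0 V0 XF; rewrite (rk_at_homog tX) exprS mulN1r.
Qed.

End PolytopeEuler.

(** * Behaviour of faces and dimensions under affine maps *)

Section Transport.
Variables (n n' : nat) (T T' : finType) (f : T -> 'rV[rat]_n) (f' : T' -> 'rV[rat]_n').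
Variable h : T -> T'.

Lemma fdim_image_ge (Y : {set T}) (L' : 'M_(n', n)) x' :
  {in Y, forall t, f t = f' (h t) *m L' + x'} -> (fdim f Y <= fdim f' (h @: Y))%N.
Proof.
move=> H; have [->|[t0 tY]] := set_0Vmem Y; first by rewrite fdim0.
rewrite (fdimE f tY) (fdimE f' (imset_f h tY)).
pose phi : 'Hom('rV[rat]_n', 'rV[rat]_n) := linfun (mulmxr L').
rewrite -(limg_ker_dim phi <<[seq f' u - f' (h t0) | u <- enum (h @: Y)]>>).
apply: leq_trans (leq_addl _ _); apply/dimvS/span_subvP => y /mapP[u].
rewrite mem_enum => uY {y}->; have -> : f u - f t0 = phi (f' (h u) - f' (h t0)).
  by rewrite lfunE /= mulmxBl !H // opprD addrACA subrr addr0.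
by apply/memv_img/memv_span/mapP; exists (h u); rewrite // mem_enum imset_f.
Qed.

Lemma fdim_image_le (Y : {set T}) (L : 'M_(n, n')) x :
  {in Y, forall t, f' (h t) = f t *m L + x} -> (fdim f' (h @: Y) <= fdim f Y)%N.
Proof.
move=> H; have [->|[t0 tY]] := set_0Vmem Y; first by rewrite imset0 fdim0.
rewrite (fdimE f tY) (fdimE f' (imset_f h tY)).
pose phi : 'Hom('rV[rat]_n, 'rV[rat]_n') := linfun (mulmxr L).
rewrite -(limg_ker_dim phi <<[seq f u - f t0 | u <- enum Y]>>).
apply: leq_trans (leq_addl _ _); apply/dimvS/span_subvP => y /mapP[u].
rewrite mem_enum => /imsetP[v vY ->] {y}->.
have -> : f' (h v) - f' (h t0) = phi (f v - f t0).
  by rewrite lfunE /= mulmxBl !H // opprD addrACA subrr addr0.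
by apply/memv_img/memv_span/mapP; exists v; rewrite // mem_enum.
Qed.

Lemma argm_image (V : {set T}) c c' k :
  {in V, forall t, dotv c' (f' (h t)) = dotv c (f t) + k} ->
  {in V &, injective h} -> argm f' (h @: V) c' = h @: argm f V c.
Proof.
move=> H inj_h; apply/setP => y; rewrite inE; apply/andP/imsetP.
  case=> /imsetP[t tV ->] /forall_inP tm; exists t => //; rewrite inE tV.
  apply/forall_inP => u uV; have := tm (h u) (imset_f h uV).
  by rewrite !H // lerD2r.
case=> t; rewrite inE => /andP[tV /forall_inP tm] ->; split; first exact: imset_f.
by apply/forall_inP => _ /imsetP[u uV ->]; rewrite !H // lerD2r tm.
Qed.

Lemma dotv_mulmx (c' : 'rV[rat]_n') (L : 'M_(n, n')) x :
  dotv c' (x *m L) = dotv (c' *m L^T) x.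
Proof. by rewrite /dotv trmx_mul mulmxA. Qed.

Lemma imset_subset_inj (V Y Z : {set T}) : {in V &, injective h} ->
  Y \subset V -> Z \subset V -> (h @: Y \subset h @: Z) = (Y \subset Z).
Proof.
move=> inj_h YV ZV; apply/idP/idP => [H|]; last exact: imsetS.
apply/subsetP => t tY; have /imsetP[u uZ /inj_h] := subsetP H _ (imset_f h tY).
by move=> -> //; [exact: (subsetP YV) | exact: (subsetP ZV)].
Qed.

End Transport.

(** * The flag index and the existence of the cd-index *)

Section FlagIndex.
Variables (R : pzRingType) (b e : R).

Definition Psi n (T : finType) (f : T -> 'rV[rat]_n) (V : {set T}) : R :=
  psi b e (fun Y Z : {set T} => Y \proper Z) (fdim f) (pfaces f V) 0 (fdim f V).

Lemma proper_irr (T : finType) : irreflexive (fun Y Z : {set T} => Y \proper Z).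
Proof. by move=> Y; rewrite properxx. Qed.
Lemma proper_tr (T : finType) : transitive (fun Y Z : {set T} => Y \proper Z).
Proof. by move=> Y X Z; apply: proper_trans. Qed.

Lemma Psi_rec n (T : finType) (f : T -> 'rV[rat]_n) V : V != set0 ->
  Psi f V = e ^+ fdim f V +
    \sum_(Y in pfaces f V) Psi f Y * b * e ^+ (fdim f V - (fdim f Y).+1).
Proof.
move=> V0; rewrite {1}/Psi psi_rec; last exact: proper_irr.
rewrite subn0; congr (_ + _); apply: eq_bigr => Y; rewrite in_setD1 => /andP[_ YF].
by rewrite /Psi (pfaces_faces V0 YF).
Qed.

(** The two affine maps need to be inverse to each other only on the points concerned. Each of them
    provides one inequality of dimensions and one inclusion between the sets of faces. *)
Lemma Psi_transport n n' (T T' : finType) (f : T -> 'rV[rat]_n) (f' : T' -> 'rV[rat]_n')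
    (V : {set T}) (h : T -> T') (L : 'M_(n, n')) (L' : 'M_(n', n)) x x' :
    {in V &, injective h} ->
    {in V, forall t, f' (h t) = f t *m L + x} ->
    {in V, forall t, f t = f' (h t) *m L' + x'} ->
  Psi f V = Psi f' (h @: V).
Proof.
move=> inj_h H H'.
have dE (Y : {set T}) : Y \subset V -> fdim f Y = fdim f' (h @: Y).
  move=> YV; apply/eqP; rewrite eqn_leq.
  rewrite (fdim_image_ge (L' := L') (x' := x')) => [|t /(subsetP YV)/H'] //.
  by rewrite (fdim_image_le (L := L) (x := x)) => [|t /(subsetP YV)/H].
have sub (Y : {set T}) : Y \in pfaces f V -> Y \subset V.
  by rewrite in_setD1 => /andP[_ /faces_sub].
rewrite /Psi -dE //; have ->: pfaces f' (h @: V) = (fun Y : {set T} => h @: Y) @: pfaces f V.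
  apply/setP => Y; rewrite in_setD1; apply/andP/imsetP.
    case=> YV /facesP[c' E'].
    exists (argm f V (c' *m L^T)).
      rewrite in_setD1; apply/andP; split; last by apply/facesP; eexists.
      apply: contraNneq YV => EV; rewrite E' -{2}EV; apply/eqP.
      by apply: (argm_image (k := dotv c' x)) => // t tV;
        rewrite H // dotvDr dotv_mulmx.
    rewrite E'; apply: (argm_image (k := dotv c' x)) => // t tV.
    by rewrite H // dotvDr dotv_mulmx.
  case=> Z /[dup] /sub sZV; rewrite in_setD1 => /andP[ZV /facesP[c Ec]] ->; split.
    by apply: contra ZV; rewrite !eqEsubset sZV !(imset_subset_inj inj_h) // => /andP[].
  apply/facesP; exists (c *m L'^T); rewrite Ec; apply/esym.
  apply: (argm_image (k := - dotv c x')) => // t tV.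
  by rewrite H' // dotvDr dotv_mulmx addrK.
rewrite (@psi_iso0 _ _ _ _ _ _ (fun Y Z : {set T'} => Y \proper Z) _ (fdim f')
  (fun Y : {set T} => h @: Y)).
- by [].
- exact: proper_irr.
- exact: proper_irr.
- move=> Y Z /sub YV /sub ZV E; apply/eqP; rewrite eqEsubset.
  by rewrite -(imset_subset_inj inj_h YV ZV) -(imset_subset_inj inj_h ZV YV) E subxx.
- by move=> Y Z /sub YV /sub ZV; rewrite !properE !(imset_subset_inj inj_h).
- by move=> Y /sub; apply: dE.
Qed.

Lemma ev_Psi_ab n (T : finType) (f : T -> 'rV[rat]_n) (g : abL -> R) :
  g Lb = b -> g La = b + e -> ev g (Psi_ab f) = Psi f [set: T].
Proof.
move=> gb ga; rewrite /Psi_ab ev_sum big_map big_enum /=.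
(* Without points there is no proper face and only the empty chain, so both sides are 1. *)
have [T0|T0] := eqVneq [set: T] set0.
  have pf0 (Y : {set T}) : proper_face f Y = false.
    apply/negP => /and3P[_ /set0Pn[t _] _].
    by have := in_setT t; rewrite T0 inE.
  have fd : fdim f [set: T] = 0%N by rewrite T0 fdim0.
  rewrite (big_pred1 set0) => [|C].
    rewrite /chain_weight ev_prod /pdim fd /= big_nil /Psi fd psi_rec ?subnn; last exact: proper_irr.
    rewrite big1 ?addr0 // => Y; rewrite in_setD1 => /andP[YT _].
    by case/negP: YT; apply/eqP/setP => t; have := in_setT t; rewrite T0 inE.
  rewrite inE /is_chain; apply/andP/eqP => [[/forall_inP H _]|->].
    by apply/setP => Y; rewrite inE; apply/negP => /H; rewrite pf0.
  by split; apply/forall_inP => Y; rewrite inE.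
have pfE (Y : {set T}) : proper_face f Y = (Y \in pfaces f [set: T]).
  rewrite in_setD1 /proper_face andbC -andbA andbCA; congr (_ && _).
  have -> : asb (is_face f Y) = (Y \in faces f [set: T]).
    have E c : [set t | [forall u, dotv c (f u) <= dotv c (f t)]] = argm f [set: T] c.
      by apply/setP => t; rewrite !inE; apply: eq_forallb => u; rewrite inE.
    by apply/asbP/facesP => -[c ->]; exists c.
  by rewrite andb_idl // => /(faces_neq0 T0).
rewrite /Psi -sum_flagwt.
- apply: eq_big => [C|C _].
    rewrite inE /is_chain; congr (_ && _).
      apply/forall_inP/subsetP => H Y; first by move/H; rewrite pfE.
      by rewrite pfE; apply: H.
    apply/forall_inP/chainP => H Y; last first.
      move=> YC; apply/forall_inP => Z ZC; have /or3P[/eqP->|/proper_sub->|/proper_sub->] := H Y Z YC ZC;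
        by rewrite ?subxx ?orbT.
    move=> Z YC ZC; have /orP := forall_inP (H Y YC) Z ZC; rewrite !properEneq.
    by case: eqVneq => //= YZ [->|->]; rewrite ?orbT.
  rewrite /chain_weight ev_prod big_map /flagwt subn0; apply: eq_bigr => i _.
  by case: ifP => _; rewrite ?ev_sub !ev_letter ?ga gb // addrAC subrr add0r.
- exact: proper_irr.
- move=> Y Z YF ZF YZ; apply: (@fdim_face_lt _ _ f setT) => //.
  by move: YF; rewrite in_setD1 => /andP[].
- move=> Y; rewrite in_setD1 => /andP[YT YF] /=; apply: fdim_face_lt T0 YF _ _ => //.
  by rewrite properEneq YT subsetT.
Qed.

End FlagIndex.

Lemma signr_parity m n : (-1) ^+ (m + n) = (if odd (m + n) then -1 else 1) :> int.
Proof. by rewrite -signr_odd; case: odd; rewrite ?expr1 ?expr0. Qed.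

(* Stanley's argument: write [2 b = c - e]; the terms with an odd power of [e]
   cancel by Euler's relation. *)
Section EvenPowers.
Variables (R : pzRingType) (aa bb : R) (n : nat) (T : finType) (f : T -> 'rV[rat]_n).
Let e := aa - bb.
Let c := aa + bb.
Let PsiA := Psi bb e f.

Lemma Psi_mul2 (V : {set T}) (D := fdim f V) : V != set0 -> PsiA V *+ 2 =
  e ^+ D *~ (1 + (-1) ^+ D)
  + \sum_(Y in pfaces f V | odd (D + fdim f Y)) PsiA Y * c * e ^+ (D - (fdim f Y).+1)
  - \sum_(Y in pfaces f V | ~~ odd (D + fdim f Y)) PsiA Y * e ^+ (D - fdim f Y).
Proof.
move=> V0.
have pV Y : Y \in pfaces f V -> Y \proper V.
  by rewrite in_setD1 properEneq => /andP[-> /faces_sub ->].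
have pF Y : Y \in pfaces f V -> Y \in faces f V.
  by rewrite in_setD1 => /andP[].
have pD Y : Y \in pfaces f V -> (fdim f Y < D)%N.
  by move=> YV; apply: (fdim_face_lt V0 (pF _ YV) (pV _ YV)).
have b2 : bb *+ 2 = c - e.
  by rewrite /c /e opprB addrC addrA subrK mulr2n.
(* The terms with an odd power of [e], where [e ^+ D] occurs only for odd [D]. *)
pose bad := e ^+ D *~ (1 - (-1) ^+ D)
  + \sum_(Y in pfaces f V | ~~ odd (D + fdim f Y)) PsiA Y * c * e ^+ (D - (fdim f Y).+1)
  - \sum_(Y in pfaces f V | odd (D + fdim f Y)) PsiA Y * e ^+ (D - fdim f Y).
have E2 : PsiA V *+ 2 = bad
  + e ^+ D *~ (1 + (-1) ^+ D)
  + \sum_(Y in pfaces f V | odd (D + fdim f Y)) PsiA Y * c * e ^+ (D - (fdim f Y).+1)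
  - \sum_(Y in pfaces f V | ~~ odd (D + fdim f Y)) PsiA Y * e ^+ (D - fdim f Y).
  rewrite /PsiA Psi_rec // -/PsiA -/D mulrnDl -sumrMnl.
  have -> : e ^+ D *+ 2 = e ^+ D *~ (1 - (-1) ^+ D) + e ^+ D *~ (1 + (-1) ^+ D).
    by rewrite -mulrzDr addrACA addNr addr0 -[1 + 1]/2%:Z -pmulrn.
  rewrite (eq_bigr (fun Y => PsiA Y * c * e ^+ (D - (fdim f Y).+1)
      - PsiA Y * e ^+ (D - fdim f Y))) => [|Y YV]; last first.
    rewrite -mulrnAl -mulrnAr b2 mulrBr mulrBl; congr (_ - _).
    by rewrite -mulrA -exprS subnSK // pD.
  rewrite sumrB (bigID (fun Y => odd (D + fdim f Y))) /=.
  rewrite [X in _ + (_ - X)](bigID (fun Y => odd (D + fdim f Y))) /=.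
  by rewrite /bad opprD !addrA (ACl (1*4*5*2*3*6)).
have bad0 : bad = 0.
  pose B Y := PsiA Y * bb * e ^+ (D - (fdim f Y).+1).
  rewrite /bad.
  have -> : \sum_(Y in pfaces f V | ~~ odd (D + fdim f Y))
        PsiA Y * c * e ^+ (D - (fdim f Y).+1) =
      \sum_(Y in pfaces f V | ~~ odd (D + fdim f Y)) PsiA Y * e ^+ (D - fdim f Y) +
      \sum_(Y in pfaces f V | ~~ odd (D + fdim f Y)) B Y *+ 2.
    rewrite -big_split /=; apply: eq_bigr => Y /andP[YV _].
    rewrite -[c](subrK e) -b2 mulrDr mulrDl addrC; congr (_ + _).
      by rewrite mulrnAr mulrnAl.
    by rewrite -mulrA -exprS subnSK // pD.
  (* One signed sum is computed twice: split by parity here, and in [S2] by unfolding each [PsiA Y]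
     and summing over the faces above a fixed [Z], where Euler's relation applies. *)
  have S1 : \sum_(Y in pfaces f V) PsiA Y * e ^+ (D - fdim f Y) *~ (-1) ^+ (D + fdim f Y) =
     \sum_(Y in pfaces f V | ~~ odd (D + fdim f Y)) PsiA Y * e ^+ (D - fdim f Y) -
     \sum_(Y in pfaces f V | odd (D + fdim f Y)) PsiA Y * e ^+ (D - fdim f Y).
    rewrite (bigID (fun Y => odd (D + fdim f Y))) /= addrC -sumrN; congr (_ + _);
    apply: eq_bigr => Y /andP[_ oY]; rewrite signr_parity.
      by rewrite (negbTE oY).
    by rewrite oY mulrN1z.
  have S2 : \sum_(Y in pfaces f V) PsiA Y * e ^+ (D - fdim f Y) *~ (-1) ^+ (D + fdim f Y) =
     e ^+ D *~ (\sum_(Y in pfaces f V) (-1) ^+ (D + fdim f Y)) +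
     \sum_(Z in pfaces f V) B Z *~ (\sum_(Y in pfaces f V | Z \proper Y) (-1) ^+ (D + fdim f Y)).
    rewrite mulrz_sumr; under [X in _ + X]eq_bigr => Z _ do rewrite mulrz_sumr.
    rewrite (exchange_big_dep (mem (pfaces f V))) /=; last by move=> ? ? _ /andP[].
    rewrite -big_split /=; apply: eq_bigr => Y YV.
    have Y0 := faces_neq0 V0 (pF _ YV).
    rewrite -mulrz_suml -mulrzDl; congr (_ *~ _).
    rewrite /PsiA (Psi_rec _ _ _ Y0) -/PsiA mulrDl -exprD.
    rewrite (subnKC (ltnW (pD _ YV))); congr (_ + _).
    rewrite mulr_suml (pfaces_faces V0 (pF _ YV)); apply: eq_big => [Z|Z].
      by rewrite inE YV.
    rewrite inE => /andP[ZV ZY]; rewrite /B -mulrA -exprD; congr (_ * _ ^+ _).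
    have := fdim_face_lt V0 (pF _ ZV) ZY (proper_sub (pV _ YV)).
    have := pD _ YV; lia.
  have eu1 : \sum_(Y in pfaces f V) (-1) ^+ (D + fdim f Y) = (-1) ^+ D - 1 :> int.
    have := euler_faces f V0; rewrite (bigD1 V) ?faces_refl //= => /(canRL (addKr _)) E.
    under eq_bigr => Y _ do rewrite exprD; rewrite -mulr_sumr.
    rewrite (eq_bigl (fun Y => (Y \in faces f V) && (Y != V))) => [|Y]; last first.
      by rewrite in_setD1 andbC.
    by rewrite E mulrDr mulr1 mulrN -expr2 sqrr_sign addrC.
  have eu2 Z : Z \in pfaces f V ->
      \sum_(Y in pfaces f V | Z \proper Y) (-1) ^+ (D + fdim f Y) =
      - (1 + (-1) ^+ (D + fdim f Z)) :> int.
    move=> ZV; have := euler_interval V0 ZV.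
    rewrite (bigD1 V) ?faces_refl ?proper_sub ?pV //= (bigD1 Z) ?pF ?subxx //=; last first.
      by move: ZV; rewrite in_setD1 => /andP[].
    rewrite addrA => /(canRL (addKr _)); rewrite addr0 => E.
    under eq_bigr => Y _ do rewrite exprD; rewrite -mulr_sumr.
    rewrite (eq_bigl (fun Y => (Y \in faces f V) && (Z \subset Y) && (Y != V) && (Y != Z))); last first.
      move=> Y; rewrite in_setD1 properEneq -!andbA; do !bool_congr.
      by rewrite eq_sym andbC.
    by rewrite -/D in E; rewrite E mulrN mulrDr -expr2 sqrr_sign -exprD.
  rewrite -addrA [X in _ + X]addrAC -S1 S2 eu1 !addrA -mulrzDr -[(-1) ^+ D - 1]opprB.
  rewrite subrr mulr0z add0r [X in _ + X]big_mkcondr -big_split big1 //= => Z ZV.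
  rewrite eu2 // signr_parity; case: ifP => _; first by rewrite subrr oppr0 mulr0z addr0.
  by rewrite mulrNz -[1 + 1]/2%:Z -pmulrn addNr.
by rewrite E2 bad0 add0r.
Qed.

End EvenPowers.

(** * Existence of the cd-index *)

Section CdIndex.

Definition aa : abring := abvar La.
Definition bb : abring := abvar Lb.
Definition PsiA := Psi bb (aa - bb).

Definition iscd (x : abring) := exists phi, evab (cd_to_ab phi) = x.

Lemma iscd_c : iscd (aa + bb).
Proof.
by exists vc; rewrite /evab ev_cd_to_ab ev_letter /cd_letter_to_ab ev_add !ev_letter.
Qed.
Lemma iscd_d : iscd (aa * bb + bb * aa).
Proof.
by exists vd; rewrite /evab ev_cd_to_ab ev_letter /cd_letter_to_ab ev_add !ev_mul !ev_letter.
Qed.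
Lemma iscd1 : iscd 1.
Proof. by exists (ncone _); rewrite /evab ev_cd_to_ab ev_one. Qed.
Lemma iscdD x y : iscd x -> iscd y -> iscd (x + y).
Proof.
case=> p <- [q <-]; exists (ncadd p q).
by rewrite /evab !ev_cd_to_ab ev_add.
Qed.
Lemma iscdB x y : iscd x -> iscd y -> iscd (x - y).
Proof.
case=> p <- [q <-]; exists (ncsub p q).
by rewrite /evab !ev_cd_to_ab ev_sub.
Qed.
Lemma iscdM x y : iscd x -> iscd y -> iscd (x * y).
Proof.
case=> p <- [q <-]; exists (ncmul p q).
by rewrite /evab !ev_cd_to_ab ev_mul.
Qed.
Lemma iscd0 : iscd 0.
Proof. by rewrite -(subrr 1); apply: iscdB; apply: iscd1. Qed.
Lemma iscd_sum (I : finType) (P : pred I) (F : I -> abring) :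
  (forall i, P i -> iscd (F i)) -> iscd (\sum_(i | P i) F i).
Proof. by move=> H; elim/big_ind: _ => //; [exact: iscd0 | exact: iscdD]. Qed.
Lemma iscdX x n : iscd x -> iscd (x ^+ n).
Proof.
move=> H; elim: n => [|n IH]; first exact: iscd1.
by rewrite exprS; apply: iscdM.
Qed.

Let e := aa - bb.
Let c := aa + bb.

(** The square of a - b is c c - 2 d. *)
Lemma iscd_even n : ~~ odd n -> iscd (e ^+ n).
Proof.
move=> evn; rewrite -(odd_double_half n) (negbTE evn) add0n -muln2 mulnC exprM.
apply: iscdX; have -> : e ^+ 2 = c * c - (aa * bb + bb * aa) - (aa * bb + bb * aa).
  rewrite expr2 /e /c !mulrDl !mulrDr !mulrN !mulNr opprK.
  move: (aa * aa) (aa * bb) (bb * aa) (bb * bb) => p q r s.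
  by rewrite [r + s]addrC (addrACA p q) addrK [- r + s]addrC addrACA opprD.
apply: iscdB; last exact: iscd_d; apply: iscdB; last exact: iscd_d.
by apply: iscdM; apply: iscd_c.
Qed.

(** Induction on the faces: [Psi_mul2] contains only even powers of [e], so twice the index is a
    cd-polynomial, and [halve_cd] removes the factor. *)
Lemma iscd_Psi n (T : finType) (f : T -> 'rV[rat]_n) V : V != set0 -> iscd (PsiA f V).
Proof.
have [k] := ubnP #|V|; elim: k V => // k IH V Vk V0.
have pI Y : Y \in pfaces f V -> iscd (PsiA f Y) /\ (fdim f Y < fdim f V)%N.
  rewrite in_setD1 => /andP[YV YF].
  have pYV : Y \proper V by rewrite properEneq YV (faces_sub YF).
  split; last exact: fdim_face_lt V0 YF _ _.
  by apply: IH (faces_neq0 V0 YF); apply: leq_trans (proper_card pYV) Vk.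
have [psi Hpsi] : iscd (PsiA f V *+ 2).
  rewrite Psi_mul2 //; apply: iscdB; first apply: iscdD.
  - rewrite -(addn0 (fdim f V)) signr_parity; case: ifP => oD.
      by rewrite subrr mulr0z; apply: iscd0.
    by apply: iscdD; apply: iscd_even; rewrite oD.
  - apply: iscd_sum => Y /andP[YV oY]; have [cdY dY] := pI Y YV; apply: iscdM.
      by apply: iscdM => //; apply: iscd_c.
    apply: iscd_even; rewrite oddB //=.
    by move: oY; rewrite oddD; case: odd; case: odd.
  - apply: iscd_sum => Y /andP[YV oY]; have [cdY dY] := pI Y YV; apply: iscdM => //.
    apply: iscd_even; rewrite oddB 1?ltnW //=.
    by move: oY; rewrite oddD; case: odd; case: odd.
by case: (halve_cd (esym Hpsi)) => phi <-; exists phi.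
Qed.

End CdIndex.

Lemma evab_Psi_ab n (T : finType) (f : T -> 'rV[rat]_n) :
  evab (Psi_ab f) = PsiA f [set: T].
Proof. by rewrite /evab (@ev_Psi_ab _ bb (aa - bb)) // addrC subrK. Qed.

Lemma Psi_set0 (R : pzRingType) (b e : R) n (T : finType) (f : T -> 'rV[rat]_n) :
  Psi b e f set0 = 1.
Proof.
rewrite /Psi fdim0 psi_rec ?subnn; last exact: proper_irr.
rewrite big1 ?addr0 // => Y; rewrite in_setD1 => /andP[Y0 /faces_sub].
by rewrite subset0 (negbTE Y0).
Qed.

Lemma evab_Psi_cd n (T : finType) (f : T -> 'rV[rat]_n) :
  evab (cd_to_ab (Psi_cd f)) = PsiA f [set: T].
Proof.
rewrite -evab_Psi_ab; apply/nceq_evab.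
have : exists phi, nceq (cd_to_ab phi) (Psi_ab f); last exact: epsilon_spec.
have [phi E] : iscd (PsiA f [set: T]).
  have [->|T0] := eqVneq [set: T] set0; last exact: iscd_Psi.
  by rewrite /PsiA Psi_set0; apply: iscd1.
by exists phi; apply/nceq_evab; rewrite E evab_Psi_ab.
Qed.

(** * Split matroids and their cyclic flats *)

Section MatroidRank.
Variables (n k : nat) (Bs : {set {set 'I_n}}).
Hypotheses (matB : is_matroid Bs) (rkB : has_rank Bs k).
Implicit Types (A B C F G I J X Y : {set 'I_n}).
Local Notation rk := (rk Bs).
Local Notation indep := (indep Bs).

Lemma indepP I : reflect (exists2 B, B \in Bs & I \subset B) (indep I).
Proof. exact: (iffP exists_inP). Qed.

Lemma indepS I J : I \subset J -> indep J -> indep I.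
Proof. by move=> IJ /indepP[B BB JB]; apply/indepP; exists B => //; apply: subset_trans JB. Qed.

Lemma indep_base B : B \in Bs -> indep B.
Proof. by move=> BB; apply/indepP; exists B. Qed.

Lemma leq_rk B X : B \in Bs -> (#|B :&: X| <= rk X)%N.
Proof. by move=> BB; rewrite /Defs.rk (bigD1 B) //= leq_maxl. Qed.

Lemma rk_basis X : exists2 B, B \in Bs & #|B :&: X| = rk X.
Proof.
have [Bs0 _] := matB; have /card_gt0P[B0 B0B] : (0 < #|Bs|)%N by rewrite card_gt0.
rewrite /Defs.rk; case: (@eq_bigmax_cond _ (mem Bs) (fun B => #|B :&: X|)) => [|B BB ->].
  by apply/card_gt0P; exists B0.
by exists B.
Qed.

Lemma rk_le_card X : (rk X <= #|X|)%N.
Proof. by have [B _ <-] := rk_basis X; rewrite subset_leq_card ?subsetIr. Qed.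

Lemma rk_le X : (rk X <= k)%N.
Proof. by have [B BB <-] := rk_basis X; rewrite -(rkB BB) subset_leq_card ?subsetIl. Qed.

Lemma rkS X Y : X \subset Y -> (rk X <= rk Y)%N.
Proof.
move=> XY; have [B BB <-] := rk_basis X; apply: leq_trans (leq_rk Y BB).
by rewrite subset_leq_card ?setIS.
Qed.

Lemma indep_rk I : indep I = (rk I == #|I|).
Proof.
apply/indepP/eqP => [[B BB /setIidPr IB]|].
  by apply/eqP; rewrite eqn_leq rk_le_card -{1}IB leq_rk.
have [B BB <-] := rk_basis I => E; exists B => //.
by apply/setIidPr/eqP; rewrite eqEcard subsetIr E leqnn.
Qed.

Lemma indep_card_le I X : indep I -> I \subset X -> (#|I| <= rk X)%N.
Proof. by rewrite indep_rk => /eqP <-; apply: rkS. Qed.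

(** Among the bases containing [I] take one with fewest elements outside [I :|: B]; any such element
    could be exchanged for one of [B]. *)
Lemma base_extension I B : indep I -> B \in Bs ->
  exists B', [/\ B' \in Bs, I \subset B' & B' \subset I :|: B].
Proof.
move=> /indepP[B0 B0B IB0] BB.
pose P B' := (B' \in Bs) && (I \subset B').
have PB0 : P B0 by rewrite /P B0B.
case: (@arg_minnP _ B0 P (fun B' => #|B' :\: (I :|: B)|) PB0) => B' /andP[B'B IB'] B'min.
exists B'; split=> //; apply/subsetP => x xB'; apply: contraT => xIB.
have xIB2 : (x \notin I) && (x \notin B) by rewrite -negb_or -in_setU.
case/andP: xIB2 => xI xB.
have [|y] := (proj2 matB) B' B B'B BB x; first by rewrite inE xB.
rewrite inE => /andP[yB' yB] B2B.
have := B'min (y |: B' :\ x); rewrite /P B2B subsetU ?andbT; last first.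
  by rewrite subsetD1 IB' xI orbT.
move/(_ isT); rewrite leqNgt => /negP[]; apply: proper_card; apply/properP; split.
  apply/subsetP => z; rewrite !inE; case: eqP => [->|_] /=; first by rewrite yB orbT.
  by case/and3P => -> _ ->.
exists x; rewrite ?inE ?negb_or ?xI ?xB ?xB' //=.
by rewrite eqxx orbF; case: eqP => // xy; rewrite xy yB in xB.
Qed.

(** Extend [I] inside [I :|: B] for a base [B] meeting [X] maximally. Outside [X] the result uses
    only elements of [B], so by cardinality it loses nothing inside [X]. *)
Lemma extend_basis I X : indep I -> I \subset X ->
  exists2 B, B \in Bs & I \subset B /\ #|B :&: X| = rk X.
Proof.
move=> iI IX; have [B BB BX] := rk_basis X.
have [B' [B'B IB' B'IB]] := base_extension iI BB.
exists B' => //; split=> //; apply/eqP; rewrite eqn_leq leq_rk //= -BX.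
rewrite -(leq_add2r #|B' :\: X|) cardsID (rkB B'B) -(rkB BB) -(cardsID X B) leq_add2l.
apply: subset_leq_card; apply/subsetP => x; rewrite !inE => /andP[xX xB'].
rewrite xX /=; have := subsetP B'IB x xB'; rewrite inE => /orP[|//].
by move/(subsetP IX); rewrite (negbTE xX).
Qed.

Lemma rk_submod X Y : (rk (X :|: Y) + rk (X :&: Y) <= rk X + rk Y)%N.
Proof.
have [B0 B0B B0E] := rk_basis (X :&: Y).
have [||B BB [IB BE]] := @extend_basis (B0 :&: (X :&: Y)) (X :|: Y).
- by apply/indepP; exists B0; rewrite ?subsetIl.
- by apply: subset_trans (subsetIr _ _) _; rewrite subIset // subsetUl.
rewrite -BE -B0E; apply: leq_trans (leq_add (leq_rk X BB) (leq_rk Y BB)).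
rewrite -[leqRHS]cardsUI -setIUr leq_add2l setIACA setIid.
by rewrite subset_leq_card // subsetI IB subsetIr.
Qed.

Lemma dep_circuit X : ~~ indep X -> exists2 C, circuit Bs C & C \subset X.
Proof.
move=> dX; have PX : (~~ indep X) && (X \subset X) by rewrite dX /=.
case: (@arg_minnP _ X (fun C => ~~ indep C && (C \subset X)) (fun C => #|C|) PX).
move=> C /andP[dC CX] Cmin; exists C => //; rewrite /circuit dC; apply/forall_inP => x xC.
apply: contraT => dCx; have := Cmin (C :\ x); rewrite dCx (subset_trans (subD1set _ _) CX).
by move=> /(_ isT); rewrite (cardsD1 x C) xC add1n ltnn.
Qed.

Lemma circuit_proper C I : circuit Bs C -> I \proper C -> indep I.
Proof.
case/andP => _ /forall_inP HC /properP[IC [x xC xI]].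
by apply: indepS (HC x xC); rewrite subsetD1 IC.
Qed.

Lemma circuit_dep C : circuit Bs C -> ~~ indep C.
Proof. by case/andP. Qed.

End MatroidRank.

Lemma subset_between (T : finType) (I X : {set T}) m :
  I \subset X -> (#|I| <= m <= #|X|)%N -> exists J : {set T}, [/\ I \subset J, J \subset X & #|J| = m].
Proof.
move=> IX /andP[Im mX]; elim: m Im mX => [|m IH].
  by rewrite leqn0 cards_eq0 => /eqP -> _; exists set0; rewrite cards0 !sub0set.
rewrite leq_eqVlt => /predU1P[<- _|Im mX]; first by exists I.
have [J [IJ JX Jm]] := IH Im (ltnW mX).
have /subsetPn[x xX xJ] : ~~ (X \subset J).
  by apply/negP => /subset_leq_card; rewrite Jm leqNgt mX.
exists (x |: J); rewrite subsetU ?IJ ?orbT // subUset sub1set xX JX.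
by rewrite cardsU1 xJ Jm.
Qed.

(** * Stressed sets in a split matroid *)

Section SplitMatroid.
Variables (n k : nat) (Bs : {set {set 'I_n}}).
Hypotheses (matB : is_matroid Bs) (rkB : has_rank Bs k) (splitB : split_matroid Bs k).
Implicit Types (A B C F G I J X Y : {set 'I_n}).
Local Notation rk := (rk Bs).
Local Notation indep := (indep Bs).

(** These will turn out to be the proper nonempty cyclic flats ([pne_cyclic_flatE]). They are easier
    to handle because restriction and contraction are uniform. *)
Definition relaxed := [set A | stressed Bs A && (Defs.cover Bs k A != set0)].

Lemma connectedP x y : x != y -> exists2 C, circuit Bs C & (x \in C) && (y \in C).
Proof.
case/andP: splitB => /forallP/(_ x)/forallP/(_ y)/implyP H _ /H.
by case/existsP => C /andP[/andP[cC xC] yC]; exists C; rewrite ?xC.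
Qed.

(** A [k]-set that is not a base is added by the relaxation, so it lies in the cover of some relaxed
    [A] and violates the inequality of [A]. *)
Lemma bases_relaxed B :
  (B \in Bs) = (#|B| == k) && [forall A in relaxed, #|B :&: A| <= rk A]%N.
Proof.
case/andP: splitB => _ /eqP/setP/(_ B); rewrite inE [RHS]inE => E.
apply/idP/andP => [BB|[Bk /forall_inP H]].
  by split; [rewrite (rkB BB) | apply/forall_inP => A _; apply: leq_rk].
move: E; rewrite Bk => /orP[//|/bigcupP[A sA]].
by rewrite inE ltnNge H ?andbF // inE.
Qed.

Section Stressed.
Variable A : {set 'I_n}.
Hypothesis sA : A \in relaxed.

Lemma relaxed_rk : (rk A < #|A|)%N /\ (rk A < k)%N.
Proof.
move: sA; rewrite inE => /andP[_ /set0Pn[B]]; rewrite inE => /andP[/eqP Bk rA].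
split; apply: leq_trans rA _; first by rewrite subset_leq_card ?subsetIr.
by rewrite -Bk subset_leq_card ?subsetIl.
Qed.

Lemma relaxed_indep I : I \subset A -> (#|I| <= rk A)%N -> indep I.
Proof.
move=> IA Ir; have [rA _] := relaxed_rk.
have [|J [IJ JA Jr]] := subset_between IA (m := rk A); first by rewrite Ir ltnW.
move: sA; rewrite inE => /andP[/andP[/existsP[r /eqP rE] _] _].
have [B BB BA] := rk_basis matB A.
have : B :&: A \in restr_bases Bs A.
  rewrite inE subsetIr BA eqxx andbT; apply: indepS (subsetIl _ _) (indep_base BB).
rewrite rE inE subsetIr BA => /eqP rr.
have : J \in restr_bases Bs A by rewrite rE inE JA Jr rr eqxx.
by rewrite inE => /andP[/andP[_ iJ] _]; apply: indepS iJ.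
Qed.

(** The upper bound is general. For the lower one, uniformity of the contraction provides a base
    whose part outside [A] is a prescribed set [Y] of [k - rk A] elements, chosen to meet [X] as
    much as possible. *)
Lemma relaxed_contr X : X \subset ~: A -> rk (A :|: X) = (rk A + minn #|X| (k - rk A))%N.
Proof.
move=> XA; have [rA rAk] := relaxed_rk.
move: sA; rewrite inE => /andP[/andP[_ /existsP[s /eqP sE]] _].
have [B BB BA] := rk_basis matB A.
have : B :\: A \in contr_bases Bs A by apply/imsetP; exists B; rewrite ?inE ?BB ?BA /=.
have BDA : #|B :\: A| = (k - rk A)%N by rewrite -(rkB BB) -(cardsID A B) BA addKn.
rewrite sE inE BDA => /andP[BAc /eqP ss].
have kA : (k - rk A <= #|~: A|)%N by rewrite -BDA subset_leq_card.
apply/eqP; rewrite eqn_leq; apply/andP; split.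
  rewrite addn_minr leq_min; apply/andP; split.
    have [B' B'B <-] := rk_basis matB (A :|: X).
    rewrite setIUr; apply: leq_trans (leq_card_setU _ _) _.
    by rewrite leq_add ?leq_rk // subset_leq_card ?subsetIr.
  by rewrite (subnKC (ltnW rAk)) (rk_le matB rkB).
have [Y [H1 H2]] : exists Y, Y \subset ~: A /\ #|Y| = (k - rk A)%N /\ (minn #|X| (k - rk A) <= #|Y :&: X|)%N.
  have [Xk|Xk] := leqP #|X| (k - rk A).
    have [|Y [XY YA Yk]] := subset_between XA (m := (k - rk A)%N); first by rewrite Xk.
    by exists Y; rewrite YA Yk (setIidPr XY).
  have [|Y [_ YX Yk]] := subset_between (sub0set X) (m := (k - rk A)%N).
    by rewrite cards0 leq0n (ltnW Xk).
  by exists Y; rewrite (subset_trans YX XA) Yk (setIidPl YX) Yk.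
case: H2 => H2 H3.
have : Y \in contr_bases Bs A by rewrite sE inE H1 H2 ss eqxx.
case/imsetP => B'; rewrite inE => /andP[B'B /eqP B'A] YE.
rewrite -{1}B'A; apply: leq_trans (leq_rk (A :|: X) B'B).
rewrite setIUr -[leqRHS]addn0 -(@cards0 'I_n).
have -> : set0 = (B' :&: A) :&: (B' :&: X).
  apply/esym/eqP; rewrite -subset0; apply/subsetP => x; rewrite !inE.
  by case/andP => /andP[_ xA] /andP[_ /(subsetP XA)]; rewrite inE xA.
rewrite cardsUI leq_add2l; apply: leq_trans H3 _.
by rewrite subset_leq_card // setSI // YE subsetDl.
Qed.

End Stressed.

Lemma rk_setT : rk [set: 'I_n] = k.
Proof. by have [B BB <-] := rk_basis matB setT; rewrite setIT (rkB BB). Qed.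

(** Otherwise [A] contains a loop, which no circuit joins to an element outside [A]. *)
Lemma relaxed_rk_gt0 A : A \in relaxed -> (0 < rk A)%N.
Proof.
move=> sA; have [rA rAk] := relaxed_rk sA; rewrite lt0n; apply/eqP => r0.
have /card_gt0P[x xA] : (0 < #|A|)%N by apply: leq_trans rA.
have /subsetPn[y _ yA] : ~~ ([set: 'I_n] \subset A).
  by apply/negP => /(rkS matB); rewrite rk_setT leqNgt rAk.
have xy : x != y by apply: contraNneq yA => <-.
have [C cC /andP[xC yC]] := connectedP xy.
have : indep [set x].
  apply: circuit_proper cC _; apply/properP; split; first by rewrite sub1set.
  by exists y; rewrite // inE eq_sym.
rewrite (indep_rk matB) cards1 => /eqP r1.
by have := rkS matB (X := [set x]) (Y := A); rewrite sub1set xA r1 r0 => /(_ isT).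
Qed.

(** Otherwise every base contains the complement of [A], whose elements are then coloops and lie in
    no circuit. *)
Lemma relaxed_contr_card A : A \in relaxed -> (k - rk A < #|~: A|)%N.
Proof.
move=> sA; have [rA rAk] := relaxed_rk sA; rewrite ltnNge; apply/negP => kA.
have /subsetPn[y _ yA] : ~~ ([set: 'I_n] \subset A).
  by apply/negP => /(rkS matB); rewrite rk_setT leqNgt rAk.
have /card_gt0P[x xA] : (0 < #|A|)%N by apply: leq_trans rA.
have yx : y != x by apply: contraNneq yA => ->.
have [C cC /andP[yC _]] := connectedP yx.
have iC : indep (C :\ y) by case/andP: cC => _ /forall_inP/(_ y yC).
case/negP: (circuit_dep cC); case/indepP: iC => B BB CB; apply/indepP; exists B => //.
suff yB : y \in B.
  by apply/subsetP => z zC; have [->|zy] := eqVneq z y => //; apply: (subsetP CB); rewrite !inE zy.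
have : ~: A \subset B :\: A.
  have BA : B :\: A \subset ~: A by rewrite setDE subsetIr.
  have : (#|~: A| <= #|B :\: A|)%N.
    have := leq_rk A BB; have := cardsID A B; rewrite (rkB BB); lia.
  by move=> h; have := eqEcard (B :\: A) (~: A); rewrite BA h => /eqP ->.
by move/subsetP/(_ y); rewrite !inE yA => /(_ isT).
Qed.

Lemma relaxed_flat A x : A \in relaxed -> x \notin A -> rk (x |: A) = (rk A).+1.
Proof.
move=> sA xA; have [_ rAk] := relaxed_rk sA; rewrite setUC relaxed_contr //.
  by rewrite cards1; lia.
by rewrite sub1set inE.
Qed.

Lemma relaxed_pne_cyclic_flat A : A \in relaxed -> pne_cyclic_flat Bs A.
Proof.
move=> sA; have [rA rAk] := relaxed_rk sA; apply/and3P; split; last first.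
- by apply: contraTneq rAk => ->; rewrite rk_setT ltnn.
- by apply: contraTneq rA => ->; rewrite cards0.
apply/andP; split; first by apply/forall_inP => x xA; rewrite relaxed_flat.
apply/forall_inP => x xA.
(* As the restriction to [A] is uniform, any [rk A + 1] elements of [A] form a circuit. *)
have [||J [xJ JA Jr]] := @subset_between _ [set x] A (rk A).+1.
- by rewrite sub1set.
- by rewrite cards1.
have dJ : ~~ indep J.
  apply/negP => /(indep_card_le matB)/(_ JA); by rewrite Jr ltnn.
have [C cC CJ] := dep_circuit dJ; apply/existsP; exists C.
have CE : C = J.
  apply/eqP; rewrite eqEcard CJ Jr ltnNge; apply/negP => Cr.
  case/negP: (circuit_dep cC); apply: (relaxed_indep sA) => //.
  exact: subset_trans CJ JA.
by rewrite cC CE JA -sub1set xJ.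
Qed.

(** If [A1] and [A2] shared [rk A1] elements, flatness and uniformity would force [A1] into [A2],
    then the same rank and equality. So the intersection is independent, and submodularity with the
    uniform contraction leaves only rank [k] for the union. *)
Lemma relaxed_pair A A' : A \in relaxed -> A' \in relaxed -> A != A' ->
  [/\ rk (A :&: A') = #|A :&: A'|, rk (A :|: A') = k & (#|A :&: A'| + k <= rk A + rk A')%N].
Proof.
have one A1 A2 : A1 \in relaxed -> A2 \in relaxed -> A1 != A2 -> (#|A1 :&: A2| < rk A1)%N.
  move=> s1 s2 A12; have [r1 r1k] := relaxed_rk s1; have [r2 r2k] := relaxed_rk s2.
  rewrite ltnNge; apply/negP => h.
  have [|J [_ JI Jr]] := subset_between (sub0set (A1 :&: A2)) (m := rk A1).
    by rewrite cards0.
  have [JA1 JA2] := (subset_trans JI (subsetIl _ _), subset_trans JI (subsetIr _ _)).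
  have iJ : indep J by apply: (relaxed_indep s1); rewrite ?Jr.
  have rI := indep_card_le matB iJ JI; have sub := rk_submod matB rkB A1 A2.
  have rU : (rk (A1 :|: A2) <= rk A2)%N by lia.
  have sA12 : A1 \subset A2.
    apply: contraT => /subsetPn[x xA1 xA2].
    have := rkS matB (X := x |: A2) (Y := A1 :|: A2); rewrite relaxed_flat // leqNgt.
    by rewrite subUset sub1set inE xA1 subsetUr ltnS rU => /(_ isT).
  have r21 : (rk A2 <= rk A1)%N.
    rewrite leqNgt; apply/negP => r12.
    have [|J' [_ J'A Jr']] := subset_between (sub0set A1) (m := (rk A1).+1).
      by rewrite cards0.
    have iJ' : indep J' by apply: (relaxed_indep s2); rewrite ?Jr' // (subset_trans J'A).
    by have := indep_card_le matB iJ' J'A; rewrite Jr' ltnn.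
  case/eqP: A12; apply/eqP; rewrite eqEsubset sA12 /=; apply: contraT => /subsetPn[x xA2 xA1].
  have := rkS matB (X := x |: A1) (Y := A2); rewrite relaxed_flat // subUset sub1set xA2 sA12.
  by move/(_ isT); lia.
move=> s1 s2 A12; have [r1 r1k] := relaxed_rk s1; have [r2 r2k] := relaxed_rk s2.
have h1 := one _ _ s1 s2 A12.
have rI : rk (A :&: A') = #|A :&: A'|.
  apply/eqP; rewrite -(indep_rk matB); apply: (relaxed_indep s1); first exact: subsetIl.
  exact: ltnW.
have rU : rk (A :|: A') = (rk A + minn #|A' :\: A| (k - rk A))%N.
  have -> : A :|: A' = A :|: (A' :\: A) by apply/setP => x; rewrite !inE; case: (x \in A).
  by rewrite relaxed_contr // setDE subsetIr.
have sub := rk_submod matB rkB A A'.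
have cD : (#|A' :\: A| + #|A :&: A'|)%N = #|A'| by rewrite addnC setIC cardsID.
have kU : rk (A :|: A') = k by lia.
by rewrite rI kU in sub *; split=> //; lia.
Qed.

(** Elements are added until a base is reached. If [A] is tight, the new element is taken outside
    [A]; it violates no other tight constraint, since two tight sets would force [#|I| >= k]. *)
Lemma indep_relaxed I : (#|I| <= k)%N -> {in relaxed, forall A, #|I :&: A| <= rk A}%N -> indep I.
Proof.
have [m] := ubnP (k - #|I|); elim: m I => // m IH I Im Ik HI.
have [Ik'|Ik'] := leqP k #|I|.
  apply: indep_base; rewrite bases_relaxed; apply/andP; split; first by rewrite eqn_leq Ik Ik'.
  by apply/forall_inP.
have tight A : A \in relaxed -> #|I :&: A| = rk A ->
    exists2 x, x \notin I & {in relaxed, forall A', x \in A' -> #|I :&: A'| < rk A'}%N.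
  move=> sA tA;
  have [rA rAk] := relaxed_rk sA; have cA := relaxed_contr_card sA.
  have /subsetPn[x] : ~~ (~: A \subset I :\: A).
    apply/negP => /subset_leq_card h; have := cardsID A I; lia.
  rewrite !inE => xA /negbTE; rewrite xA /= => xI; exists x; first by rewrite xI.
  move=> A' sA' xA'; rewrite ltn_neqAle HI // andbT; apply/eqP => tA'.
  have AA' : A != A' by apply: contraNneq xA => ->.
  have [_ _ h] := relaxed_pair sA sA' AA'.
  have := cardsUI (I :&: A) (I :&: A'); rewrite -setIUr -setIIr.
  have : (#|I :&: (A :&: A')| <= #|A :&: A'|)%N by rewrite subset_leq_card ?subsetIr.
  have : (#|I :&: (A :|: A')| <= #|I|)%N by rewrite subset_leq_card ?subsetIl.
  rewrite tA tA' => h1 h2 h3; clear -Ik' h h1 h2 h3. lia.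
have [x xI Hx] : exists2 x, x \notin I &
    {in relaxed, forall A, x \in A -> #|I :&: A| < rk A}%N.
  have [/existsP[A /andP[sA /eqP tA]]|] := boolP [exists A, (A \in relaxed) && (#|I :&: A| == rk A)].
    exact: tight sA tA.
  rewrite negb_exists => /forallP nt.
  have /subsetPn[x _ xI] : ~~ ([set: 'I_n] \subset I).
    apply/negP => TI; have := rk_le_card matB setT; rewrite rk_setT => h.
    by have := leq_trans h (subset_leq_card TI); rewrite leqNgt Ik'.
  exists x => // A sA _; rewrite ltn_neqAle HI // andbT.
  by have := nt A; rewrite sA.
apply: indepS (subsetUr [set x] I) _; apply: IH; rewrite ?cardsU1 ?xI //; first by lia.
move=> A sA; rewrite setIUl; have [xA|xA] := boolP (x \in A).
  apply: leq_trans (leq_card_setU _ _) (leq_trans _ (Hx A sA xA)).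
  by rewrite -add1n leq_add2r -(cards1 x) subset_leq_card ?subsetIl.
suff -> : [set x] :&: A = set0 by rewrite set0U HI.
by apply/setP => y; rewrite !inE; case: eqP => [->|] //; rewrite (negbTE xA).
Qed.

(** The circuit must violate the inequality of some [A]. If it were not contained in [A], then
    [C :&: A] would be independent with more than [rk A] elements. *)
Lemma small_circuit C : circuit Bs C -> (#|C| <= k)%N ->
  exists A, [/\ A \in relaxed, C \subset A & (rk A < #|C|)%N].
Proof.
move=> cC Ck; have [/forall_inP H|] := boolP [forall A in relaxed, #|C :&: A| <= rk A]%N.
  by case/negP: (circuit_dep cC); apply: indep_relaxed.
rewrite negb_forall => /existsP[A]; rewrite negb_imply -ltnNge => /andP[sA rC].
have CA : C \subset A.
  apply: contraT => nCA; have : indep (C :&: A).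
    apply: circuit_proper cC _; rewrite properEneq subsetIl andbT.
    by apply: contra nCA => /eqP <-; apply: subsetIr.
  by move/(indep_card_le matB)/(_ (subsetIr C A)); rewrite leqNgt rC.
by exists A; rewrite -{2}(setIidPl CA).
Qed.

(** A circuit in a proper flat [F] has at most [k] elements, so it lies in a relaxed set, which is
    contained in [F] by submodularity. Two distinct such sets would have a union of rank [k]; hence
    a single one covers [F]. *)
Lemma pne_cyclic_flatE F : pne_cyclic_flat Bs F = (F \in relaxed).
Proof.
apply/idP/idP => [|/relaxed_pne_cyclic_flat //].
case/and3P => /andP[/forall_inP flF /forall_inP cyF] /set0Pn[x0 x0F] FT.
have /subsetPn[z _ zF] : ~~ ([set: 'I_n] \subset F).
  by apply: contra FT; rewrite -subTset.
have rFk : (rk F < k)%N by apply: leq_trans (flF z zF) (rk_le matB rkB _).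
have getA x : x \in F -> exists A, [/\ A \in relaxed, x \in A & A \subset F].
  move=> /cyF/existsP[C /andP[/andP[cC CF] xC]].
  have iC : indep (C :\ x) by case/andP: cC => _ /forall_inP/(_ x xC).
  have Cx := cardsD1 x C; rewrite xC in Cx.
  have iCF := indep_card_le matB iC (subset_trans (subD1set C x) CF).
  have [|A [sA CA rC]] := small_circuit cC; first by clear -Cx iCF rFk; lia.
  exists A; split=> //; first exact: (subsetP CA).
  apply/subsetP => y yA; apply: contraT => yF.
  have CI : C :\ x \subset F :&: A.
    by rewrite (subset_trans (subD1set _ _)) // subsetI CF.
  have h1 := indep_card_le matB iC CI; have h2 := rk_submod matB rkB F A.
  have h3 := flF y yF; have h4 : (rk (y |: F) <= rk (F :|: A))%N.
    by apply: (rkS matB); rewrite subUset sub1set inE yA orbT subsetUl.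
  clear -h1 h2 h3 h4 rC Cx; lia.
have [A [sA xA AF]] := getA x0 x0F.
suff -> : F = A by [].
apply/eqP; rewrite eqEsubset AF andbT; apply: contraT => /subsetPn[x1 x1F x1A].
have [A' [sA' xA' AF']] := getA x1 x1F.
have AA' : A != A' by apply: contraNneq x1A => ->.
have [_ h _] := relaxed_pair sA sA' AA'.
have := rkS matB (X := A :|: A') (Y := F); rewrite subUset AF AF' h => /(_ isT).
by rewrite leqNgt rFk.
Qed.

Lemma modularE F G : F \in relaxed -> G \in relaxed -> F != G ->
  modular Bs F G = (#|F :&: G| + k == rk F + rk G)%N.
Proof.
move=> sF sG FG; have [h1 h2 _] := relaxed_pair sF sG FG.
by rewrite /modular h1 h2 eq_sym (addnC k).
Qed.

(* By connectedness [M] is not the direct sum of [M|F] and [M|G]. *)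
Lemma modular_not_compl F G : F \in relaxed -> G \in relaxed -> F != G ->
  (#|F :&: G| + k = rk F + rk G)%N -> F :|: G = setT -> F :&: G != set0.
Proof.
move=> sF sG FG mod FGT; apply/eqP => FG0; rewrite FG0 cards0 add0n in mod.
have [[rF _] [rG _]] := (relaxed_rk sF, relaxed_rk sG).
have /card_gt0P[x xF] : (0 < #|F|)%N by apply: leq_trans rF.
have /card_gt0P[y yG] : (0 < #|G|)%N by apply: leq_trans rG.
have yF : y \notin F by apply/negP => yF; have := in_set0 y; rewrite -FG0 inE yF yG.
have xG : x \notin G by apply/negP => xG; have := in_set0 x; rewrite -FG0 inE xF xG.
have xy : x != y by apply: contraNneq yF => <-.
have [C cC /andP[xC yC]] := connectedP xy.
have iF : indep (C :&: F).
  by apply: circuit_proper cC _; apply/properP; split; [exact: subsetIl | exists y; rewrite // inE (negbTE yF) andbF].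
have iG : indep (C :&: G).
  by apply: circuit_proper cC _; apply/properP; split; [exact: subsetIl | exists x; rewrite // inE (negbTE xG) andbF].
have hF := indep_card_le matB iF (subsetIr _ _); have hG := indep_card_le matB iG (subsetIr _ _).
have CE := cardsUI (C :&: F) (C :&: G).
rewrite -setIUr -setIIr FGT FG0 setIT setI0 cards0 in CE.
have [|A [sA CA rC]] := small_circuit cC; first by clear -CE hF hG mod; lia.
have FA : F != A by apply: contraNneq yF => ->; apply: (subsetP CA).
have GA : G != A by apply: contraNneq xG => ->; apply: (subsetP CA).
have [_ _ h1] := relaxed_pair sF sA FA; have [_ _ h2] := relaxed_pair sG sA GA.
have AE := cardsUI (F :&: A) (G :&: A).
rewrite -setIUl -setIIl FGT FG0 setTI set0I cards0 in AE.
by have [rA rAk] := relaxed_rk sA; clear -h1 h2 AE rA rAk mod; lia.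
Qed.

End SplitMatroid.

(** * Faces of the hypersimplex *)

Section Families.
Variables (n k : nat).
Implicit Types (A B Z F G : {set 'I_n}) (V W Y s : {set {set 'I_n}}) (x y z : 'I_n).
Local Notation ind := (@indic n).

Definition swap B x y : {set 'I_n} := y |: B :\ x.

Lemma dotv_indic (c : 'rV[rat]_n) B : dotv c (ind B) = \sum_(i in B) c 0 i.
Proof.
rewrite dotvE [RHS]big_mkcond; apply: eq_bigr => i _; rewrite mxE.
by case: ifP => _; rewrite (mulr1, mulr0).
Qed.

Lemma indic_swap B x y : x \in B -> y \notin B ->
  ind (swap B x y) = ind B - delta_mx 0 x + delta_mx 0 y.
Proof.
move=> xB yB; apply/rowP => i; rewrite !mxE !inE /=.
have [->|iy] := eqVneq i y.
  rewrite (negbTE yB) /=; have -> : (y == x) = false by apply: contraNF yB => /eqP ->.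
  by rewrite subr0 add0r.
have [->|ix] := eqVneq i x; rewrite /= ?mulr0n ?mulr1n addr0; first by rewrite xB subrr.
by rewrite subr0.
Qed.

Lemma card_swap B x y : x \in B -> y \notin B -> #|swap B x y| = #|B|.
Proof.
move=> xB yB; rewrite cardsU1 (cardsD1 x B) xB; congr (_ + _)%N.
by rewrite !inE (negbTE yB) andbF.
Qed.

Lemma card_swapI B x y F : x \in B -> y \notin B ->
  (#|swap B x y :&: F| + (x \in F) = #|B :&: F| + (y \in F))%N.
Proof.
move=> xB yB; have xy : (x == y) = false by apply: contraNF yB => /eqP <-.
rewrite (cardsD1 x (B :&: F)) (cardsD1 y (swap B x y :&: F)) !inE xB eqxx /=.
have -> : (swap B x y :&: F) :\ y = (B :&: F) :\ x.
  apply/setP => i; rewrite !inE; have [->|iy] := eqVneq i y; last by rewrite /= andbA.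
  by rewrite (negbTE yB) andbF.
by rewrite addnC addnCA [RHS]addnC.
Qed.

Definition ksets : {set {set 'I_n}} := [set B : {set 'I_n} | #|B| == k].
(** The nonempty intervals are the faces of the hypersimplex ([itv_face], [face_hull]): coordinates
    in [A] are fixed to 1, those outside [Z] to 0. *)
Definition kitv A Z : {set {set 'I_n}} := [set B in ksets | (A \subset B) && (B \subset Z)].
Definition core Y : {set 'I_n} := \bigcap_(B in Y) B.
Definition supp Y : {set 'I_n} := \bigcup_(B in Y) B.
Definition hull Y := kitv (core Y) (supp Y).
Definition freeset Y := supp Y :\: core Y.

Lemma ksetsP B : reflect (#|B| = k) (B \in ksets).
Proof. by rewrite inE; apply: eqP. Qed.

Lemma kitvP A Z B : reflect [/\ #|B| = k, A \subset B & B \subset Z] (B \in kitv A Z).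
Proof. by rewrite !inE; apply: (iffP and3P) => -[/eqP]. Qed.

Lemma itv_sub A Z : kitv A Z \subset ksets.
Proof. by apply/subsetP => B; rewrite inE => /andP[]. Qed.

Lemma swap_itv A Z B x y : B \in kitv A Z -> x \in B -> x \notin A -> y \notin B -> y \in Z ->
  swap B x y \in kitv A Z.
Proof.
case/kitvP => Bk AB BZ xB xA yB yZ; apply/kitvP; split; first by rewrite card_swap.
  by rewrite subsetU // subsetD1 AB xA orbT.
by rewrite subUset sub1set yZ (subset_trans (subD1set _ _) BZ).
Qed.

Lemma core_sub Y B : B \in Y -> core Y \subset B.
Proof. by move=> BY; apply: bigcap_inf. Qed.
Lemma supp_sub Y B : B \in Y -> B \subset supp Y.
Proof. by move=> BY; apply: (bigcup_sup B). Qed.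
Lemma coreP Y x : x \notin core Y -> exists2 B, B \in Y & x \notin B.
Proof.
move=> H; have [/exists_inP[B BY xB]|] := boolP [exists B in Y, x \notin B]; first by exists B.
rewrite negb_exists => /forallP nx; case/negP: H; apply/bigcapP => B BY.
by have := nx B; rewrite BY negbK.
Qed.
Lemma suppP Y x : x \in supp Y -> exists2 B, B \in Y & x \in B.
Proof. by case/bigcupP => B BY xB; exists B. Qed.

Lemma sub_hull Y : Y \subset ksets -> Y \subset hull Y.
Proof.
move=> YV; apply/subsetP => B BY; apply/kitvP.
by split; [apply/ksetsP/(subsetP YV) | apply: core_sub | apply: supp_sub].
Qed.

Lemma coreS Y W : Y \subset W -> core W \subset core Y.
Proof. by move=> YW; apply/bigcapsP => B /(subsetP YW); apply: core_sub. Qed.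
Lemma suppS Y W : Y \subset W -> supp Y \subset supp W.
Proof. by move=> YW; apply/bigcupsP => B /(subsetP YW); apply: supp_sub. Qed.

Lemma kitvS A Z A' Z' : A' \subset A -> Z \subset Z' -> kitv A Z \subset kitv A' Z'.
Proof.
move=> AA ZZ; apply/subsetP => B /kitvP[Bk AB BZ].
by apply/kitvP; split; [| apply: subset_trans AB | apply: subset_trans ZZ].
Qed.

Lemma hullS Y W : Y \subset W -> hull Y \subset hull W.
Proof. by move=> YW; apply: kitvS; [apply: coreS | apply: suppS]. Qed.

(** The functional rewards the elements of [A] and penalises those outside [Z]; its bound [#|A|] is
    attained exactly on the interval. *)
Lemma itv_face A Z : kitv A Z != set0 -> kitv A Z \in faces ind ksets.
Proof.
move=> I0; apply/facesP; exists (ind A - ind (~: Z)); apply/esym.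
have dE C B : dotv (ind C) (ind B) = #|B :&: C|%:R.
  rewrite dotv_indic -sum1_card natr_sum [LHS]big_mkcond [RHS]big_mkcond /=.
  by apply: eq_bigr => i _; rewrite mxE inE; case: (i \in B); case: (i \in C).
apply: (@argm_eq _ _ _ _ _ (#|A|%:R)) => //; first exact: itv_sub.
move=> B BV; rewrite dotvBl !dE inE BV /=.
have cA : (#|B :&: A| <= #|A|)%N by rewrite subset_leq_card ?subsetIr.
have -> : (A \subset B) = (#|B :&: A| == #|A|).
  apply/idP/eqP => [/setIidPr ->//|E]; apply/setIidPr/eqP.
  by rewrite eqEcard subsetIr E leqnn.
have -> : (B \subset Z) = (#|B :&: ~: Z| == 0%N).
  by rewrite cards_eq0 setI_eq0 disjoints_subset setCK.
move: cA; move: (#|B :&: A|) (#|B :&: ~: Z|) (#|A|) => p q m pm.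
rewrite lerBlDr -natrD ler_nat subr_eq -natrD eqr_nat.
split; first by lia.
by apply/eqP/andP => [E|[/eqP -> /eqP ->]]; [split; apply/eqP; lia | rewrite addn0].
Qed.

(** Opposite exchanges in two maximisers preserve the sum of the two values, so both results are
    maximisers again. *)
Lemma face_swap s B B' x y : s \in faces ind ksets -> B \in s -> B' \in s ->
  x \in B -> x \notin B' -> y \in B' -> y \notin B -> swap B x y \in s.
Proof.
case/facesP => c -> Bs B's xB xB' yB' yB.
move: Bs B's; rewrite !inE => /andP[Bk /forall_inP Bm] /andP[B'k /forall_inP B'm].
have k1 : swap B x y \in ksets by rewrite inE card_swap.
have k2 : swap B' y x \in ksets by rewrite inE card_swap.
rewrite card_swap // Bk /=; have h1 := Bm _ k1; have h2 := B'm _ k2.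
have h3 : dotv c (ind B) <= dotv c (ind B') by apply: B'm; rewrite inE.
have h4 : dotv c (ind B') <= dotv c (ind B) by apply: Bm; rewrite inE.
rewrite indic_swap // dotvDr dotvBr in h1; rewrite indic_swap // dotvDr dotvBr in h2.
apply/forall_inP => C CV; have h5 := Bm C CV; rewrite indic_swap // dotvDr dotvBr.
lra.
Qed.

(** Take [C] in [s] closest to [B] and exchange a surplus [x] for a missing [y]. Members of [s]
    avoiding [x], and others containing [y], exist by the choice of core and support; if none of
    those at hand does both, [face_swap] builds one. *)
Lemma face_hull s : s \in faces ind ksets -> hull s = s.
Proof.
move=> sF; have sV := faces_sub sF; apply/eqP; rewrite eqEsubset sub_hull // andbT.
apply/subsetP => B /kitvP[Bk AB BZ].
have [s0|[C0 C0s]] := set_0Vmem s.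
  have [B0|[i iB]] := set_0Vmem B.
    have : ksets = set0.
      apply/eqP; apply: contraT => V0; have := faces_neq0 V0 sF; by rewrite s0 eqxx.
    by move/setP/(_ B); rewrite !inE Bk eqxx.
  by have := subsetP BZ i iB; rewrite /supp s0 big_set0 inE.
case: (@arg_minnP _ C0 (mem s) (fun C => #|C :\: B|) C0s) => C Cs Cmin.
have Ck : #|C| = k by apply/ksetsP/(subsetP sV).
have [CB|] := boolP (C \subset B).
  suff <- : C = B by [].
  by apply/eqP; rewrite eqEcard CB Bk Ck leqnn.
case/subsetPn => x xC xB; have [y yB yC] : exists2 y, y \in B & y \notin C.
  apply/subsetPn; apply: contraNN xB => BC.
  have /eqP -> : B == C by rewrite eqEcard BC Bk Ck leqnn.
  by [].
have [B1 B1s xB1] : exists2 B1, B1 \in s & x \notin B1.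
  by apply: coreP; apply: contra xB; apply: (subsetP AB).
have [B2 B2s yB2] := suppP (subsetP BZ y yB).
suff sw : swap C x y \in s.
  have := Cmin _ sw; rewrite leqNgt => /negP[]; apply: proper_card; apply/properP; split.
    apply/subsetP => z; rewrite !inE; case: eqP => [->|_] /=; first by rewrite yB.
    by case/and3P => -> _ ->.
  exists x; first by rewrite inE xB.
  rewrite !inE eqxx orbF negb_and negbK; apply/orP; right.
  by apply: contraNN xB => /eqP ->.
have [yB1|yB1] := boolP (y \in B1); first exact: face_swap sF Cs B1s xC xB1 yB1 yC.
have [xB2|xB2] := boolP (x \in B2); last exact: face_swap sF Cs B2s xC xB2 yB2 yC.
have B1k : #|B1| = k by apply/ksetsP/(subsetP sV).
have B2k : #|B2| = k by apply/ksetsP/(subsetP sV).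
(* Replacing [x] by [z] in [B2] gives a member that avoids [x] and contains [y]. *)
have [z zB1 zB2] : exists2 z, z \in B1 & z \notin B2.
  apply/subsetPn; apply: contraNN xB1 => B12.
  have /eqP -> : B1 == B2 by rewrite eqEcard B12 B1k B2k leqnn.
  by [].
have sw := face_swap sF B2s B1s xB2 xB1 zB1 zB2.
have xz : x != z by apply: contraNneq zB2 => <-.
have yx : y != x by apply: contraNneq yC => ->.
apply: (face_swap sF Cs sw xC _ _ yC); rewrite !inE.
  by rewrite eqxx orbF.
by rewrite yB2 yx orbT.
Qed.
End Families.

(** * Dimension of faces through swaps *)

Section FaceDimension.
Variables (n k : nat).
Implicit Types (A B Z F G T : {set 'I_n}) (V W Y s : {set {set 'I_n}}) (x y z : 'I_n).
Local Notation ind := (@indic n).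
Local Notation ksets := (ksets n k).
Local Notation swap := (@swap n).

Definition dirs Y B0 : {vspace 'rV[rat]_n} := <<[seq ind B - ind B0 | B <- enum Y]>>%VS.

Lemma dirs_mem Y B0 B B' : B \in Y -> B' \in Y -> ind B - ind B' \in dirs Y B0.
Proof.
have inW C : C \in Y -> ind C - ind B0 \in dirs Y B0.
  by move=> CY; apply/memv_span/mapP; exists C; rewrite ?mem_enum.
move=> BY B'Y; rewrite -(subrKA (ind B0)) -[ind B0 - _]opprB.
by apply: memvD; rewrite ?memvN inW.
Qed.

(** A swap contributes the direction between an element in [B0] and one not in [B0]; elements on the
    same side are joined through [u] or [v]. *)
Lemma block_dirs Y B0 T u v x x' :
  u \in T :&: B0 -> v \in T :\: B0 ->
  {in T :&: B0 & T :\: B0, forall y z, swap B0 y z \in Y} ->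
  x \in T -> x' \in T -> B0 \in Y ->
  (delta_mx 0 x - delta_mx 0 x' : 'rV[rat]_n) \in dirs Y B0.
Proof.
move=> uT vT sw xT x'T B0Y.
have D1 y z : y \in T :&: B0 -> z \in T :\: B0 ->
    (delta_mx 0 z - delta_mx 0 y : 'rV[rat]_n) \in dirs Y B0.
  move=> yT zT; have := dirs_mem B0 (sw y z yT zT) B0Y.
  move: yT zT; rewrite !inE => /andP[_ yB] /andP[zB _]; rewrite indic_swap //.
  by rewrite addrAC [ind B0 - _ - _]addrAC subrr add0r addrC.
have D2 y z : y \in T :\: B0 -> z \in T :&: B0 ->
    (delta_mx 0 z - delta_mx 0 y : 'rV[rat]_n) \in dirs Y B0.
  by move=> yT zT; rewrite -opprB memvN D1.
have tri (a b c : 'rV[rat]_n) : a - b \in dirs Y B0 -> b - c \in dirs Y B0 -> a - c \in dirs Y B0.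
  by move=> h1 h2; rewrite -(subrKA b) memvD.
have cl y : y \in T -> (y \in T :&: B0) || (y \in T :\: B0).
  by move=> yT; rewrite !inE yT andbT /=; case: (y \in B0).
case/orP: (cl x xT) => xB; case/orP: (cl x' x'T) => xB'.
- by apply: (tri _ (delta_mx 0 v)); [apply: D2 | apply: D1].
- exact: D2.
- exact: D1.
- by apply: (tri _ (delta_mx 0 u)); [apply: D1 | apply: D2].
Qed.

Lemma card_le_dim (S : {set 'I_n}) (U : {vspace 'rV[rat]_n}) :
  {in S, forall x, (delta_mx 0 x : 'rV[rat]_n) \in U} -> (#|S| <= \dim U)%N.
Proof.
move=> H; pose X := [seq (delta_mx 0 x : 'rV[rat]_n) | x <- enum S].
have fX : free X.
  have -> : X = [seq (delta_mx 0 x : 'rV[rat]_n) | x <- enum S] by [].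
  elim: (enum S) (enum_uniq S) => [|x s IH]; first by rewrite nil_free.
  rewrite cons_uniq => /andP[xs us]; rewrite /= free_cons IH // andbT.
  apply/negP => /dotv_span => /(_ (delta_mx 0 x)) E.
  have dE (y z : 'I_n) : dotv (delta_mx 0 y) (delta_mx 0 z) = (y == z)%:R.
    rewrite /dotv trmx_delta mul_delta_mx_cond.
    by case: (y == z); rewrite ?mulr1n ?mulr0n !mxE.
  have : dotv (delta_mx 0 x) (delta_mx 0 x : 'rV[rat]_n) = 0.
    apply: E => y /mapP[z zs ->]; rewrite dE; case: eqP => // xz.
    by rewrite xz zs in xs.
  by rewrite dE eqxx => /eqP; rewrite oner_eq0.
have := fX; rewrite /free size_map -cardE => /eqP <-; apply/dimvS/span_subvP.
by move=> y /mapP[x]; rewrite mem_enum => /H xU ->.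
Qed.

(** The directions together with one coordinate vector per block span all coordinate vectors of the
    blocks, whence the 2. *)
Lemma block_dim Y B0 T1 T2 u1 v1 u2 v2 : B0 \in Y ->
  u1 \in T1 :&: B0 -> v1 \in T1 :\: B0 -> u2 \in T2 :&: B0 -> v2 \in T2 :\: B0 ->
  {in T1 :&: B0 & T1 :\: B0, forall y z, swap B0 y z \in Y} ->
  {in T2 :&: B0 & T2 :\: B0, forall y z, swap B0 y z \in Y} ->
  (#|T1 :|: T2| <= (fdim ind Y).+2)%N.
Proof.
move=> B0Y u1T v1T u2T v2T sw1 sw2; rewrite (fdimE ind B0Y) -/(dirs Y B0).
pose U : {vspace 'rV[rat]_n} := (<[delta_mx 0%R u1]> + (<[delta_mx 0%R u2]> + dirs Y B0))%VS.
have dU : (\dim U <= (\dim (dirs Y B0)).+2)%N.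
  by apply: leq_trans (dim_add_vline_le _ _) _; rewrite ltnS dim_add_vline_le.
apply: leq_trans dU; apply: card_le_dim => x; rewrite inE => /orP[] xT.
  have u1T1 : u1 \in T1 by move: u1T; rewrite inE => /andP[].
  rewrite -(subrK (delta_mx 0 u1) (delta_mx 0 x)) addrC; apply: memv_add (memv_line _) _.
  by apply: (subvP (addvSr _ _)); exact: (block_dirs u1T v1T sw1 xT u1T1 B0Y).
have u2T2 : u2 \in T2 by move: u2T; rewrite inE => /andP[].
rewrite -(subrK (delta_mx 0 u2) (delta_mx 0 x)) addrC.
apply: (subvP (addvSr _ _)); apply: memv_add (memv_line _) _.
exact: (block_dirs u2T v2T sw2 xT u2T2 B0Y).
Qed.

Lemma block_dim1 Y B0 T u v : B0 \in Y -> u \in T :&: B0 -> v \in T :\: B0 ->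
  {in T :&: B0 & T :\: B0, forall y z, swap B0 y z \in Y} -> (#|T| <= (fdim ind Y).+1)%N.
Proof.
move=> B0Y uT vT sw; rewrite (fdimE ind B0Y) -/(dirs Y B0).
apply: leq_trans (dim_add_vline_le (delta_mx 0 u) _).
apply: card_le_dim => x xT; have uT1 : u \in T by move: uT; rewrite inE => /andP[].
rewrite -(subrK (delta_mx 0 u) (delta_mx 0 x)) addrC; apply: memv_add (memv_line _) _.
exact: (block_dirs uT vT sw xT uT1 B0Y).
Qed.

(** All directions lie in the space of the free coordinates and have coordinate sum zero, whereas
    the coordinate vector of [x0] has sum one. *)
Lemma dim_le_free Y x0 : Y \subset ksets -> x0 \in freeset Y -> (fdim ind Y < #|freeset Y|)%N.
Proof.
move=> YV x0S; have [Y0|[B0 B0Y]] := set_0Vmem Y; first by rewrite {1}Y0 fdim0; apply/card_gt0P; exists x0.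
rewrite (fdimE ind B0Y) -/(dirs Y B0).
pose X := [seq (delta_mx 0 x : 'rV[rat]_n) | x <- enum (freeset Y)].
have WX : (dirs Y B0 <= <<X>>)%VS.
  apply/span_subvP => w /mapP[B]; rewrite mem_enum => BY ->.
  have -> : ind B - ind B0 = \sum_(x in freeset Y) (ind B - ind B0) 0 x *: delta_mx 0 x.
    rewrite {1}(row_sum_delta (ind B - ind B0)) [RHS]big_mkcond; apply: eq_bigr => x _.
    case: ifP => // /negbT xS; suff -> : (ind B - ind B0) 0 x = 0 by rewrite scale0r.
    have [xc|xc] := boolP (x \in core Y).
      by rewrite !mxE (subsetP (core_sub BY) x xc) (subsetP (core_sub B0Y) x xc) subrr.
    have xs : x \notin supp Y by move: xS; rewrite inE xc.
    rewrite !mxE ifF ?ifF ?subrr //; apply: contraNF xs => h.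
      exact: (subsetP (supp_sub B0Y)).
    exact: (subsetP (supp_sub BY)).
  apply: memv_suml => x xS; apply: memvZ; apply/memv_span/mapP; exists x => //.
  by rewrite mem_enum.
have nX : delta_mx 0 x0 \notin dirs Y B0.
  apply/negP => /dotv_span => /(_ (const_mx 1)) E.
  have : dotv (const_mx 1) (delta_mx 0 x0 : 'rV[rat]_n) = 0.
    apply: E => w /mapP[B]; rewrite mem_enum => BY ->; rewrite dotvBr !dotv_indic.
    have cE C : C \in Y -> \sum_(i in C) (const_mx 1 : 'rV[rat]_n) 0 i = k%:R.
      move=> CY; under eq_bigr => i _ do rewrite mxE.
      by rewrite sumr_const; move/(subsetP YV)/ksetsP: CY => ->.
    by rewrite !cE // subrr.
  rewrite dotvE (bigD1 x0) //= big1 => [|i ix]; last by rewrite !mxE (negbTE ix) mulr0.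
  by rewrite !mxE !eqxx mulr1 addr0 => /eqP; rewrite oner_eq0.
have sX : size X = #|freeset Y| by rewrite size_map -cardE.
rewrite -sX; apply: leq_trans (dim_span X).
rewrite -(dim_add_vline nX); apply/dimvS; rewrite subv_add WX andbT -memvE.
by apply/memv_span/mapP; exists x0; rewrite // mem_enum.
Qed.

Lemma free_ltn s x0 B : s \in faces ind ksets -> x0 \in freeset s -> B \in s ->
  exists u v, u \in freeset s :&: B /\ v \in freeset s :\: B.
Proof.
move=> sF; rewrite inE => /andP[x0c x0s] Bs; have sV := faces_sub sF.
have Bk := ksetsP _ _ (subsetP sV B Bs).
have [B1 B1s xB1] := coreP x0c; have [B2 B2s xB2] := suppP x0s.
have B1k := ksetsP _ _ (subsetP sV _ B1s); have B2k := ksetsP _ _ (subsetP sV _ B2s).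
have [C Cs CB] : exists2 C, C \in s & C != B.
  have [E|] := eqVneq B1 B; last by exists B1.
  by exists B2 => //; apply: contraNneq xB1 => E2; rewrite E -E2.
have Ck := ksetsP _ _ (subsetP sV _ Cs).
have /subsetPn[v vC vB] : ~~ (C \subset B).
  by apply: contra CB => CB; rewrite eqEcard CB Ck Bk leqnn.
have /subsetPn[u uB uC] : ~~ (B \subset C).
  by apply: contra CB => BC; rewrite eq_sym eqEcard BC Ck Bk leqnn.
exists u, v; rewrite !inE uB vB /= ?andbT; split; apply/andP; split.
- by apply: contra uC; apply: (subsetP (core_sub Cs)).
- exact: (subsetP (supp_sub Bs)).
- by apply: contra vB; apply: (subsetP (core_sub Bs)).
- exact: (subsetP (supp_sub Cs)).
Qed.

Lemma swap_face s B x y : s \in faces ind ksets -> B \in s ->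
  x \in freeset s :&: B -> y \in freeset s :\: B -> swap B x y \in s.
Proof.
move=> sF Bs xs ys; rewrite -(face_hull sF) in Bs *.
move: xs ys; rewrite in_setI in_setD in_setD [in X in _ -> X -> _]in_setD.
by case/andP => /andP[xc _] xB /and3P[yB _ ys]; apply: swap_itv.
Qed.

Lemma fdim_face s x0 : s \in faces ind ksets -> x0 \in freeset s ->
  (fdim ind s).+1 = #|freeset s|.
Proof.
move=> sF x0s; apply/eqP; rewrite eqn_leq (dim_le_free (faces_sub sF) x0s) /=.
have [B Bs] : exists B, B \in s.
  by move: x0s; rewrite inE => /andP[_ /suppP[B]]; exists B.
have [u [v [uB vB]]] := free_ltn sF x0s Bs.
by apply: (block_dim1 Bs uB vB) => y z yB zB; apply: swap_face.
Qed.

End FaceDimension.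

(** * Cutting the hypersimplex *)

Section Cuts.
Variables (n k : nat) (R : {set {set 'I_n}}) (r : {set 'I_n} -> nat).
Implicit Types (A B Z F G : {set 'I_n}) (V W Y s t : {set {set 'I_n}}) (x y z : 'I_n).
Local Notation ind := (@indic n).
Local Notation V := (ksets n k).
Local Notation swap := (@swap n).

(** The matroid is abstracted to a family [R] with bounds [r]. A face is [cut] by [F] if it has
    vertices strictly on both sides, [out] if it is on the forbidden side but not inside the
    hyperplane; [dbl] marks the exceptional faces, which are cut by exactly two members of [R]
    ([dbl_pair]). *)
Definition cutQ : {set {set 'I_n}} := [set B in V | [forall F in R, #|B :&: F| <= r F]%N].
Definition cut F s := [exists B in s, #|B :&: F| < r F]%N && [exists B in s, r F < #|B :&: F|]%N.
Definition out F s := [forall B in s, r F <= #|B :&: F|]%N && [exists B in s, r F < #|B :&: F|]%N.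
Definition trace F s : {set {set 'I_n}} := [set B in s | #|B :&: F| == r F].
Definition dbl s := [exists F in R, cut F s && (s :&: cutQ \subset trace F s)].
Local Notation Q := cutQ.

Lemma cutP F s : reflect ((exists2 B, B \in s & (#|B :&: F| < r F)%N) /\
  (exists2 B, B \in s & (r F < #|B :&: F|)%N)) (cut F s).
Proof. by apply: (iffP andP) => -[/exists_inP h1 /exists_inP h2]; split. Qed.

Lemma cutS F s t : s \subset t -> cut F s -> cut F t.
Proof.
by move=> st /cutP[[B Bs h] [C Cs h']]; apply/cutP; split; [exists B | exists C] => //;
  apply: (subsetP st).
Qed.

Lemma traceP F s B : (B \in trace F s) = (B \in s) && (#|B :&: F| == r F).
Proof. by rewrite inE. Qed.

(** A swap changes [#|B :&: F|] by at most one, so moving towards a vertex on the other side cannot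
    jump over the hyperplane. *)
Lemma cut_trace_neq0 F s : s \in faces ind V -> cut F s -> exists B, B \in trace F s.
Proof.
move=> sF /cutP[[B1 B1s h1] [B2 B2s h2]]; have sV := faces_sub sF.
pose P B := (B \in s) && (r F <= #|B :&: F|)%N.
have PB2 : P B2 by rewrite /P B2s ltnW.
case: (@arg_minnP _ B2 P (fun B => #|B :&: F|) PB2) => B /andP[Bs Bge] Bmin.
exists B; rewrite traceP Bs eqn_leq Bge andbT leqNgt; apply/negP => Blt.
have Bk := ksetsP _ _ (subsetP sV B Bs); have B1k := ksetsP _ _ (subsetP sV B1 B1s).
have /subsetPn[x] : ~~ (B :&: F \subset B1 :&: F).
  by apply/negP => /subset_leq_card; clear -h1 Blt; lia.
rewrite !inE => /andP[xB xF]; rewrite xF andbT => xB1.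
have /subsetPn[y] : ~~ (B1 :\: F \subset B :\: F).
  apply/negP => /subset_leq_card; have := cardsID F B; have := cardsID F B1.
  by rewrite Bk B1k; clear -h1 Blt; lia.
rewrite !inE => /andP[yF yB1]; rewrite yF /= => yB.
have sw := face_swap sF Bs B1s xB xB1 yB1 yB.
have := card_swapI F xB yB; rewrite xF (negbTE yF) addn1 addn0 => E.
have PW : P (swap B x y).
  by rewrite /P sw /= -ltnS E.
by have := Bmin _ PW; rewrite -E ltnn.
Qed.

(** The trace is a product of two hypersimplices, on the free coordinates inside and outside [F].
    The witnesses, found by comparing [B0] with vertices on both sides, show that neither factor is
    a point. *)
Lemma cut_blocks F s B0 : s \in faces ind V -> cut F s -> B0 \in trace F s ->
  exists u1 v1 u2 v2, [/\ u1 \in freeset s :&: F :&: B0, v1 \in freeset s :&: F :\: B0,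
    u2 \in (freeset s :\: F) :&: B0 & v2 \in freeset s :\: F :\: B0].
Proof.
move=> sF /cutP[[B1 B1s h1] [B2 B2s h2]]; rewrite traceP => /andP[B0s /eqP B0F].
have sV := faces_sub sF.
have Bk := ksetsP _ _ (subsetP sV _ B0s); have B1k := ksetsP _ _ (subsetP sV _ B1s).
have B2k := ksetsP _ _ (subsetP sV _ B2s).
have c0 := cardsID F B0; have c1 := cardsID F B1; have c2 := cardsID F B2.
rewrite Bk in c0; rewrite B1k in c1; rewrite B2k in c2.
have /subsetPn[u1] : ~~ (B0 :&: F \subset B1 :&: F).
  by apply/negP => /subset_leq_card; clear -h1 B0F; lia.
have /subsetPn[v1] : ~~ (B2 :&: F \subset B0 :&: F).
  by apply/negP => /subset_leq_card; clear -h2 B0F; lia.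
have /subsetPn[u2] : ~~ (B0 :\: F \subset B2 :\: F).
  by apply/negP => /subset_leq_card; clear -h2 B0F c0 c2; lia.
have /subsetPn[v2] : ~~ (B1 :\: F \subset B0 :\: F).
  by apply/negP => /subset_leq_card; clear -h1 B0F c0 c1; lia.
have nand1 (a b : bool) : a -> ~~ (a && b) -> ~~ b by case: a.
have nand2 (a b : bool) : b -> ~~ (a && b) -> ~~ a by case: a; case: b.
rewrite !inE => /andP[v2F v2B1] /(nand1 _ _ v2F) v2B0.
move=> /andP[u2F u2B0] /(nand1 _ _ u2F) u2B2.
move=> /andP[v1B2 v1F] /(nand2 _ _ v1F) v1B0.
move=> /andP[u1B0 u1F] /(nand2 _ _ u1F) u1B1.
have nc B C x : B \in s -> C \in s -> x \in B -> x \notin C -> x \in freeset s.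
  move=> Bs Cs xB xC; rewrite in_setD (subsetP (supp_sub Bs)) // andbT.
  by apply: contra xC; apply: (subsetP (core_sub Cs)).
exists u1, v1, u2, v2; split.
- by rewrite !in_setI (nc _ _ _ B0s B1s u1B0 u1B1) u1F u1B0.
- by rewrite in_setD in_setI (nc _ _ _ B2s B0s v1B2 v1B0) v1B0 v1F.
- by rewrite in_setI in_setD (nc _ _ _ B0s B2s u2B0 u2B2) u2B0 u2F.
- by rewrite in_setD in_setD (nc _ _ _ B1s B0s v2B1 v2B0) v2B0 v2F.
Qed.

Lemma swap_trace F s B0 x y : s \in faces ind V -> B0 \in trace F s ->
  x \in freeset s -> y \in freeset s -> (x \in F) = (y \in F) -> x \in B0 -> y \notin B0 ->
  swap B0 x y \in trace F s.
Proof.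
move=> sF; rewrite !traceP => /andP[B0s /eqP B0F] xs ys xyF xB yB.
apply/andP; split; first by apply: (swap_face sF) => //; rewrite inE ?xs ?yB.
by have := card_swapI F xB yB; rewrite xyF B0F => /addIn ->.
Qed.

(** Swaps within the two blocks can insert and remove every free coordinate, so the trace has the
    same core and support as [s]. *)
Lemma hull_trace F s : s \in faces ind V -> cut F s -> hull k (trace F s) = s.
Proof.
move=> sF cs; have [B0 B0t] := cut_trace_neq0 sF cs.
have [u1 [v1 [u2 [v2 [hu1 hv1 hu2 hv2]]]]] := cut_blocks sF cs B0t.
rewrite -[RHS](face_hull sF) /hull.
have tS : trace F s \subset s by apply/subsetP => B; rewrite traceP => /andP[].
have sub B : B \in s -> B \subset supp s by apply: supp_sub.
have B0s := subsetP tS _ B0t.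
case/setIP: hu1 => /setIP[u1S u1F] u1B; case/setDP: hv1 => /setIP[v1S v1F] v1B.
case/setIP: hu2 => /setDP[u2S u2F] u2B; case/setDP: hv2 => /setDP[v2S v2F] v2B.
congr (kitv k _ _); apply/eqP; rewrite eqEsubset; apply/andP; split.
- apply/subsetP => z zc; apply: contraT => zs.
  have zB0 := subsetP (core_sub B0t) z zc.
  have zS : z \in freeset s by rewrite inE zs (subsetP (sub _ B0s)).
  have fin y : y \in freeset s -> (z \in F) = (y \in F) -> y \notin B0 -> False.
    move=> yS zy yB; have := subsetP (core_sub (swap_trace sF B0t zS yS zy zB0 yB)) z zc.
    by rewrite !inE eqxx orbF => /eqP zyE; rewrite -zyE zB0 in yB.
  have [zF|zF] := boolP (z \in F); first by case: (fin v1); rewrite // zF v1F.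
  by case: (fin v2); rewrite // (negbTE zF) (negbTE v2F).
- exact: coreS.
- exact: suppS.
- apply/subsetP => z zs; have [zB0|zB0] := boolP (z \in B0); first exact: (subsetP (supp_sub B0t)).
  have zS : z \in freeset s.
    by rewrite inE zs andbT; apply: contra zB0; apply: (subsetP (core_sub B0s)).
  have fin y : y \in freeset s -> (y \in F) = (z \in F) -> y \in B0 -> z \in supp (trace F s).
    move=> yS zy yB; have := swap_trace sF B0t yS zS zy yB zB0.
    by move/supp_sub/subsetP; apply; rewrite !inE eqxx.
  have [zF|zF] := boolP (z \in F); first by apply: (fin u1); rewrite // zF u1F.
  by apply: (fin u2); rewrite // (negbTE zF) (negbTE u2F).
Qed.

(** The two blocks make [block_dim] lose one dimension at most, and a vertex off the hyperplane
    shows that one is lost. *)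
Lemma fdim_trace F s : s \in faces ind V -> cut F s -> fdim ind s = (fdim ind (trace F s)).+1.
Proof.
move=> sF cs; have [B0 B0t] := cut_trace_neq0 sF cs.
have [u1 [v1 [u2 [v2 [hu1 hv1 hu2 hv2]]]]] := cut_blocks sF cs B0t.
have x0S : u1 \in freeset s by case/setIP: hu1 => /setIP[].
apply/eqP; rewrite eqn_leq; apply/andP; split.
  rewrite -ltnS (fdim_face sF x0S).
  have := block_dim B0t hu1 hv1 hu2 hv2; rewrite setID; apply.
    move=> y z /setIP[/setIP[yS yF] yB] /setDP[/setIP[zS zF] zB].
    by apply: swap_trace => //; rewrite yF zF.
  move=> y z /setIP[/setDP[yS yF] yB] /setDP[/setDP[zS zF] zB].
  by apply: swap_trace => //; rewrite (negbTE yF) (negbTE zF).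
case/cutP: cs => [[B1 B1s h1] _].
have dE B : dotv (ind F) (ind B) = #|B :&: F|%:R.
  rewrite dotv_indic -sum1_card natr_sum [LHS]big_mkcond [RHS]big_mkcond /=.
  by apply: eq_bigr => i _; rewrite mxE inE; case: (i \in B); case: (i \in F).
apply: (@fdim_lt _ _ _ _ _ (ind F) ((r F)%:R) B1) => //.
- by apply/set0Pn; exists B0.
- by apply/subsetP => B; rewrite traceP => /andP[].
- by move=> B; rewrite traceP dE => /andP[_ /eqP ->].
- by rewrite dE eqr_nat neq_ltn h1.
Qed.

Lemma cutQP B : reflect (#|B| = k /\ {in R, forall F, #|B :&: F| <= r F}%N) (B \in Q).
Proof.
rewrite !inE; apply: (iffP andP) => -[/eqP Bk H]; split=> //; last by apply/forall_inP.
exact: forall_inP.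
Qed.

Lemma cutQ_sub : Q \subset V.
Proof. by apply/subsetP => B /cutQP[Bk _]; apply/ksetsP. Qed.

Hypothesis pairR : {in R &, forall F G, F != G -> #|F :&: G| + k <= r F + r G}%N.

(** Counting [B] on union and intersection gives [#|B :&: F| + #|B :&: G| <= k + #|F :&: G|], which
    leaves no slack in any of the inequalities. *)
Lemma tight_pair B F G : #|B| = k -> F \in R -> G \in R -> F != G ->
  (r F <= #|B :&: F|)%N -> (r G <= #|B :&: G|)%N ->
  [/\ #|B :&: F| = r F, #|B :&: G| = r G, (#|F :&: G| + k = r F + r G)%N,
      F :&: G \subset B & B \subset F :|: G].
Proof.
move=> Bk FR GR FG hF hG; have hp := pairR FR GR FG.
have E := cardsUI (B :&: F) (B :&: G); rewrite -setIUr -setIIr in E.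
have h1 : (#|B :&: (F :|: G)| <= #|B|)%N by rewrite subset_leq_card ?subsetIl.
have h2 : (#|B :&: (F :&: G)| <= #|F :&: G|)%N by rewrite subset_leq_card ?subsetIr.
rewrite Bk in h1.
split.
- by clear -E h1 h2 hp hF hG; lia.
- by clear -E h1 h2 hp hF hG; lia.
- by clear -E h1 h2 hp hF hG; lia.
- apply/setIidPr/eqP; rewrite eqEcard subsetIr.
  by clear -E h1 h2 hp hF hG; lia.
- apply/setIidPl/eqP; rewrite eqEcard subsetIl Bk.
  by clear -E h1 h2 hp hF hG; lia.
Qed.

Lemma trace_sub_Q F s : F \in R -> s \subset V -> trace F s \subset Q.
Proof.
move=> FR sV; apply/subsetP => B; rewrite traceP => /andP[Bs /eqP BF].
have Bk := ksetsP _ _ (subsetP sV B Bs); apply/cutQP; split=> // G GR.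
have [<-|FG] := eqVneq F G; first by rewrite BF.
rewrite leqNgt; apply/negP => h.
have [_ E _ _ _] := tight_pair Bk FR GR FG (eq_leq (esym BF)) (ltnW h).
by rewrite E ltnn in h.
Qed.

Lemma cut_not_out F G s : F \in R -> G \in R -> s \subset V -> cut F s -> ~~ out G s.
Proof.
move=> FR GR sV /cutP[[B1 B1s h1] [B2 B2s h2]]; apply/negP => /andP[/forall_inP H _].
have [FG|FG] := eqVneq F G; first by have := H B1 B1s; rewrite -FG leqNgt h1.
have [E _ _ _ _] := tight_pair (ksetsP _ _ (subsetP sV _ B2s)) FR GR FG (ltnW h2) (H _ B2s).
by rewrite E ltnn in h2.
Qed.

Lemma out_uniq F G s : F \in R -> G \in R -> s \subset V -> out F s -> out G s -> F = G.
Proof.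
move=> FR GR sV /andP[_ /exists_inP[B Bs h]] /andP[/forall_inP H _]; apply/eqP.
apply: contraT => FG.
have [E _ _ _ _] := tight_pair (ksetsP _ _ (subsetP sV _ Bs)) FR GR FG (ltnW h) (H _ Bs).
by rewrite E ltnn in h.
Qed.

(* A face [s] cut by [F] with [s] and [Q] meeting only in the hyperplane of [F]
   lies in the face of [V] where the hyperplanes of [F] and [G] coincide and
   their sides are interchanged. *)
Lemma dbl_partner F s : F \in R -> s \in faces ind V -> cut F s -> s :&: Q \subset trace F s ->
  exists G, [/\ G \in R, G != F, (#|F :&: G| + k = r F + r G)%N &
    {in s, forall B, F :&: G \subset B /\ B \subset F :|: G}].
Proof.
move=> FR sF cs sQ; have [B0 B0t] := cut_trace_neq0 sF cs; have sV := faces_sub sF.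
have [u1 [v1 [u2 [v2 [hu1 hv1 hu2 hv2]]]]] := cut_blocks sF cs B0t.
move: (B0t); rewrite traceP => /andP[B0s /eqP B0F].
have B0k := ksetsP _ _ (subsetP sV _ B0s).
have B0Q := subsetP (trace_sub_Q FR sV) _ B0t; case/cutQP: (B0Q) => _ B0R.
(* The exchange moves from the hyperplane to the allowed side of [F], so it has to leave [Q]: some
   other [G] forbids it, is tight at [B0], contains [y] and not [x]. *)
have key x y : x \in freeset s :&: F -> x \in B0 -> y \in freeset s :\: F -> y \notin B0 ->
    exists G, [/\ G \in R, G != F, #|B0 :&: G| = r G, x \notin G & y \in G].
  move=> /setIP[xS xF] xB /setDP[yS yF] yB.
  have swk : swap B0 x y \in s by apply: (swap_face sF) => //; rewrite inE ?xS ?yB.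
  have E := card_swapI F xB yB; rewrite xF (negbTE yF) B0F addn1 addn0 in E.
  have : swap B0 x y \notin Q.
    apply/negP => swQ; have := subsetP sQ (swap B0 x y); rewrite inE swk swQ => /(_ isT).
    by rewrite traceP => /andP[_ /eqP E']; rewrite E' in E; clear -E; lia.
  rewrite inE (subsetP sV _ swk) /= negb_forall => /existsP[G]; rewrite negb_imply -ltnNge.
  case/andP => GR hG; exists G; have EG := card_swapI G xB yB; have hG0 := B0R G GR.
  have GF : G != F by apply: contraTneq hG => ->; rewrite -leqNgt -E leqnSn.
  have hsw : (#|B0 :&: G| < #|swap B0 x y :&: G|)%N by apply: leq_ltn_trans hG0 hG.
  have [xG yG] : x \notin G /\ y \in G.
    move: EG hsw; case: (x \in G); case: (y \in G); rewrite ?addn1 ?addn0 //.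
    - by move=> [->]; rewrite ltnn.
    - by move=> <-; rewrite ltnNge ltnW.
    - by move=> ->; rewrite ltnn.
  split=> //; apply/eqP; rewrite eqn_leq hG0 /= -ltnS.
  by move: EG; rewrite (negbTE xG) yG addn0 addn1 => <-.
have xF0 : u1 \in freeset s :&: F by case/setIP: hu1.
have xB0 : u1 \in B0 by case/setIP: hu1.
have yF0 : v2 \in freeset s :\: F by case/setDP: hv2.
have yB0 : v2 \notin B0 by case/setDP: hv2.
have [G [GR GF B0G xG yG]] := key _ _ xF0 xB0 yF0 yB0.
have FG : F != G by rewrite eq_sym.
have [_ _ mod FGB BFG] := tight_pair B0k FR GR FG (eq_leq (esym B0F)) (eq_leq (esym B0G)).
(* The same [G] forbids all exchanges: two distinct sets tight at [B0] have their intersection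
   inside [B0] and their union around it. *)
have SF z : z \in freeset s -> z \in F -> z \notin G.
  move=> zS zF; have [zB|zB] := boolP (z \in B0); last first.
    by apply: contra zB => zG; apply: (subsetP FGB); rewrite inE zF.
  have [|G' [G'R G'F B0G' zG' yG']] := key z _ _ zB yF0 yB0; first by rewrite inE zS.
  have [<-//|GG'] := eqVneq G' G.
  have [_ _ _ h _] := tight_pair B0k G'R GR GG' (eq_leq (esym B0G')) (eq_leq (esym B0G)).
  by case/negP: yB0; apply: (subsetP h); rewrite inE yG'.
have SG z : z \in freeset s -> z \notin F -> z \in G.
  move=> zS zF; have [zB|zB] := boolP (z \in B0).
    by have := subsetP BFG z zB; rewrite inE (negbTE zF).
  have [|G' [G'R G'F B0G' xG' zG']] := key _ z xF0 xB0 _ zB; first by rewrite inE zF.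
  have [<-//|GG'] := eqVneq G' G.
  have [_ _ _ _ h] := tight_pair B0k G'R GR GG' (eq_leq (esym B0G')) (eq_leq (esym B0G)).
  by have := subsetP h _ xB0; rewrite inE (negbTE xG') (negbTE xG).
exists G; split=> // B Bs; split; apply/subsetP => z.
  move=> zFG; have zB0 := subsetP FGB z zFG; move: zFG; rewrite inE => /andP[zF zG].
  have [zS|] := boolP (z \in freeset s); first by have := SF z zS zF; rewrite zG.
  rewrite inE (subsetP (supp_sub B0s) z zB0) andbT negbK; exact: (subsetP (core_sub Bs)).
move=> zB; have [zS|] := boolP (z \in freeset s).
  by rewrite inE; case: (boolP (z \in F)) => //= zF; apply: SG.
rewrite inE (subsetP (supp_sub Bs) z zB) andbT negbK => zc.
exact: (subsetP BFG _ (subsetP (core_sub B0s) z zc)).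
Qed.

Lemma pair_sum B F G : #|B| = k -> F :&: G \subset B -> B \subset F :|: G ->
  (#|B :&: F| + #|B :&: G| = #|F :&: G| + k)%N.
Proof.
move=> Bk h1 h2; rewrite -cardsUI -setIUr -setIIr (setIidPl h2) (setIidPr h1) Bk.
by rewrite addnC.
Qed.

(** On such a face the two intersection numbers add up to [r F + r G], so within [Q] both
    inequalities are equalities. *)
Lemma pair_dbl F G s : F \in R -> G \in R -> s \in faces ind V -> cut F s ->
  (#|F :&: G| + k = r F + r G)%N ->
  {in s, forall B, F :&: G \subset B /\ B \subset F :|: G} -> s :&: Q \subset trace F s.
Proof.
move=> FR GR sF cs mod H; have sV := faces_sub sF.
apply/subsetP => B; rewrite inE => /andP[Bs /cutQP[Bk BR]]; rewrite traceP Bs.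
have [h1 h2] := H B Bs; have E := pair_sum Bk h1 h2; rewrite mod in E.
have hF := BR F FR; have hG := BR G GR.
by clear -E hF hG; apply/eqP; lia.
Qed.

End Cuts.

(** * Faces of the cut polytope *)

Section CutFaces.
Variables (n k : nat) (R : {set {set 'I_n}}) (r : {set 'I_n} -> nat).
Implicit Types (A B C Z F G : {set 'I_n}) (W Y s t : {set {set 'I_n}}) (x y z : 'I_n).
Local Notation ind := (@indic n).
Local Notation V := (ksets n k).
Local Notation Q := (cutQ k R r).
Local Notation cut := (@cut n r).
Local Notation out := (@out n r).
Local Notation trace := (@trace n r).
Local Notation dbl := (@dbl n k R r).

Hypothesis pairR : {in R &, forall F G, F != G -> #|F :&: G| + k <= r F + r G}%N.
Hypothesis V0 : V != set0.
Hypothesis cutV : {in R, forall F, cut F V}.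

Lemma dotv_indicI F B : dotv (ind F) (ind B) = #|B :&: F|%:R.
Proof.
rewrite dotv_indic -sum1_card natr_sum [LHS]big_mkcond [RHS]big_mkcond /=.
by apply: eq_bigr => i _; rewrite mxE inE; case: (i \in B); case: (i \in F).
Qed.

Lemma Q0 : Q != set0.
Proof.
have [R0|[F FR]] := set_0Vmem R.
  case/set0Pn: V0 => B BV; apply/set0Pn; exists B; rewrite inE BV.
  by apply/forall_inP => F; rewrite R0 inE.
have [B Bt] := cut_trace_neq0 (faces_refl ind V) (cutV FR).
by apply/set0Pn; exists B; apply: (subsetP (trace_sub_Q pairR FR (subxx _))) Bt.
Qed.

Lemma faceI_Q s : s \in faces ind V -> s :&: Q != set0 -> s :&: Q \in faces ind Q.
Proof.
case/facesP => c -> h0; have [M HM] := argmP ind c V0; apply/facesP; exists c; apply/esym.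
apply: (@argm_eq _ _ _ _ _ M) => //; first exact: subsetIr.
move=> B BQ; have BV := subsetP (cutQ_sub k R r) B BQ.
by rewrite inE BQ andbT; apply: HM.
Qed.

Lemma trace_faceQ F s : F \in R -> s \in faces ind V -> cut F s -> trace F s \in faces ind Q.
Proof.
move=> FR sF cs; have [B0 B0t] := cut_trace_neq0 sF cs.
have tQ := trace_sub_Q pairR FR (faces_sub sF).
have ts : trace F s \subset s by apply/subsetP => B; rewrite traceP => /andP[].
have h0 : s :&: Q != set0.
  by apply/set0Pn; exists B0; rewrite inE (subsetP ts) // (subsetP tQ).
apply: (faces_trans Q0 (faceI_Q sF h0)); apply/facesP; exists (ind F); apply/esym.
apply: (@argm_eq _ _ _ _ _ ((r F)%:R)); first by apply/set0Pn; exists B0.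
  by rewrite subsetI ts tQ.
move=> B; rewrite inE => /andP[Bs /cutQP[Bk BR]].
by rewrite traceP Bs dotv_indicI ler_nat eqr_nat BR.
Qed.

Lemma out_trace_face F s : s \in faces ind V ->
  {in s, forall B, r F <= #|B :&: F|}%N -> trace F s != set0 -> trace F s \in faces ind V.
Proof.
move=> sF H h0; apply: (faces_trans V0 sF); apply/facesP; exists (- ind F); apply/esym.
apply: (@argm_eq _ _ _ _ _ (- (r F)%:R)) => //.
  by apply/subsetP => B; rewrite traceP => /andP[].
move=> B Bs; rewrite -scaleN1r dotvZl mulN1r dotv_indicI traceP Bs.
by rewrite lerN2 ler_nat eqr_opp eqr_nat H.
Qed.

Lemma sub_Q_not_out F s : F \in R -> s \subset Q -> ~~ out F s.
Proof.
move=> FR sQ; apply/negP => /andP[_ /exists_inP[B Bs]].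
by have /cutQP[_ /(_ F FR)] := subsetP sQ B Bs; rewrite leqNgt => /negP.
Qed.
Lemma sub_Q_not_cut F s : F \in R -> s \subset Q -> ~~ cut F s.
Proof.
move=> FR sQ; apply/negP => /andP[_ /exists_inP[B Bs]].
by have /cutQP[_ /(_ F FR)] := subsetP sQ B Bs; rewrite leqNgt => /negP.
Qed.
Lemma sub_Q_not_dbl s : s \subset Q -> ~~ dbl s.
Proof.
by move=> sQ; apply/negP => /exists_inP[F FR /andP[cs _]]; have := sub_Q_not_cut FR sQ; rewrite cs.
Qed.

(** For a plain face, [s :&: Q] has the dimension of [s] and determines it ([plainQ]). *)
Definition plain s := ~~ dbl s && [forall F in R, ~~ out F s].

Lemma sub_Q_plain s : s \subset Q -> plain s.
Proof.
by move=> sQ; rewrite /plain sub_Q_not_dbl //; apply/forall_inP => F FR; apply: sub_Q_not_out.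
Qed.

(** The two sources of faces of [Q]: inherited from [V], or created in a cutting hyperplane. *)
Definition faceQ_spec Y :=
  (exists s, [/\ s \in faces ind V, plain s & Y = s :&: Q]) \/
  (exists F s, [/\ F \in R, s \in faces ind V, cut F s & Y = trace F s]).

(** If [s] is out, only its trace remains, which is a plain face of [V] inside [Q]; if [s] is
    doubled, its intersection with [Q] is a trace by definition. *)
Lemma facesI_spec s : s \in faces ind V -> s :&: Q != set0 -> faceQ_spec (s :&: Q).
Proof.
move=> sF h0.
have [/exists_inP[F FR oF]|no] := boolP [exists F in R, out F s].
  have [/forall_inP oF1 _] := andP oF.
  have E : s :&: Q = trace F s.
    apply/setP => B; rewrite traceP inE; apply/andP/andP => -[Bs].
      by case/cutQP => _ /(_ F FR) h; rewrite Bs eqn_leq h oF1.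
    move=> h; split=> //; apply: (subsetP (trace_sub_Q pairR FR (faces_sub sF))).
    by rewrite traceP Bs.
  have tQ := trace_sub_Q pairR FR (faces_sub sF).
  left; exists (trace F s); split; first by apply: out_trace_face => //; rewrite -E.
    exact: sub_Q_plain.
  by rewrite E; apply/esym/setIidPl.
have [/exists_inP[F FR /andP[cs h]]|nd] := boolP (dbl s).
  right; exists F, s; split=> //; apply/eqP; rewrite eqEsubset h subsetI.
  rewrite (trace_sub_Q pairR FR (faces_sub sF)) andbT.
  by apply/subsetP => B; rewrite traceP => /andP[].
left; exists s; split=> //; rewrite /plain nd; apply/forall_inP => F FR.
by apply: contra no => oF; apply/exists_inP; exists F.
Qed.

(* Lagrange multipliers: if no maximiser of [c] on [V] lies in [Q] then all of
   them are beyond one hyperplane [F], and for the right [l > 0] the maximisers of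
   [c - l F] on [V] lie on both sides of it. *)
Lemma lagrange c F : (exists B, (B \in V) && (#|B :&: F| <= r F)%N) ->
  {in argm ind V c, forall B, r F < #|B :&: F|}%N ->
  exists2 l, 0 < l & let Y := argm ind V (c - l *: ind F) in
    (exists2 B, B \in Y & #|B :&: F| <= r F)%N /\ (exists2 B, B \in Y & r F < #|B :&: F|)%N.
Proof.
case=> B1 B1L H; have /set0Pn[B0 B0Y] := argm_neq0 ind c V0.
pose w B := dotv c (ind B); pose phi B : rat := #|B :&: F|%:R.
pose U B := (B \in V) && (r F < #|B :&: F|)%N.
pose L B := (B \in V) && (#|B :&: F| <= r F)%N.
have B0U : U B0 by rewrite /U (subsetP (argm_sub _ _ _) _ B0Y) H.
(* The slope of [c] between a vertex [B'] on the allowed side and [B] beyond. The multiplier is the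
   minimum over [B'] of the maximal slope, at which the two sides balance. *)
pose rho B' B := (w B - w B') / (phi B - phi B').
pose Bm B' := [arg max_(B > B0 | U B) rho B' B]%O.
have BmP B' : U (Bm B') /\ (forall B, U B -> rho B' B <= rho B' (Bm B')).
  by rewrite /Bm; case: arg_maxP => // B UB HB; split.
pose Bs := [arg min_(B' < B1 | L B') rho B' (Bm B')]%O.
have [BsL BsP] : L Bs /\ (forall B', L B' -> rho Bs (Bm Bs) <= rho B' (Bm B')).
  by rewrite /Bs; case: arg_minP => // B LB HB; split.
set l := rho Bs (Bm Bs) in BsP.
have den B' B : L B' -> U B -> 0 < phi B - phi B'.
  move=> /andP[_ h1] /andP[_ h2]; rewrite subr_gt0 ltr_nat.
  exact: leq_ltn_trans h1 h2.
have l0 : 0 < l.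
  apply: lt_le_trans ((BmP Bs).2 B0 B0U); apply: divr_gt0; last exact: den.
  have [M HM] := argmP ind c V0; have BsV : Bs \in V by case/andP: BsL.
  have B0V : B0 \in V by case/andP: B0U.
  have /eqP E0 : w B0 == M by rewrite (HM _ B0V).2.
  rewrite subr_gt0 E0 lt_neqAle (HM _ BsV).1 (HM _ BsV).2 andbT.
  by apply/negP => /H; case/andP: BsL => _; rewrite leqNgt => /negP.
pose v B := w B - l * phi B.
have vE B : dotv (c - l *: ind F) (ind B) = v B by rewrite dotvBl dotvZl dotv_indicI.
have leU B : U B -> v B <= v Bs.
  move=> UB; have := (BmP Bs).2 B UB; rewrite -/l ler_pdivrMr ?den // /v mulrBr => h; lra.
have leL B : L B -> v B <= v Bs.
  move=> LB; apply: le_trans (leU _ (BmP B).1); have := BsP B LB.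
  rewrite ler_pdivlMr ?den ?(BmP B).1 // /v mulrBr => h; lra.
have eqM : v (Bm Bs) = v Bs.
  have d0 := den _ _ BsL (BmP Bs).1.
  have : l * (phi (Bm Bs) - phi Bs) = w (Bm Bs) - w Bs by rewrite divfK ?gt_eqF.
  by rewrite /v mulrBr => h; lra.
have leV B : B \in V -> v B <= v Bs.
  by move=> BV; case: (leqP #|B :&: F| (r F)) => h; [apply: leL | apply: leU]; apply/andP.
exists l => //=; split.
  exists Bs; last by case/andP: BsL.
  rewrite inE; case/andP: BsL => -> _; apply/forall_inP => B BV.
  by rewrite !vE leV.
exists (Bm Bs); last by case/andP: (BmP Bs).1.
rewrite inE; case/andP: (BmP Bs).1 => -> _; apply/forall_inP => B BV.
by rewrite !vE eqM leV.
Qed.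

Lemma faceQP Y : Y \in faces ind Q -> faceQ_spec Y.
Proof.
case/facesP => c ->; have [M HM] := argmP ind c V0.
set s := argm ind V c in HM; have sF : s \in faces ind V by apply/facesP; exists c.
have [sQ0|sQ0] := eqVneq (s :&: Q) set0; last first.
  have -> : argm ind Q c = s :&: Q.
    apply: (@argm_eq _ _ _ _ _ M) => //; first exact: subsetIr.
    move=> B BQ; have BV := subsetP (cutQ_sub k R r) B BQ.
    by rewrite inE BQ andbT; apply: HM.
  exact: facesI_spec.
have nQ B : B \in s -> B \notin Q.
  by move=> Bs; apply/negP => BQ; have := in_set0 B; rewrite -sQ0 inE Bs BQ.
have /set0Pn[B0 B0s] := argm_neq0 ind c V0.
have [F FR hB0] : exists2 F, F \in R & (r F < #|B0 :&: F|)%N.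
  have := nQ _ B0s; rewrite inE (subsetP (argm_sub _ _ _) _ B0s) /= negb_forall.
  by case/existsP => F; rewrite negb_imply -ltnNge => /andP[FR h]; exists F.
(* A vertex of [s] on or before the hyperplane would make the trace of [s] nonempty, and this trace
   lies in [Q]. *)
have sF1 : {in s, forall B, r F < #|B :&: F|}%N.
  move=> B Bs; rewrite ltnNge leq_eqVlt; apply/negP => /orP[h|h].
    have := subsetP (trace_sub_Q pairR FR (faces_sub sF)) B; rewrite traceP Bs h => /(_ isT).
    by apply/negP; apply: nQ.
  have cs : cut F s by apply/cutP; split; [exists B | exists B0].
  have [C Ct] := cut_trace_neq0 sF cs; have := subsetP (trace_sub_Q pairR FR (faces_sub sF)) C Ct.
  by apply/negP; apply: nQ; move: Ct; rewrite traceP => /andP[].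
have [|l l0 [[B1 B1Y h1] [B2 B2Y h2]]] := lagrange _ sF1.
  have /cutP[[B BV h] _] := cutV FR; exists B; rewrite BV; exact: ltnW.
set Y' := argm _ _ _ in B1Y B2Y; have Y'F : Y' \in faces ind V by apply/facesP; eexists.
have [M' HM'] := argmP ind (c - l *: ind F) V0; rewrite -/Y' in HM'.
have tQ := trace_sub_Q pairR FR (faces_sub Y'F).
have t0 : trace F Y' != set0.
  move: h1; rewrite leq_eqVlt => /orP[h|h].
    by apply/set0Pn; exists B1; rewrite traceP B1Y.
  have cY : cut F Y' by apply/cutP; split; [exists B1 | exists B2].
  by have [C Ct] := cut_trace_neq0 Y'F cY; apply/set0Pn; exists C.
(* On [Q] both [c - l F] and [l F] are bounded, and [c] reaches the sum of the bounds exactly where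
   both are attained. *)
have -> : argm ind Q c = trace F Y'.
  apply: (@argm_eq _ _ _ _ _ (M' + l * (r F)%:R)) => // B BQ.
  have /cutQP[Bk BR] := BQ; have [hle heq] := HM' B (subsetP (cutQ_sub k R r) B BQ).
  have E : dotv c (ind B) = dotv (c - l *: ind F) (ind B) + l * #|B :&: F|%:R.
    by rewrite dotvBl dotvZl dotv_indicI subrK.
  have hl : l * #|B :&: F|%:R <= l * (r F)%:R by rewrite ler_pM2l // ler_nat BR.
  rewrite E traceP -heq; split; first by rewrite lerD.
  apply/eqP/andP => [E2|[/eqP -> /eqP ->] //].
  have e1 : dotv (c - l *: ind F) (ind B) = M' by lra.
  have e2 : l * #|B :&: F|%:R = l * (r F)%:R by lra.
  split; first by rewrite e1.
  by move/(mulfI (lt0r_neq0 l0))/eqP: e2; rewrite eqr_nat.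
have [cY|ncY] := boolP (cut F Y'); first by right; exists F, Y'.
have ge : {in Y', forall B, r F <= #|B :&: F|}%N.
  move=> B BY; rewrite leqNgt; apply: contra ncY => h.
  by apply/cutP; split; [exists B | exists B2].
left; exists (trace F Y'); split; first exact: out_trace_face.
  exact: sub_Q_plain.
exact/esym/setIidPl.
Qed.

End CutFaces.

(** * Correspondence between the faces of Q and those of V *)

Section CutFlags.
Variables (n k : nat) (R : {set {set 'I_n}}) (r : {set 'I_n} -> nat).
Implicit Types (A B C Z F G : {set 'I_n}) (W Y s t x y : {set {set 'I_n}}).
Local Notation ind := (@indic n).
Local Notation V := (ksets n k).
Local Notation Q := (cutQ k R r).
Local Notation cut := (@cut n r).
Local Notation out := (@out n r).
Local Notation trace := (@trace n r).
Local Notation dbl := (@dbl n k R r).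
Local Notation plain := (@plain n k R r).
Local Notation hull := (@hull n k).

Hypothesis pairR : {in R &, forall F G, F != G -> #|F :&: G| + k <= r F + r G}%N.
Hypothesis V0 : V != set0.
Hypothesis cutV : {in R, forall F, cut F V}.
Hypothesis ndV : ~~ dbl V.

Lemma trace_sub F s : trace F s \subset s.
Proof. by apply/subsetP => B; rewrite traceP => /andP[]. Qed.

(** The intersection numbers with [F] and [G] have constant sum, so beyond [F] means before [G]. A
    third cut would have a vertex beyond its hyperplane and thus strictly before both others,
    against that sum. *)
Lemma dbl_pair s : s \in faces ind V -> dbl s -> exists F G,
  [/\ F \in R, G \in R, F != G, (#|F :&: G| + k = r F + r G)%N &
    [/\ {in s, forall B, F :&: G \subset B /\ B \subset F :|: G},
        {in s, forall B, (#|B :&: F| + #|B :&: G| = r F + r G)%N},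
        (forall H, H \in R -> cut H s = (H \in [set F; G]))
      & s :&: Q = trace F s /\ s :&: Q = trace G s]].
Proof.
move=> sF /exists_inP[F FR /andP[cs sQ]]; have sV := faces_sub sF.
have [G [GR GF mod H]] := dbl_partner pairR FR sF cs sQ.
have FG : F != G by rewrite eq_sym.
have sumE : {in s, forall B, (#|B :&: F| + #|B :&: G| = r F + r G)%N}.
  move=> B Bs; have [h1 h2] := H B Bs; rewrite -mod; apply: pair_sum => //.
  exact: ksetsP _ _ (subsetP sV B Bs).
have cG : cut G s.
  case/cutP: (cs) => [[B1 B1s h1] [B2 B2s h2]]; apply/cutP; split.
    by exists B2 => //; have E := sumE _ B2s; clear -E h2; lia.
  by exists B1 => //; have E := sumE _ B1s; clear -E h1; lia.
exists F, G; split=> //; split=> //.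
  move=> H' H'R; rewrite !inE; apply/idP/orP => [cH'|[/eqP ->|/eqP ->]] //.
  have [_|H'F] := eqVneq H' F; first by left.
  have [_|H'G] := eqVneq H' G; first by right.
  case/cutP: cH' => [_ [B Bs h]]; have Bk := ksetsP _ _ (subsetP sV B Bs).
  have nle K : K \in R -> H' != K -> (#|B :&: K| < r K)%N.
    move=> KR H'K; rewrite ltnNge; apply/negP => hK.
    have [E _ _ _ _] := tight_pair pairR Bk H'R KR H'K (ltnW h) hK.
    by rewrite E ltnn in h.
  have E := sumE B Bs; have h1 := nle _ FR H'F; have h2 := nle _ GR H'G.
  by clear -E h1 h2; lia.
have E K : K \in R -> s :&: Q \subset trace K s -> s :&: Q = trace K s.
  move=> KR h; apply/eqP; rewrite eqEsubset h subsetI trace_sub.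
  exact: trace_sub_Q.
split; first exact: E.
apply: E => //; apply: (@pair_dbl _ _ _ _ G F) => //.
  by rewrite setIC mod addnC.
by move=> B Bs; have [h1 h2] := H B Bs; rewrite setIC setUC.
Qed.

Lemma dbl_trace F s : s \in faces ind V -> dbl s -> F \in R -> cut F s -> s :&: Q = trace F s.
Proof.
move=> sF ds FR cs; have [F1 [G1 [_ _ _ _ [_ _ cE [E1 E2]]]]] := dbl_pair sF ds.
by move: cs; rewrite cE // !inE => /orP[/eqP ->|/eqP ->].
Qed.

(** In a doubled face [t] the part in [Q] lies in the hyperplane of every member of [R] that cuts
    [t], and this passes to subfaces. *)
Lemma dblS F s t : s \in faces ind V -> t \in faces ind V -> F \in R -> cut F s ->
  s \subset t -> dbl t -> dbl s.
Proof.
move=> sF tF FR cs st dt; apply/exists_inP; exists F => //; rewrite cs /=.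
have ct : cut F t := cutS st cs.
apply/subsetP => B; rewrite inE => /andP[Bs BQ]; rewrite traceP Bs.
have : B \in t :&: Q by rewrite inE (subsetP st).
by rewrite (dbl_trace tF dt FR ct) traceP => /andP[].
Qed.

Lemma cut_up_out F G s t : F \in R -> G \in R -> t \in faces ind V -> cut F s ->
  s \subset t -> ~~ out G t.
Proof. by move=> FR GR tF cs st; apply: (cut_not_out pairR FR GR (faces_sub tF) (cutS st cs)). Qed.

Lemma plain_not_cut s : s \in faces ind V -> plain s -> {in R, forall F, ~~ cut F s} ->
  s \subset Q.
Proof.
move=> sF /andP[_ /forall_inP no] nc; apply/subsetP => B Bs; apply/cutQP; split.
  exact: ksetsP _ _ (subsetP (faces_sub sF) B Bs).
move=> F FR; rewrite leqNgt; apply/negP => h; case/negP: (no F FR).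
apply/andP; split; last by apply/exists_inP; exists B.
apply/forall_inP => C Cs; rewrite leqNgt; apply: contra (nc F FR) => h'.
by apply/cutP; split; [exists C | exists B].
Qed.

Lemma plain_dbl s t : s \in faces ind V -> t \in faces ind V -> t \subset s -> dbl s ->
  plain t -> t \subset Q.
Proof.
move=> sF tF ts ds pt; apply: plain_not_cut => // F FR; apply/negP => cF.
by case/andP: pt => /negP[]; apply: (dblS tF sF FR cF ts ds).
Qed.

Lemma hull_sub_face s W : s \in faces ind V -> W \subset s -> hull W \subset s.
Proof. by move=> sF Ws; rewrite -(face_hull sF); apply: hullS. Qed.

(** If nothing cuts [s], it lies in [Q]. Otherwise the trace has hull [s] and codimension one, and
    since [s] is not doubled, a vertex of [s :&: Q] off the hyperplane restores the dimension. *)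
Lemma plainQ s : s \in faces ind V -> plain s ->
  [/\ hull (s :&: Q) = s, fdim ind (s :&: Q) = fdim ind s & s :&: Q != set0].
Proof.
move=> sF ps; have [/existsP[F /andP[FR cs]]|nc] := boolP [exists F, (F \in R) && cut F s]; last first.
  suff /setIidPl -> : s \subset Q by rewrite face_hull // (faces_neq0 V0 sF).
  apply: plain_not_cut => // F FR; apply: contra nc => cF; apply/existsP; exists F.
  by rewrite FR.
have tQ : trace F s \subset s :&: Q by rewrite subsetI trace_sub trace_sub_Q ?(faces_sub sF).
have [B0 B0t] := cut_trace_neq0 sF cs.
split; last by apply/set0Pn; exists B0; apply: (subsetP tQ).
  apply/eqP; rewrite eqEsubset hull_sub_face ?subsetIl //=.
  by rewrite -{1}(hull_trace sF cs); apply: hullS.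
apply/eqP; rewrite eqn_leq fdimS ?subsetIl //= (fdim_trace sF cs).
have /subsetPn[B BsQ Bt] : ~~ (s :&: Q \subset trace F s).
  case/andP: ps => nd _; apply: contra nd => h; apply/exists_inP; exists F => //.
  by rewrite cs.
apply: (@fdim_lt _ _ _ _ _ (ind F) ((r F)%:R) B) => //; first by apply/set0Pn; exists B0.
  by move=> C; rewrite traceP dotv_indicI => /andP[_ /eqP ->].
rewrite dotv_indicI eqr_nat; apply: contra Bt => h; rewrite traceP h andbT.
by move: BsQ; rewrite inE => /andP[].
Qed.

Lemma plainV : plain V.
Proof.
rewrite /plain ndV; apply/forall_inP => F FR.
exact: (cut_up_out FR FR (faces_refl ind V) (cutV FR) (subxx _)).
Qed.

Lemma QE : V :&: Q = Q. Proof. by apply/setIidPr/cutQ_sub. Qed.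

Lemma hullQ : hull Q = V.
Proof. by rewrite -QE; case: (plainQ (faces_refl ind V) plainV). Qed.
Lemma fdimQ : fdim ind Q = fdim ind V.
Proof. by rewrite -{1}QE; case: (plainQ (faces_refl ind V) plainV). Qed.

(** A created face is represented by its own vertex set; the face of [V] it comes from is recovered
    as [hull x]. *)
Definition crossing F x := [&& hull x \in faces ind V, cut F (hull x) & x == trace F (hull x)].
Definition crossings : {set {set {set 'I_n}}} := [set x | [exists F in R, crossing F x]].
Definition plains := [set s in pfaces ind V | plain s].

Lemma crossing_trace F s : s \in faces ind V -> cut F s -> crossing F (trace F s).
Proof. by move=> sF cs; rewrite /crossing hull_trace // sF cs eqxx. Qed.

Lemma crossing_face F x : F \in R -> crossing F x -> x \in pfaces ind Q.
Proof.
move=> FR /and3P[hF cs /eqP xE]; rewrite in_setD1; apply/andP; split; last first.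
  by rewrite xE; apply: trace_faceQ.
apply: contra ndV => /eqP xQ; apply/exists_inP; exists F => //.
by rewrite xQ hullQ in cs xE; rewrite cs QE -xE subxx.
Qed.

Lemma plains_face s : s \in plains -> [/\ s \in faces ind V, s != V & plain s].
Proof. by rewrite inE in_setD1 => /andP[/andP[? ?] ?]. Qed.

Lemma plains_hull s : s \in plains -> hull (s :&: Q) = s.
Proof. by case/plains_face => sF _ /(plainQ sF)[]. Qed.

Lemma pfacesQ_crossing : crossings \subset pfaces ind Q.
Proof. by apply/subsetP => x; rewrite inE => /exists_inP[F FR]; apply: crossing_face. Qed.

Lemma pfacesQ_plain : pfaces ind Q :\: crossings = [set s :&: Q | s in plains].
Proof.
apply/setP => y; rewrite in_setD in_setD1; apply/idP/imsetP.
  case/and3P => yX yQ yF; case: (faceQP pairR V0 cutV yF) => [[s [sF ps E]]|[F [s [FR sF cs E]]]].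
    exists s => //; rewrite inE in_setD1 sF ps !andbT; apply: contra yQ => /eqP sV.
    by rewrite E sV QE.
  by case/negP: yX; rewrite inE; apply/exists_inP; exists F; rewrite // E crossing_trace.
case=> s sN ->; have [sF sV ps] := plains_face sN; have hs := plains_hull sN.
apply/and3P; split.
- rewrite inE; apply/negP => /exists_inP[F FR /and3P[]]; rewrite hs => _ cs /eqP E.
  case/andP: ps => /negP[]; apply/exists_inP; exists F => //.
  by rewrite cs E subxx.
- by apply: contra sV => /eqP E; rewrite -hs E hullQ.
- by apply: faceI_Q => //; case: (plainQ sF ps).
Qed.

End CutFlags.

Lemma psi_shift_imset (R0 : pzRingType) (b e : R0) (T1 : finType) (d : {set T1} -> nat)
    (h : {set T1} -> {set T1}) (P : {set {set T1}}) m D (lt := fun Y Z : {set T1} => Y \proper Z) :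
    {in P &, injective h} -> {in P &, forall x y, (h x \proper h y) = (x \proper y)} ->
    {in P, forall x, d x = d (h x)} ->
  psi b e lt d (h @: P) m D = psi b e lt d P m D.
Proof.
move=> h1 h2 h3; rewrite -(@psi_iso0 R0 b e _ _ lt lt d d h P) //.
- exact: proper_irr.
- exact: proper_irr.
Qed.

(** * Comparison of the flag indices of Q and V *)

Section CutIndex.
Variables (n k : nat) (R0 : pzRingType) (b e : R0).
Implicit Types (A B C Z F G : {set 'I_n}) (W Y s t x y : {set {set 'I_n}}).
Local Notation ind := (@indic n).
Local Notation V := (ksets n k).
Local Notation lt := (fun Y Z : {set {set 'I_n}} => Y \proper Z).
Local Notation iPsi := (Psi b e ind).
Local Notation P := (pfaces ind V).
Local Notation D := (fdim ind V).
Local Notation ipsi := (psi b e lt (fdim ind)).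
Local Notation hull := (@hull n k).

(* The flag index of the face figure of [s] in [V]. *)
Definition psi_up s := ipsi (above lt P s) (fdim ind s).+1 D.

Section OneCut.
Variables (R : {set {set 'I_n}}) (r : {set 'I_n} -> nat).
Local Notation Q := (cutQ k R r).
Local Notation cut := (@cut n r).
Local Notation dbl := (@dbl n k R r).
Local Notation N := (plains k R r).

Hypothesis pairR : {in R &, forall F G, F != G -> #|F :&: G| + k <= r F + r G}%N.
Hypothesis V0 : V != set0.
Hypothesis cutV : {in R, forall F, cut F V}.
Hypothesis ndV : ~~ dbl V.

Lemma plains_imset (M : {set {set {set 'I_n}}}) m m' : M \subset N ->
  ipsi [set s :&: Q | s in M] m m' = ipsi M m m'.
Proof.
move=> MN; have hN s : s \in M -> hull (s :&: Q) = s.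
  by move=> sM; apply: (plains_hull pairR V0); apply: (subsetP MN).
apply: psi_shift_imset.
- by move=> s t sM tM E; rewrite -(hN s sM) E hN.
- move=> s t sM tM; rewrite !properE; congr (_ && ~~ _).
    by apply/idP/idP => [/(@hullS n k)|]; [rewrite !hN | apply: setSI].
  by apply/idP/idP => [/(@hullS n k)|]; [rewrite !hN | apply: setSI].
- move=> s /(subsetP MN)/plains_face[sF _ ps].
  by case: (plainQ pairR V0 sF ps).
Qed.

(** Flags of [Q] are sorted by their largest crossing [x]. Below it everything is allowed, which
    gives the index of [x]; above it only inherited faces occur, corresponding to plain faces
    containing [hull x]. *)
Lemma Psi_crossings : iPsi Q = ipsi N 0 D +
  \sum_(x in crossings k R r) iPsi x * b *
     ipsi [set t in N | hull x \subset t] (fdim ind x).+1 D.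
Proof.
rewrite {1}/Psi (fdimQ pairR V0 cutV ndV).
rewrite (psi_split_top _ _ _ _ _ _ _ (pfacesQ_crossing pairR V0 cutV ndV)); first last.
- exact: proper_tr.
- exact: proper_irr.
rewrite (pfacesQ_plain pairR V0 cutV ndV) plains_imset ?subxx //; congr (_ + _).
apply: eq_bigr => x xX.
have xF : x \in faces ind Q.
  by have := subsetP (pfacesQ_crossing pairR V0 cutV ndV) x xX; rewrite in_setD1 => /andP[].
have Q0' : Q != set0 by apply: Q0 pairR V0 cutV.
rewrite /Psi (pfaces_faces Q0' xF); congr (_ * _ * _).
rewrite -plains_imset; last by apply/subsetP => t; rewrite inE => /andP[].
congr (psi _ _ _ _ _ _ _); apply/setP => y.
have xh : x \subset hull x.
  by apply: sub_hull; apply: subset_trans (faces_sub xF) (cutQ_sub k R r).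
rewrite inE; apply/andP/imsetP => [[/imsetP[t tN ->] xt]|[t]].
  exists t => //; rewrite inE tN /=; rewrite -(plains_hull pairR V0 tN).
  exact: hullS (proper_sub xt).
rewrite inE => /andP[tN ht] ->; split; first by apply: imset_f.
rewrite properEneq subsetI (subset_trans xh ht) (faces_sub xF) !andbT.
apply: contraTneq (imset_f (fun s => s :&: Q) tN) => <-.
by rewrite -(pfacesQ_plain pairR V0 cutV ndV) inE xX.
Qed.

Lemma plains_sub : N \subset P.
Proof. by apply/subsetP => s; rewrite inE => /andP[]. Qed.

(** Flags of [V] are sorted by their smallest face that is not plain. The flags consisting of plain
    faces are common to both polytopes and cancel in the comparison. *)
Lemma Psi_plains : iPsi V = ipsi N 0 D +
  \sum_(s in P :\: N) ipsi (below lt N s) 0 (fdim ind s) * b * psi_up s.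
Proof.
have PN : P :\: (P :\: N) = N.
  apply/setP => s; rewrite in_setD in_setD negb_and negbK; have := subsetP plains_sub s.
  by case: (s \in N) => [->|_] //=; rewrite andNb.
rewrite {1}/Psi (psi_split_low _ _ _ _ _ _ _ (subsetDl P N)); first last.
- exact: proper_tr.
- exact: proper_irr.
by rewrite PN.
Qed.

End OneCut.

Section AllCuts.
Variables (R : {set {set 'I_n}}) (r : {set 'I_n} -> nat).
Local Notation Q := (cutQ k R r).
Local Notation cut := (@cut n r).
Local Notation out := (@out n r).
Local Notation trace := (@trace n r).
Local Notation idbl := (@dbl n k R r).
Local Notation iplain := (@plain n k R r).
Local Notation N := (plains k R r).
Local Notation crossing := (@crossing n k r).

Hypothesis pairR : {in R &, forall F G, F != G -> #|F :&: G| + k <= r F + r G}%N.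
Hypothesis V0 : V != set0.
Hypothesis cutV : {in R, forall F, cut F V}.
Hypothesis ndV : ~~ idbl V.

(** What the polytope cut by a single flat loses at an out face, and what it gains at a crossing. *)
Definition out_term F s := ipsi [set t in P | ~~ out F t & t \proper s] 0 (fdim ind s) * b * psi_up s.
Definition cross_term x := iPsi x * b * ipsi [set t in P | hull x \subset t] (fdim ind x).+1 D.

(** A single flat has no partner, so no face is doubled, and being plain means not being out for
    [F]. *)
Lemma Psi_one_cut F : F \in R -> iPsi (cutQ k [set F] r) = iPsi V
  + \sum_(x | crossing F x) cross_term x - \sum_(s in P | out F s) out_term F s.
Proof.
move=> FR.
have pairF : {in [set F] &, forall F G, F != G -> #|F :&: G| + k <= r F + r G}%N.
  by move=> G H; rewrite !inE => /eqP -> /eqP ->; rewrite eqxx.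
have cutF : {in [set F], forall F, cut F V} by move=> G /set1P ->; apply: cutV.
have ndF s : s \in faces ind V -> ~~ dbl k [set F] r s.
  move=> sF; apply/negP => /exists_inP[G GF /andP[cs sQ]].
  have [H [HF HG _ _]] := dbl_partner pairF GF sF cs sQ.
  by move: GF HF HG; rewrite !inE => /eqP -> /eqP ->; rewrite eqxx.
have plE t : t \in P -> plain k [set F] r t = ~~ out F t.
  rewrite in_setD1 => /andP[_ tF]; rewrite /plain ndF //=.
  apply/forall_inP/idP => [|h G /set1P -> //]; by apply; rewrite inE.
rewrite (Psi_crossings pairF V0 cutF (ndF _ (faces_refl _ _))) (Psi_plains [set F] r).
rewrite -!addrA; congr (_ + _).
have -> : \sum_(s in P :\: plains k [set F] r)
    ipsi (below lt (plains k [set F] r) s) 0 (fdim ind s) * b * psi_up s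
    = \sum_(s in P | out F s) out_term F s.
  apply: eq_big => s; first by rewrite in_setD [s \in plains _ _ _]inE andbC; case: (boolP (s \in P)) => //= sP; rewrite plE // negbK.
  move=> _; congr (psi _ _ _ _ _ _ _ * _ * _); apply/setP => t; rewrite [RHS]in_set in_set [t \in plains _ _ _]in_set.
  by case: (boolP (t \in P)) => //= tP; rewrite plE.
rewrite addrCA subrr addr0; apply: eq_big => [x|x].
  rewrite inE; apply/exists_inP/idP => [[G /set1P ->] //|cx]; exists F => //; exact: set11.
rewrite inE => /exists_inP[G /set1P -> /and3P[_ cs _]].
congr (_ * _ * psi _ _ _ _ _ _ _); apply/setP => t; rewrite [LHS]in_set [RHS]in_set [t \in plains _ _ _]in_set.
case: (boolP (t \in P)) => //= tP; rewrite plE //; case: (boolP (hull x \subset t)) => ht; rewrite ?andbF // andbT.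
have FF : F \in [set F] by rewrite inE.
by apply: (cut_up_out pairF FF FF _ cs ht); move: tP; rewrite in_setD1 => /andP[].
Qed.

Lemma P_face s : s \in P -> s \in faces ind V.
Proof. by rewrite in_setD1 => /andP[]. Qed.

Lemma dbl_not_out F s : s \in P -> idbl s -> F \in R -> ~~ out F s.
Proof.
move=> sP /exists_inP[G GR /andP[cs _]] FR.
exact: (cut_up_out pairR GR FR (P_face sP) cs (subxx s)).
Qed.

Lemma dbl_not_plain s : idbl s -> ~~ iplain s.
Proof. by move=> ds; rewrite /plain ds. Qed.

(** Doubled faces are never out, and no face is out for two members of [R]. *)
Lemma sum_not_plain (w : {set {set 'I_n}} -> R0) : \sum_(s in P :\: N) w s =
  \sum_(s in P | idbl s) w s + \sum_(F in R) \sum_(s in P | out F s) w s.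
Proof.
rewrite (bigID idbl) /=; congr (_ + _).
  apply: eq_bigl => s; rewrite in_setD [s \in N]in_set.
  case: (boolP (idbl s)) => [/dbl_not_plain|]; rewrite ?andbF // => /negbTE ->.
  by rewrite andbF /= andbT.
rewrite (exchange_big_dep (fun s => (s \in P) && [exists F in R, out F s])) /=; last first.
  by move=> F s FR /andP[-> oF]; apply/exists_inP; exists F.
apply: eq_big => s.
  rewrite in_setD [s \in N]in_set /plain; case: (boolP (s \in P)) => sP; rewrite ?andbF //= andbT.
  have [/exists_inP[F FR oF]|no] := boolP [exists F in R, out F s].
    have nd : ~~ idbl s by apply: contraL oF => ds; apply: dbl_not_out.
    rewrite nd andbT /=; apply/negP => /forall_inP/(_ F FR); by rewrite oF.
  apply/negP => /andP[]; case: (idbl s) => //= /negP[]; apply/forall_inP => F FR.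
  by apply: contra no => oF; apply/exists_inP; exists F.
case/andP => /setDP[sP sN] nd; have sF := P_face sP.
have [F FR oF] : exists2 F, F \in R & out F s.
  move: sN; rewrite [s \in N]in_set sP /plain nd /= negb_forall => /existsP[F].
  by rewrite negb_imply negbK => /andP[FR oF]; exists F.
rewrite (big_pred1 F) // => G.
apply/and3P/eqP => [[GR _ oG]|-> //]; exact: (out_uniq pairR GR FR (faces_sub sF)).
Qed.

(** Below an out face, a face that is not out for [F] lies in the hyperplane of [F], hence in [Q],
    and is plain for the whole of [R]. *)
Lemma out_term_plains F s : F \in R -> s \in P -> out F s ->
  ipsi (below lt N s) 0 (fdim ind s) * b * psi_up s = out_term F s.
Proof.
move=> FR sP /andP[/forall_inP oF _]; congr (psi _ _ _ _ _ _ _ * _ * _).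
apply/setP => t; rewrite [LHS]in_set [RHS]in_set [t \in N]in_set.
case: (boolP (t \in P)) => //= tP; case: (boolP (t \proper s)) => ts; rewrite ?andbF // !andbT.
apply/idP/idP => [/andP[_ /forall_inP]|no]; first by apply.
apply: sub_Q_plain => //; apply/subsetP => B Bt.
have tF := P_face tP.
apply: (subsetP (trace_sub_Q pairR FR (faces_sub tF))); rewrite traceP Bt eqn_leq.
rewrite oF ?(subsetP (proper_sub ts)) // andbT leqNgt; apply: contra no => h.
apply/andP; split; last by apply/exists_inP; exists B.
by apply/forall_inP => C Ct; apply: oF; apply: (subsetP (proper_sub ts)).
Qed.

Lemma crossing_dbl x : x \in crossings k R r -> idbl (hull x) ->
  hull x \in faces ind V /\ hull x :&: Q = x.
Proof.
rewrite inE => /exists_inP[F FR /and3P[sF cs /eqP xF]] ds; split=> //.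
by rewrite (dbl_trace pairR sF ds FR cs) -xF.
Qed.

Lemma sum_dbl_crossings (w : {set {set 'I_n}} -> R0) :
  \sum_(x in crossings k R r | idbl (hull x)) w x = \sum_(s in P | idbl s) w (s :&: Q).
Proof.
rewrite (reindex_onto (fun s => s :&: Q) hull) /=; last first.
  by move=> x /andP[xX dx]; case: (crossing_dbl xX dx).
apply: eq_bigl => s; apply/andP/andP => [[/andP[sX ds] /eqP E]|[sP ds]].
  have [hF _] := crossing_dbl sX ds; rewrite E in hF ds; rewrite in_setD1 hF andbT; split=> //.
  by apply: contraTneq ds => ->.
have sF := P_face sP; have [F [G [FR GR _ _ [_ _ cE [E1 E2]]]]] := dbl_pair pairR sF ds.
have cs : cut F s by rewrite cE // !inE eqxx.
rewrite E1 (hull_trace sF cs) ds eqxx andbT; split=> //.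
by rewrite inE; apply/exists_inP; exists F => //; apply: crossing_trace.
Qed.

(* The crossing faces over a face [s] cut by exactly one [F] are counted once in
   the sum over [F], those over a face cut by two of them coincide. *)
Lemma sum_crossings (w : {set {set 'I_n}} -> R0) :
  \sum_(F in R) \sum_(x | crossing F x) w x =
  \sum_(x in crossings k R r | ~~ idbl (hull x)) w x
  + (\sum_(s in P | idbl s) w (s :&: Q)) *+ 2.
Proof.
rewrite (exchange_big_dep (mem (crossings k R r))) /=; last first.
  by move=> F x FR cx; rewrite inE; apply/exists_inP; exists F.
rewrite (bigID (fun x => idbl (hull x))) /= addrC; congr (_ + _).
  apply: eq_bigr => x /andP[]; rewrite inE => /exists_inP[F FR cx] nd.
  rewrite (big_pred1 F) // => G; apply/andP/eqP => [[GR cG]|-> //]; apply/eqP.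
  apply: contraNT nd => GF; case/and3P: cx => sF cs /eqP xF; case/and3P: cG => _ cG /eqP xG.
  have FG : F != G by rewrite eq_sym.
  have xt B : B \in x -> [/\ #|B :&: F| = r F, #|B :&: G| = r G, (#|F :&: G| + k = r F + r G)%N,
      F :&: G \subset B & B \subset F :|: G].
    move=> Bx; have := Bx; rewrite {1}xF traceP => /andP[Bs /eqP BF].
    have := Bx; rewrite {1}xG traceP => /andP[_ /eqP BG].
    apply: (tight_pair pairR) => //; rewrite ?BF ?BG //.
    exact: ksetsP _ _ (subsetP (faces_sub sF) B Bs).
  have [B0 B0x] := cut_trace_neq0 sF cs; rewrite -xF in B0x.
  have [_ _ mod _ _] := xt _ B0x.
  apply/exists_inP; exists F => //; rewrite cs; apply: (pair_dbl FR GR sF cs mod) => B.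
  case/kitvP => _ h1 h2; split.
    by apply: subset_trans h1; apply/bigcapsP => C /xt[].
  by apply: subset_trans h2 _; apply/bigcupsP => C /xt[].
rewrite -sum_dbl_crossings -sumrMnl; apply: eq_bigr => x /andP[sX ds].
have [sF xE] := crossing_dbl sX ds.
have [F [G [FR GR FG _ [_ _ cE [E1 E2]]]]] := dbl_pair pairR sF ds.
rewrite (eq_bigl (mem [set F; G])) => [|H].
  by rewrite big_setU1 ?inE //= big_set1 mulr2n.
rewrite /= /crossing sF /=; case: (boolP (H \in R)) => HR /=.
  rewrite -cE //; case: (boolP (cut H (hull x))) => //= cH.
  by rewrite -(dbl_trace pairR sF ds HR cH) xE eqxx.
by apply/esym/negP; rewrite !inE => /orP[] /eqP HE; rewrite HE ?FR ?GR in HR.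
Qed.

Lemma dbl_traceE s : s \in P -> idbl s -> exists F,
  [/\ F \in R, cut F s, s :&: Q = trace F s, hull (s :&: Q) = s & fdim ind s = (fdim ind (s :&: Q)).+1].
Proof.
move=> sP ds; have sF := P_face sP; case/exists_inP: (ds) => F FR /andP[cs _].
exists F; have E := dbl_trace pairR sF ds FR cs.
by split; rewrite // E ?(hull_trace sF cs) -?(fdim_trace sF cs).
Qed.

Lemma dbl_P s : s \in faces ind V -> idbl s -> s \in P.
Proof. by move=> sF ds; rewrite in_setD1 sF andbT; apply: contraTneq ds => ->. Qed.

Lemma in_N s : (s \in N) = (s \in P) && iplain s.
Proof. by rewrite in_set. Qed.

(** The parts of [psi_up s] and of the index of [s :&: Q] that avoid doubled faces and their
    traces. *)
Definition psi_up_plain s := ipsi [set t in N | s \subset t] (fdim ind s).+1 D.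
Definition psi_down s := ipsi [set t in P | t \subset s :&: Q] 0 (fdim ind (s :&: Q)).

(** Flags above [s] are sorted by their smallest doubled face [t]. All faces between [s] and [t] are
    doubled by [dblS], so nothing precedes [t] and the ranks in between contribute powers of [e]. *)
Lemma psi_up_dbl s : s \in P -> idbl s -> psi_up s = psi_up_plain s +
  \sum_(t in P | idbl t && (s \proper t)) e ^+ (fdim ind t - (fdim ind s).+1) * b * psi_up t.
Proof.
move=> sP ds; have sF := P_face sP; have [F [FR cs _ _ _]] := dbl_traceE sP ds.
pose X := [set t in above lt P s | idbl t].
have XP : X \subset above lt P s by apply/subsetP => t; rewrite inE => /andP[].
rewrite /psi_up (psi_split_low _ _ _ _ _ _ _ XP); [|exact: proper_irr|exact: proper_tr].
congr (_ + _).
  congr (psi _ _ _ _ _ _ _); apply/setP => t; rewrite in_setD [t \in X]in_set [RHS]in_set in_N [t \in above _ _ _]in_set.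
  case: (boolP (t \in P)) => //= tP; case: (boolP (s \proper t)) => [st|nst] /=.
    rewrite andbT (proper_sub st) andbT /plain; case: (boolP (idbl t)) => //= ndt.
    apply/esym/forall_inP => G GR; exact: (cut_up_out pairR FR GR (P_face tP) cs (proper_sub st)).
  apply/esym/negP => /andP[pt st]; case/negP: nst; rewrite properEneq st andbT.
  by apply: contraTneq pt => <-; apply: dbl_not_plain.
apply: eq_big => [t|t].
  by rewrite [t \in X]in_set in_set -andbA [_ && idbl t]andbC.
rewrite [t \in X]in_set in_set => /andP[/andP[tP st] dt].
have -> : below lt (above lt P s :\: X) t = set0.
  apply/setP => y; rewrite in_set in_setD [y \in X]in_set in_set in_set0; apply/negP.
  case/andP => /andP[ny /andP[yP sy]] yt; move: ny; rewrite yP sy /= => /negP[].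
  apply: (dblS pairR (P_face yP) (P_face tP) FR (cutS (proper_sub sy) cs) (proper_sub yt) dt).
rewrite psi0; last exact: proper_irr.
congr (_ * _ * psi _ _ _ _ _ _ _); apply/setP => y.
rewrite in_set [RHS]in_set; case: (boolP (t \proper y)) => ty; rewrite ?andbF // !andbT.
by rewrite in_set (proper_trans st ty) andbT.
Qed.

Lemma dbl_crossing s : s \in P -> idbl s -> s :&: Q \in crossings k R r.
Proof.
move=> sP ds; have [F [FR cs E _ _]] := dbl_traceE sP ds.
by rewrite inE; apply/exists_inP; exists F; rewrite // E crossing_trace ?P_face.
Qed.

Lemma sub_dbl_plain s t : s \in P -> idbl s -> t \in P ->
  (t \subset s :&: Q) = (iplain t && (t \subset s)).
Proof.
move=> sP ds tP; rewrite subsetI; apply/andP/andP => -[h1 h2].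
  by rewrite h1; split=> //; apply: sub_Q_plain.
by rewrite h2; split=> //; apply: (plain_dbl pairR (P_face sP) (P_face tP) h2 ds h1).
Qed.

(** The plain faces below [s] lie in [s :&: Q] and have smaller dimension, so the rank of [s :&: Q]
    stays vacant and yields the additional [e]. *)
Lemma down_plain s : s \in P -> idbl s ->
  ipsi (below lt N s) 0 (fdim ind s) * b * psi_up s = psi_down s * e * b * psi_up s.
Proof.
move=> sP ds; have [F [FR cs E hs dE]] := dbl_traceE sP ds.
have -> : below lt N s = [set t in P | t \subset s :&: Q].
  apply/setP => t; rewrite in_set in_N [RHS]in_set; case: (boolP (t \in P)) => //= tP.
  rewrite sub_dbl_plain // properEneq; case: (boolP (iplain t)) => //= pt.
  rewrite andb_idl // => _; apply: contraTneq pt => ->; exact: dbl_not_plain.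
rewrite dE psi_shift_high; [by []|exact: proper_irr|by []|].
move=> t; rewrite in_set => /andP[tP tx].
have xF : s :&: Q \in pfaces ind Q.
  exact: (subsetP (pfacesQ_crossing pairR V0 cutV ndV) _ (dbl_crossing sP ds)).
have Qn0 := Q0 pairR V0 cutV.
have tQ : t \subset Q by move: tx; rewrite subsetI => /andP[].
have tFQ : t \in faces ind Q.
  rewrite -(setIidPl tQ); apply: (faceI_Q V0 (P_face tP)); rewrite (setIidPl tQ).
  exact: faces_neq0 V0 (P_face tP).
apply: (fdim_face_lt Qn0 tFQ); last exact: subsetIr.
rewrite properEneq tx andbT; apply: contraTneq tx => tE.
apply/negP => _; have := sub_Q_not_cut FR tQ; rewrite -(face_hull (P_face tP)) tE hs.
by rewrite cs.
Qed.

(** The proper faces of [s :&: Q] are faces of [V] or traces of doubled faces [t] below [s]. Sorted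
    by the largest trace, nothing follows it, since a face of [V] containing the trace contains [t]
    and so is not inside [Q]. *)
Lemma Psi_dbl s : s \in P -> idbl s -> iPsi (s :&: Q) = psi_down s +
  \sum_(t in P | idbl t && (t \proper s))
     iPsi (t :&: Q) * b * e ^+ (fdim ind s - (fdim ind t).+1).
Proof.
move=> sP ds; have [F [FR cs E hs dE]] := dbl_traceE sP ds.
set x := s :&: Q in hs dE *.
have xX : x \in crossings k R r := dbl_crossing sP ds.
have sXQ := pfacesQ_crossing pairR V0 cutV ndV.
have xPQ : x \in pfaces ind Q := subsetP sXQ _ xX.
have xF : x \in faces ind Q by move: xPQ; rewrite in_setD1 => /andP[].
have Qn0 := Q0 pairR V0 cutV; have x0 := faces_neq0 Qn0 xF.
have hullt t : t \in P -> idbl t -> hull (t :&: Q) = t by move=> tP dt; case: (dbl_traceE tP dt) => ? [].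
pose T := [set t in P | idbl t && (t \proper s)].
pose X := [set t :&: Q | t in T].
have pfx : pfaces ind x = [set y in pfaces ind Q | y \proper x] by apply: pfaces_faces.
have tX t : t \in T -> t :&: Q \in crossings k R r /\ t :&: Q \in pfaces ind x.
  rewrite in_set => /and3P[tP dt ts]; have cX := dbl_crossing tP dt; split=> //.
  rewrite pfx in_set (subsetP sXQ) //= properEneq setSI ?proper_sub // andbT.
  by apply: contraTneq ts => tE; rewrite -(hullt t tP dt) tE -/x hs properxx.
have XP : X \subset pfaces ind x by apply/subsetP => _ /imsetP[t /tX[_ h] ->].
rewrite {1}/Psi (psi_split_top _ _ _ _ _ _ _ XP); [|exact: proper_irr|exact: proper_tr].
have DX : pfaces ind x :\: X = [set t in P | t \subset x].
  apply/setP => y; rewrite in_setD pfx [RHS]in_set [_ \in [set y in _ | _]]in_set.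
  apply/and3P/andP => [[yX yQ yx]|[yP yx]].
    have [yc|yc] := boolP (y \in crossings k R r).
      case/negP: yX; move: yc; rewrite inE => /exists_inP[G GR /and3P[tF ct /eqP yE]].
      have ts : hull y \subset s by rewrite -hs; apply/hullS/proper_sub.
      have dt : idbl (hull y) by apply: (dblS pairR tF (P_face sP) GR ct ts ds).
      have yE2 : y = hull y :&: Q by rewrite (dbl_trace pairR tF dt GR ct).
      apply/imsetP; exists (hull y) => //; rewrite in_set dbl_P //= dt /= properEneq ts andbT.
      by apply: contraTneq yx => tE; rewrite yE2 tE properxx.
    have : y \in pfaces ind Q :\: crossings k R r by rewrite in_setD yc.
    rewrite (pfacesQ_plain pairR V0 cutV ndV) => /imsetP[t tN yE].
    have ht := plains_hull pairR V0 tN; move: tN; rewrite in_N => /andP[tP pt].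
    have ts : t \subset s by rewrite -ht -yE -hs; apply/hullS/proper_sub.
    have tQ := plain_dbl pairR (P_face sP) (P_face tP) ts ds pt.
    by rewrite yE (setIidPl tQ) tP subsetI ts tQ.
  have yQ : y \subset Q by move: yx; rewrite subsetI => /andP[].
  have yN : y \in N by rewrite in_N yP sub_Q_plain.
  have : y \in pfaces ind Q :\: crossings k R r.
    by rewrite (pfacesQ_plain pairR V0 cutV ndV); apply/imsetP; exists y; rewrite // (setIidPl yQ).
  rewrite in_setD => /andP[yc yPQ]; split=> //.
    by apply/imsetP => -[t /tX[tc _] yE]; rewrite yE tc in yc.
  by rewrite properEneq yx andbT; apply: contraNneq yc => ->.
rewrite DX; congr (_ + _).
rewrite big_imset /=; last first.
  move=> t t'; rewrite in_set => /and3P[tP dt _]; rewrite in_set => /and3P[tP' dt' _] tE.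
  by rewrite -(hullt t tP dt) tE hullt.
apply: eq_big => [t|t tT]; first by rewrite in_set.
have [tc tx] := tX t tT; move: (tT); rewrite in_set => /and3P[tP dt ts].
have [G [GR ct tE ht dtE]] := dbl_traceE tP dt.
have txF : t :&: Q \in faces ind x by move: tx; rewrite in_setD1 => /andP[].
rewrite {1}/Psi (pfaces_faces x0 txF); congr (_ * _ * _).
have -> : above lt [set t in P | t \subset x] (t :&: Q) = set0.
  apply/setP => y; rewrite in_set in_set in_set0; apply/negP => /andP[/andP[yP yx] ty].
  have yQ : y \subset Q by move: yx; rewrite subsetI => /andP[].
  have tQ : t \subset Q.
    apply: subset_trans yQ; rewrite -ht -(face_hull (P_face yP)).
    exact/hullS/proper_sub.
  by have := sub_Q_not_cut GR tQ; rewrite ct.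
rewrite psi0; last exact: proper_irr.
by rewrite dE dtE subSS.
Qed.

(** In the one-flat polytope [s] is itself allowed above its trace and is the minimum there, so its
    rank contributes [b + e]. *)
Lemma cross_term_dbl s : s \in P -> idbl s ->
  cross_term (s :&: Q) = iPsi (s :&: Q) * b * (b + e) * psi_up s.
Proof.
move=> sP ds; have [F [FR cs E hs dE]] := dbl_traceE sP ds.
rewrite /cross_term hs -dE -[RHS]mulrA; congr (_ * _).
have PE : above lt [set t in P | s \subset t] s = above lt P s.
  apply/setP => t; rewrite in_set [RHS]in_set in_set; case: (boolP (t \in P)) => //= tP.
  by case: (boolP (s \proper t)) => st; rewrite ?andbF // (proper_sub st).
rewrite psi_bottom ?PE //; first by rewrite [b + e]addrC.
- exact: proper_irr.
- exact: proper_tr.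
- by rewrite in_set sP subxx.
- apply: (fdim_face_lt V0 (P_face sP)) => //; move: sP; rewrite in_setD1 => /andP[sV sF].
  by rewrite properEneq sV (faces_sub sF).
move=> t; rewrite in_set => /andP[tP st] ts; have st' : s \proper t by rewrite properEneq eq_sym ts.
by split=> //; apply: (fdim_face_lt V0 (P_face sP) st' (faces_sub (P_face tP))).
Qed.

(** Above a crossing that is not doubled all faces are plain, so the one-flat terms reappear. Above
    the trace of a doubled [s] the face [s] is missing, and its rank contributes [e] instead of
    [b + e]. *)
Lemma Psi_Q_split : iPsi Q = ipsi N 0 D + (\sum_(x in crossings k R r | ~~ idbl (hull x)) cross_term x
    + \sum_(s in P | idbl s) iPsi (s :&: Q) * b * e * psi_up_plain s).
Proof.
rewrite (Psi_crossings pairR V0 cutV ndV) (bigID (fun x => ~~ idbl (hull x))) /=.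
congr (_ + (_ + _)).
  apply: eq_bigr => x /andP[]; rewrite inE => /exists_inP[F FR /and3P[sF cs _]] nd.
  congr (_ * psi _ _ _ _ _ _ _); apply/setP => t; rewrite in_set in_N [RHS]in_set.
  case: (boolP (t \in P)) => //= tP; case: (boolP (hull x \subset t)) => ht; rewrite ?andbF // andbT.
  apply/andP; split; last by apply/forall_inP => G GR; apply: (cut_up_out pairR FR GR (P_face tP) cs ht).
  by apply: contra nd; apply: (dblS pairR sF (P_face tP) FR cs ht).
under eq_bigl => x do rewrite negbK.
rewrite sum_dbl_crossings; apply: eq_bigr => s /andP[sP ds].
have [F [FR cs E hs dE]] := dbl_traceE sP ds.
rewrite hs -dE -[RHS]mulrA; congr (_ * _); apply: psi_shift_low; first exact: proper_irr.
  apply: (fdim_face_lt V0 (P_face sP)) => //; move: sP; rewrite in_setD1 => /andP[sV sF].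
  by rewrite properEneq sV (faces_sub sF).
move=> t; rewrite in_set in_N => /andP[/andP[tP pt] st].
have st' : s \proper t by rewrite properEneq st andbT; apply: contraTneq pt => <-; apply: dbl_not_plain.
exact: (fdim_face_lt V0 (P_face sP) st' (faces_sub (P_face tP))).
Qed.

(** Expanding [psi_up_plain] and [psi_down] produces the same double sum over nested doubled faces
    once the factor [e] is absorbed into the power; it cancels. *)
Lemma dbl_telescope :
  \sum_(s in P | idbl s) iPsi (s :&: Q) * b * e * psi_up_plain s
   - \sum_(s in P | idbl s) psi_down s * e * b * psi_up s =
  \sum_(s in P | idbl s) iPsi (s :&: Q) * (b * e - e * b) * psi_up s.
Proof.
pose K s t := e ^+ (fdim ind t - (fdim ind s).+1).
have -> : \sum_(s in P | idbl s) iPsi (s :&: Q) * b * e * psi_up_plain s =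
    \sum_(s in P | idbl s) iPsi (s :&: Q) * b * e * psi_up s -
    \sum_(s in P | idbl s) \sum_(t in P | idbl t && (s \proper t))
       iPsi (s :&: Q) * b * e * K s t * b * psi_up t.
  rewrite -sumrB; apply: eq_bigr => s /andP[sP ds].
  rewrite (psi_up_dbl sP ds) mulrDr mulr_sumr.
  by under [X in (_ + X) - _]eq_bigr => t _ do rewrite !mulrA; rewrite addrK.
have -> : \sum_(s in P | idbl s) psi_down s * e * b * psi_up s =
    \sum_(s in P | idbl s) iPsi (s :&: Q) * e * b * psi_up s -
    \sum_(s in P | idbl s) \sum_(t in P | idbl t && (t \proper s))
       iPsi (t :&: Q) * b * K t s * e * b * psi_up s.
  rewrite -sumrB; apply: eq_bigr => s /andP[sP ds].
  by rewrite (Psi_dbl sP ds) !mulrDl !mulr_suml addrK.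
have -> : \sum_(s in P | idbl s) \sum_(t in P | idbl t && (s \proper t))
       iPsi (s :&: Q) * b * e * K s t * b * psi_up t =
    \sum_(s in P | idbl s) \sum_(t in P | idbl t && (t \proper s))
       iPsi (t :&: Q) * b * K t s * e * b * psi_up s.
  rewrite (exchange_big_dep (fun t => (t \in P) && idbl t)) /=; last by move=> s t _ /and3P[-> -> _].
  apply: eq_bigr => t /andP[tP dt]; apply: eq_big => [s|s _].
    by rewrite tP dt /= andbA.
  by rewrite -[_ * e * K s t]mulrA -[_ * K s t * e]mulrA -exprS -exprSr.
rewrite opprD opprK addrACA addNr addr0 -sumrB; apply: eq_bigr => s _.
by rewrite mulrBr mulrBl !mulrA.
Qed.

Theorem Psi_cuts : iPsi Q = iPsi V + \sum_(F in R) (iPsi (cutQ k [set F] r) - iPsi V)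
  - \sum_(s in P | idbl s) iPsi (s :&: Q) * ((b + e) * b + b * (b + e)) * psi_up s.
Proof.
have E1 : \sum_(F in R) (iPsi (cutQ k [set F] r) - iPsi V) =
    \sum_(F in R) \sum_(x | crossing F x) cross_term x
    - \sum_(F in R) \sum_(s in P | out F s) out_term F s.
  rewrite -sumrB; apply: eq_bigr => F FR.
  by rewrite Psi_one_cut // -(addrA (iPsi V)) [LHS]addrC addKr.
have E2 : iPsi V = ipsi N 0 D + (\sum_(s in P | idbl s) psi_down s * e * b * psi_up s
    + \sum_(F in R) \sum_(s in P | out F s) out_term F s).
  rewrite (Psi_plains R r) sum_not_plain; congr (_ + (_ + _)).
    by apply: eq_bigr => s /andP[sP ds]; apply: down_plain.
  by apply: eq_bigr => F FR; apply: eq_bigr => s /andP[sP oF]; apply: out_term_plains.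
(* The factor is 2b(b + e) - ((b + e)b + b(b + e)) = be - eb; the subtracted term becomes ab + ba
   for a = b + e. *)
have E4 : (\sum_(s in P | idbl s) cross_term (s :&: Q)) *+ 2 -
    \sum_(s in P | idbl s) iPsi (s :&: Q) * ((b + e) * b + b * (b + e)) * psi_up s =
    \sum_(s in P | idbl s) iPsi (s :&: Q) * (b * e - e * b) * psi_up s.
  rewrite -sumrMnl -sumrB; apply: eq_bigr => s /andP[sP ds].
  rewrite cross_term_dbl // -(mulrA _ b (b + e)) -mulrnAl -mulrnAr -mulrBl -mulrBr.
  congr (_ * _ * _); rewrite mulr2n opprD addrACA subrr addr0.
  by rewrite mulrDr mulrDl opprD addrACA subrr add0r.
rewrite E1 sum_crossings Psi_Q_split {1}E2.
set q := \sum_(s in P | idbl s) _ * psi_up_plain s in E4 *.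
set m := \sum_(s in P | idbl s) psi_down s * _ * _ * _.
have -> : q = m + ((\sum_(s in P | idbl s) cross_term (s :&: Q)) *+ 2 -
    \sum_(s in P | idbl s) iPsi (s :&: Q) * ((b + e) * b + b * (b + e)) * psi_up s).
  by rewrite E4 -dbl_telescope addrC subrK.
move: (_ *+ 2) => g2; rewrite !addrA [RHS](ACl (1*2*4*5*7*3*6)) /= addrK.
by rewrite [LHS](ACl (1*3*2*4*5)).
Qed.

End AllCuts.

End CutIndex.

(** * Cuspidal polytopes, products and simplices *)

Section IndicatorMaps.
Variables (m n : nat) (g : 'I_m -> 'I_n).
Hypothesis inj_g : injective g.

Definition incl_mx : 'M[rat]_(m, n) := \matrix_(i, j) (g i == j)%:R.

Lemma indic_incl (B : {set 'I_m}) : indic B *m incl_mx = indic (g @: B).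
Proof.
apply/rowP => j; rewrite !mxE; case: ifP => [/imsetP[i iB ->]|jB].
  rewrite (bigD1 i) //= !mxE iB eqxx mulr1 big1 ?addr0 // => l li.
  by rewrite !mxE (inj_eq inj_g) (negbTE li) mulr0.
rewrite big1 // => i _; rewrite !mxE; case: ifP => iB; rewrite ?mul0r //.
case: eqP => [E|_]; last by rewrite mulr0.
by move: jB; rewrite -E imset_f.
Qed.

Lemma indic_incl_tr (C : {set 'I_n}) : indic C *m incl_mx^T = indic (g @^-1: C).
Proof.
apply/rowP => i; rewrite !mxE (bigD1 (g i)) //= !mxE eqxx mulr1 inE big1 ?addr0 // => j ji.
by rewrite !mxE eq_sym (negbTE ji) mulr0.
Qed.

Lemma preimset_imset (B : {set 'I_m}) : g @^-1: (g @: B) = B.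
Proof. by apply/setP => i; rewrite inE mem_imset. Qed.
End IndicatorMaps.

Section Transports.
Variables (R0 : pzRingType) (b e : R0).

Lemma Psi_sig n (Bs : {set {set 'I_n}}) (p : pred {set 'I_n}) :
  (forall B, (B \in Bs) = p B) ->
  Psi b e (fun B : {B : {set 'I_n} | p B} => indic (val B)) setT = Psi b e (@indic n) Bs.
Proof.
move=> E.
rewrite (@Psi_transport _ _ _ _ _ _ _ _ (@indic n) _ val 1%:M 1%:M 0 0).
- congr (Psi b e _ _); apply/setP => B; apply/imsetP/idP => [[C _ ->]|].
    by rewrite E; apply: (valP C).
  by rewrite E => pB; exists (exist _ B pB).
- by move=> B C _ _; apply: val_inj.
- by move=> B _; rewrite mulmx1 addr0.
- by move=> B _; rewrite mulmx1 addr0.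
Qed.

(** Enumerate [F] and then its complement. *)
Lemma perm_initial n (F : {set 'I_n}) : exists2 g : 'I_n -> 'I_n, injective g &
  forall i, (g i \in F) = (i < #|F|)%N.
Proof.
pose s := enum F ++ enum (~: F).
have sz : size s == n by rewrite size_cat -!cardE cardsC card_ord.
have us : uniq s.
  rewrite cat_uniq !enum_uniq andbT /=; apply/hasPn => x; rewrite !mem_enum inE.
  by [].
exists (tnth (Tuple sz)); first exact/tuple_uniqP.
move=> i; rewrite (tnth_nth i) /= nth_cat -cardE; case: ifP => iF.
  by rewrite -mem_enum mem_nth // -cardE.
have : nth i (enum (~: F)) (i - #|F|) \in enum (~: F).
  rewrite mem_nth // -cardE; have cE := cardsC F; rewrite card_ord in cE.
  have il := ltn_ord i; move/negbT: iF; rewrite -leqNgt => iF.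
  by rewrite ltn_subLR // cE.
by rewrite mem_enum inE => /negbTE.
Qed.

(** Relabelling the coordinates moves [F] to the initial segment by which the cuspidal polytope is
    defined. *)
Lemma Psi_cuspidal n k (F : {set 'I_n}) (q : nat) (r : {set 'I_n} -> nat) : r F = q ->
  Psi b e (@indic n) (cutQ k [set F] r) = Psi b e (@indic n)
    [set B : {set 'I_n} | (#|B| == k) && (#|B :&: [set i : 'I_n | (i < #|F|)%N]| <= q)%N].
Proof.
move=> rF; have [g inj_g gF] := perm_initial F; apply/esym.
rewrite (@Psi_transport _ _ _ _ _ _ _ _ (@indic n) _ (fun B : {set 'I_n} => g @: B) (incl_mx g) (incl_mx g)^T 0 0).
- congr (Psi b e _ _); apply/setP => B.
  have gI (C : {set 'I_n}) : g @: C :&: F = g @: (C :&: [set i : 'I_n | (i < #|F|)%N]).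
    apply/setP => x; rewrite inE; apply/andP/imsetP => [[/imsetP[i iC ->]]|[i]].
      by rewrite gF => iF; exists i; rewrite // !inE iC.
    by rewrite !inE => /andP[iC iF] ->; rewrite imset_f // gF.
  apply/imsetP/cutQP => [[C]|[Bk BF]].
    rewrite inE => /andP[/eqP Ck CF] ->; split; first by rewrite card_imset.
    by move=> G /set1P ->; rewrite gI card_imset // rF.
  have [g' gK Kg] := injF_bij inj_g.
  have BE : B = g @: (g @^-1: B).
    apply/setP => x; rewrite -[x]Kg mem_imset // inE.
    by [].
  exists (g @^-1: B) => //; rewrite inE.
  have := card_imset (g @^-1: B) inj_g; rewrite -BE Bk => <-; rewrite eqxx /=.
  by have := BF F; rewrite inE eqxx rF BE gI card_imset // preimset_imset // => /(_ isT).
- by move=> B C _ _; apply: imset_inj.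
- by move=> B _; rewrite indic_incl // addr0.
- by move=> B _; rewrite indic_incl_tr preimset_imset // addr0.
Qed.

(** The fixed elements [A] act as a translation, and the two factors occupy the coordinates in [S1]
    and [S2]. *)
Lemma Psi_prod n (A S1 S2 : {set 'I_n}) p q :
  [disjoint A & S1] -> [disjoint A & S2] -> [disjoint S1 & S2] ->
  Psi b e (prod_pts (hyp_pts p #|S1|) (hyp_pts q #|S2|)) setT = Psi b e (@indic n)
    [set B : {set 'I_n} | [&& A \subset B, B \subset A :|: S1 :|: S2, #|B :&: S1| == p & #|B :&: S2| == q]].
Proof.
move=> dA1 dA2 d12.
pose g1 (i : 'I_(#|S1|)) : 'I_n := enum_val i; pose g2 (i : 'I_(#|S2|)) : 'I_n := enum_val i.
have i1 : injective g1 := @enum_val_inj _ _; have i2 : injective g2 := @enum_val_inj _ _.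
have m1 i : g1 i \in S1 by apply: enum_valP.
have m2 i : g2 i \in S2 by apply: enum_valP.
have s1 (B : {set 'I_(#|S1|)}) : g1 @: B \subset S1 by apply/subsetP => x /imsetP[i _ ->].
have s2 (B : {set 'I_(#|S2|)}) : g2 @: B \subset S2 by apply/subsetP => x /imsetP[i _ ->].
pose h (x : {B : {set 'I_(#|S1|)} | #|B| == p} * {B : {set 'I_(#|S2|)} | #|B| == q}) : {set 'I_n} :=
  A :|: g1 @: (val x.1) :|: g2 @: (val x.2).
have nA1 x : x \in S1 -> x \notin A by move=> xS; rewrite (disjointFl dA1 xS).
have nA2 x : x \in S2 -> x \notin A by move=> xS; rewrite (disjointFl dA2 xS).
have n12 x : x \in S1 -> x \notin S2 by move=> xS; rewrite (disjointFr d12 xS).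
have n21 x : x \in S2 -> x \notin S1 by move=> xS; rewrite (disjointFl d12 xS).
have h1 x : h x :&: S1 = g1 @: (val x.1).
  apply/setP => y; rewrite !inE; case: (boolP (y \in S1)) => yS; rewrite ?andbF ?andbT.
    rewrite (negbTE (nA1 y yS)) /=; case: (boolP (y \in g2 @: _)) => [/(subsetP (s2 _))|]; rewrite ?orbF //.
    by rewrite (negbTE (n12 y yS)).
  by apply/esym/negbTE; apply: contra yS; apply: (subsetP (s1 _)).
have h2 x : h x :&: S2 = g2 @: (val x.2).
  apply/setP => y; rewrite !inE; case: (boolP (y \in S2)) => yS; rewrite ?andbF ?andbT.
    rewrite (negbTE (nA2 y yS)) /=; case: (boolP (y \in g1 @: _)) => [/(subsetP (s1 _))|]; rewrite ?orbF //.
    by rewrite (negbTE (n21 y yS)).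
  by apply/esym/negbTE; apply: contra yS; apply: (subsetP (s2 _)).
have p1 x : g1 @^-1: h x = val x.1.
  by rewrite -[RHS](preimset_imset i1) -h1; apply/setP => i; rewrite !inE m1 andbT.
have p2 x : g2 @^-1: h x = val x.2.
  by rewrite -[RHS](preimset_imset i2) -h2; apply/setP => i; rewrite !inE m2 andbT.
rewrite (@Psi_transport _ _ _ _ _ _ _ _ (@indic n) _ h (col_mx (incl_mx g1) (incl_mx g2))
  (row_mx (incl_mx g1)^T (incl_mx g2)^T) (indic A) 0).
- congr (Psi b e _ _); apply/setP => B; rewrite inE; apply/imsetP/and4P => [[x _ ->]|[AB BZ B1 B2]].
    rewrite h1 h2 !card_imset // (valP x.1) (valP x.2); split=> //.
      by rewrite /h -setUA subsetUl.
    by rewrite /h setUSS // setUS.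
  have c1 : #|g1 @^-1: B| == p.
    rewrite -(card_imset _ i1); have -> : g1 @: (g1 @^-1: B) = B :&: S1; last by [].
    apply/setP => x; rewrite inE; apply/imsetP/andP => [[i]|[xB xS]].
      by rewrite inE => iB ->; rewrite iB m1.
    by exists (enum_rank_in xS x); rewrite ?inE /g1 enum_rankK_in.
  have c2 : #|g2 @^-1: B| == q.
    rewrite -(card_imset _ i2); have -> : g2 @: (g2 @^-1: B) = B :&: S2; last by [].
    apply/setP => x; rewrite inE; apply/imsetP/andP => [[i]|[xB xS]].
      by rewrite inE => iB ->; rewrite iB m2.
    by exists (enum_rank_in xS x); rewrite ?inE /g2 enum_rankK_in.
  exists (exist (fun B : {set 'I_(#|S1|)} => #|B| == p) _ c1, exist (fun B : {set 'I_(#|S2|)} => #|B| == q) _ c2) => //; apply/setP => x; rewrite /h !inE /=.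
  apply/idP/orP => [xB|[/orP[xA|/imsetP[i]]|/imsetP[i]]].
  - have := subsetP BZ x xB; rewrite !inE => /orP[/orP[->|xS]|xS]; first by left.
      left; apply/orP; right; apply/imsetP; exists (enum_rank_in xS x);
      by rewrite ?inE /g1 enum_rankK_in.
    by right; apply/imsetP; exists (enum_rank_in xS x); rewrite ?inE /g2 enum_rankK_in.
  - exact: (subsetP AB).
  - by rewrite inE => ? ->.
  - by rewrite inE => ? ->.
- move=> x y _ _ E; apply/pair_eqP; rewrite /pair_eq -!val_eqE /=.
  by rewrite -p1 -[in X in _ && X]p2 E p1 p2 !eqxx.
- move=> x _; rewrite /prod_pts /hyp_pts mul_row_col !indic_incl //.
  apply/rowP => i; rewrite !mxE /h !inE.
  have [i1'|/negbTE n1] := boolP (i \in g1 @: _).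
    have iS := subsetP (s1 _) _ i1'; rewrite (negbTE (nA1 i iS)) /= addr0.
    case: (boolP (i \in g2 @: _)) => [/(subsetP (s2 _))|]; rewrite ?addr0 //.
    by rewrite (negbTE (n12 i iS)).
  rewrite orbF add0r; have [i2'|/negbTE n2] := boolP (i \in g2 @: _).
    by rewrite orbT (negbTE (nA2 i (subsetP (s2 _) _ i2'))) addr0.
  by rewrite orbF add0r.
- move=> x _; rewrite addr0 mul_mx_row !indic_incl_tr p1 p2.
  by [].
Qed.

End Transports.

Section IntervalFaces.
Variables (n k : nat).
Implicit Types (A B Z : {set 'I_n}) (s t : {set {set 'I_n}}).

(** For [k = #|Z|] the interval would be the single set [Z], whose core is [Z]; hence the strict
    inequality. *)
Lemma core_kitv A Z : A \subset Z -> (#|A| <= k < #|Z|)%N -> core (kitv k A Z) = A.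
Proof.
move=> AZ /andP[Ak kZ]; apply/eqP; rewrite eqEsubset; apply/andP; split; last first.
  by apply/bigcapsP => B /kitvP[].
apply/subsetP => x xc; apply: contraT => xA.
have AZx : A \subset Z :\ x by rewrite subsetD1 AZ.
have [|B [AB BZ Bk]] := subset_between AZx (m := k).
  by rewrite Ak -ltnS (leq_trans kZ) // (cardsD1 x Z); case: (x \in Z).
have BI : B \in kitv k A Z by apply/kitvP; rewrite (subset_trans BZ) ?subD1set.
by have := subsetP BZ x (subsetP (core_sub BI) x xc); rewrite !inE eqxx.
Qed.

Lemma supp_kitv A Z : A \subset Z -> (#|A| < k <= #|Z|)%N -> supp (kitv k A Z) = Z.
Proof.
move=> AZ /andP[Ak kZ]; apply/eqP; rewrite eqEsubset; apply/andP; split.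
  by apply/bigcupsP => B /kitvP[].
apply/subsetP => x xZ.
have AxZ : x |: A \subset Z by rewrite subUset sub1set xZ.
have [|B [AB BZ Bk]] := subset_between AxZ (m := k).
  by rewrite kZ andbT cardsU1; case: (x \notin A) => //=; apply: ltnW.
apply: (subsetP (supp_sub (B := B) _)); first by apply/kitvP; rewrite (subset_trans _ AB) ?subsetUr.
by apply: (subsetP AB); rewrite !inE eqxx.
Qed.

Lemma kitv_neq0 A Z : A \subset Z -> (#|A| <= k <= #|Z|)%N -> kitv k A Z != set0.
Proof.
move=> AZ /(subset_between AZ)[B [AB BZ Bk]]; apply/set0Pn; exists B; exact/kitvP.
Qed.

Lemma kitvT : kitv k set0 [set: 'I_n] = ksets n k.
Proof. by apply/setP => B; rewrite inE sub0set subsetT !andbT. Qed.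

Lemma core_supp_card s x0 : s \in faces (@indic n) (ksets n k) -> x0 \in freeset s ->
  [/\ core s \subset supp s, (#|core s| < k)%N & (k < #|supp s|)%N].
Proof.
move=> sF x0s; have [B Bs] : exists B, B \in s.
  by move: x0s; rewrite inE => /andP[_ /suppP[B]]; exists B.
have [u [v [/setIP[/setDP[_ uc] uB] /setDP[/setDP[vs _] vB]]]] := free_ltn sF x0s Bs.
have <- := ksetsP _ _ (subsetP (faces_sub sF) B Bs).
split; first exact: subset_trans (core_sub Bs) (supp_sub Bs).
  by apply/proper_card/properP; split; [apply: core_sub | exists u].
by apply/proper_card/properP; split; [apply: supp_sub | exists v].
Qed.
End IntervalFaces.

Section SimplexIndex.
Variables (R0 : pzRingType) (b e : R0).

Lemma fdim_set1 m (T : finType) (f : T -> 'rV[rat]_m) t : fdim f [set t] = 0%N.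
Proof.
by rewrite (fdimE f (set11 t)) enum_set1 /= span_seq1 subrr dim_vline eqxx.
Qed.

Lemma singletons_supp n (t : {set {set 'I_n}}) : t \subset ksets n 1 -> t = kitv 1 set0 (supp t).
Proof.
move=> tV; apply/setP => B; apply/idP/kitvP => [Bt|[/eqP/cards1P[x ->] _]].
  by split; [apply/ksetsP/(subsetP tV) | exact: sub0set | exact: supp_sub].
rewrite sub1set => /suppP[C Ct]; have /eqP/cards1P[y Cy] := ksetsP _ _ (subsetP tV C Ct).
by rewrite Cy inE => /eqP ->; rewrite -Cy.
Qed.

(** Through the support, the proper faces of a simplex are the nonempty proper subsets of its
    vertices, of dimension one less than their size. *)
Lemma psi_subsets n (X : {set 'I_n}) : X != set0 ->
  psi b e (fun Y Z : {set 'I_n} => Y \proper Z) (fun W : {set 'I_n} => #|W|.-1)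
    [set W : {set 'I_n} | (W != set0) && (W \proper X)] 0 #|X|.-1 =
  Psi b e (@indic #|X|) (ksets #|X| 1).
Proof.
rewrite -card_gt0 => X0; pose g (i : 'I_(#|X|)) : 'I_n := enum_val i.
have inj_g : injective g := @enum_val_inj _ _.
have gX (W : {set 'I_(#|X|)}) : g @: W \subset X by apply/subsetP => _ /imsetP[i _ ->]; apply: enum_valP.
have gT : g @: setT = X.
  by apply/eqP; rewrite eqEcard gX card_imset // cardsT card_ord leqnn.
have sub (W W' : {set 'I_(#|X|)}) : (g @: W \subset g @: W') = (W \subset W').
  by apply/idP/idP => [|/imsetS]; [rewrite -{2}(preimset_imset inj_g W) -{2}(preimset_imset inj_g W'); apply: preimsetS | apply].
have E0 (W : {set 'I_(#|X|)}) : W != set0 -> (#|@set0 'I_(#|X|)| < 1 <= #|W|)%N by rewrite cards0 card_gt0.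
have sE (W : {set 'I_(#|X|)}) : W != set0 -> supp (kitv 1 set0 W) = W.
  by move=> W0; rewrite supp_kitv ?sub0set ?E0.
have T0 : [set: 'I_(#|X|)] != set0 by rewrite -card_gt0 cardsT card_ord.
have VE : ksets #|X| 1 = kitv 1 set0 setT by rewrite kitvT.
have V0 : ksets #|X| 1 != set0.
  by rewrite VE kitv_neq0 ?sub0set // cards0 cardsT card_ord.
have supp0 t : t \in faces (@indic #|X|) (ksets #|X| 1) -> supp t != set0.
  move=> tF; have /set0Pn[B Bt] := faces_neq0 V0 tF.
  have := ksetsP _ _ (subsetP (faces_sub tF) B Bt) => /eqP/cards1P[x Bx].
  by apply/set0Pn; exists x; apply: (subsetP (supp_sub Bt)); rewrite Bx set11.
have dE t : t \in faces (@indic #|X|) (ksets #|X| 1) -> fdim (@indic #|X|) t = #|supp t|.-1.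
  move=> tF; have tE := singletons_supp (faces_sub tF); have s0 := supp0 t tF.
  case: (ltngtP #|supp t| 1%N) => [|s2|/eqP/cards1P[x sx]].
  - by rewrite ltnS leqn0 cards_eq0 (negbTE s0).
  - have cE : core t = set0 by rewrite tE core_kitv ?sub0set // cards0.
    have fE : freeset t = supp t by rewrite /freeset cE setD0.
    have /card_gt0P[x xs] : (0 < #|supp t|)%N by apply: ltnW.
    by rewrite -fE -(fdim_face tF (x0 := x)) ?fE.
  - rewrite sx cards1 /= tE sx; have -> : kitv 1 set0 [set x] = [set [set x]].
      apply/setP => B; rewrite in_set1; apply/kitvP/eqP => [[B1 _ Bx]|->]; last by rewrite cards1 sub0set subxx.
      by apply/eqP; rewrite eqEcard Bx B1 cards1.
    by rewrite fdim_set1.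
have sS (t t' : {set {set 'I_(#|X|)}}) : t \subset ksets #|X| 1 -> t' \subset ksets #|X| 1 -> (supp t \subset supp t') = (t \subset t').
  move=> tV tV'; apply/idP/idP => [h|]; last exact: suppS.
  by rewrite (singletons_supp tV) (singletons_supp tV'); apply: kitvS.
have suppV : supp (ksets #|X| 1) = setT by rewrite VE sE.
have sub' t : t \in pfaces (@indic #|X|) (ksets #|X| 1) -> t \subset ksets #|X| 1.
  by rewrite in_setD1 => /andP[_ /faces_sub].
rewrite /Psi (@psi_iso0 R0 b e _ _ _ (fun Y Z : {set 'I_n} => Y \proper Z) _ (fun W : {set 'I_n} => #|W|.-1)
  (fun t : {set {set 'I_(#|X|)}} => g @: supp t)).
- rewrite dE ?faces_refl // suppV cardsT card_ord; congr (psi _ _ _ _ _ _ _).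
  apply/setP => W; rewrite inE; apply/andP/imsetP => [[W0 WX]|[t]].
    have gW : g @: (g @^-1: W) = W.
      apply/setP => x; apply/imsetP/idP => [[i]|xW]; first by rewrite inE => iW ->.
      have xX := subsetP (proper_sub WX) x xW; exists (enum_rank_in xX x).
        by rewrite inE /g enum_rankK_in.
      by rewrite /g enum_rankK_in.
    have gW0 : g @^-1: W != set0 by apply: contraNneq W0 => h; rewrite -gW h imset0.
    exists (kitv 1 set0 (g @^-1: W)); last by rewrite sE.
    rewrite in_setD1; apply/andP; split; last first.
      apply: itv_face; rewrite kitv_neq0 ?sub0set // cards0 card_gt0 //.
    apply: contraTneq WX => h; rewrite -gW -(sE _ gW0) h suppV gT properxx //.
  move=> tP ->; have /andP[tV tF] : (t != ksets #|X| 1) && (t \in faces (@indic #|X|) (ksets #|X| 1)).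
    by rewrite -in_setD1.
  split; first by have /set0Pn[x xs] := supp0 t tF; apply/set0Pn; exists (g x); apply: imset_f.
  rewrite properEneq gX andbT; apply: contra tV => /eqP h.
  by rewrite eqEsubset (sub' t tP) -(sS _ _ (subxx _) (sub' t tP)) suppV -sub gT h subxx.
- exact: proper_irr.
- exact: proper_irr.
- move=> t t' /sub' tV /sub' tV' /(imset_inj inj_g) h.
  by rewrite (singletons_supp tV) h -singletons_supp.
- by move=> t t' /sub' tV /sub' tV'; rewrite !properE !sub !sS.
- by move=> t; rewrite in_setD1 => /andP[_ tF]; rewrite card_imset // dE.
Qed.

(** The faces above [s] arise by releasing an arbitrary set [W] of fixed coordinates, whether fixed
    to 1 or to 0. Since [#|core s| < k < #|supp s|], every choice gives an interval with exactly
    these free coordinates, so the order is Boolean. *)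
Lemma psi_up_simplex n k s x0 : (0 < k < n)%N -> s \in pfaces (@indic n) (ksets n k) ->
  x0 \in freeset s ->
  psi_up k b e s = Psi b e (@indic (n - #|freeset s|)) (ksets (n - #|freeset s|) 1).
Proof.
move=> /andP[k0 kn]; rewrite in_setD1 => /andP[sV sF] x0s.
pose V := ksets n k; have VE : V = kitv k set0 setT by rewrite kitvT.
have V0 : V != set0 by rewrite VE kitv_neq0 ?sub0set // cards0 cardsT card_ord (ltnW kn).
have coreV : core V = set0 by rewrite VE core_kitv ?sub0set // cards0 cardsT card_ord kn.
have suppV : supp V = setT by rewrite VE supp_kitv ?sub0set // cards0 cardsT card_ord k0 (ltnW kn).
have sVs : s \subset V := faces_sub sF.
have cardS : (n - #|freeset s|)%N = #|~: freeset s|.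
  by have := cardsC (freeset s); rewrite card_ord; lia.
have frS (t : {set {set 'I_n}}) : s \subset t -> freeset s \subset freeset t.
  by move=> st; rewrite setDSS ?coreS ?suppS.
have fr0 (t : {set {set 'I_n}}) : s \subset t -> x0 \in freeset t by move=> st; apply: (subsetP (frS t st)).
have frV : freeset V = setT by rewrite /freeset coreV suppV setD0.
have cs (t : {set {set 'I_n}}) : s \subset t -> core t = core s :\: freeset t /\ supp t = supp s :|: freeset t.
  move=> st; have [B Bs] : exists B, B \in s.
    by move: x0s; rewrite inE => /andP[_ /suppP[B]]; exists B.
  have h1 : core t \subset core s := coreS st.
  have h2 : supp s \subset supp t := suppS st.
  have h3 : core s \subset supp s := subset_trans (core_sub Bs) (supp_sub Bs).
  split; apply/setP => x; rewrite !inE; have := subsetP h1 x; have := subsetP h2 x; have := subsetP h3 x;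
    case: (x \in core t); case: (x \in core s); case: (x \in supp t); case: (x \in supp s);
    move=> h4 h5 h6; first [by [] | by have := h4 isT | by have := h5 isT | by have := h6 isT].
have frE (t t' : {set {set 'I_n}}) : t \in faces (@indic n) V -> t' \in faces (@indic n) V -> s \subset t -> s \subset t' ->
    (freeset t \subset freeset t') = (t \subset t').
  move=> tF tF' st st'; apply/idP/idP => [h|]; last by move=> h; rewrite setDSS ?coreS ?suppS.
  rewrite -(face_hull tF) -(face_hull tF') /hull.
  by have [-> ->] := cs t st; have [-> ->] := cs t' st'; rewrite kitvS ?setDS ?setUS.
have dE (t : {set {set 'I_n}}) : t \in faces (@indic n) V -> s \subset t -> (fdim (@indic n) t).+1 = #|freeset t|.
  by move=> tF st; apply: (fdim_face tF (fr0 t st)).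
have sNV : freeset s != setT.
  apply: contra sV => /eqP h; rewrite eqEsubset sVs -frE ?faces_refl ?subxx //.
  by rewrite frV h subxx.
rewrite cardS -psi_subsets; last first.
  by apply: contra sNV => /eqP h; rewrite -(setCK (freeset s)) h setC0.
have memA (t : {set {set 'I_n}}) : t \in above (fun Y Z : {set {set 'I_n}} => Y \proper Z) (pfaces (@indic n) V) s ->
   [/\ t \in faces (@indic n) V, s \proper t & t \proper V].
  by rewrite inE in_setD1 => /andP[/andP[tV tF] st]; rewrite tF st properEneq tV (faces_sub tF).
have cD (t : {set {set 'I_n}}) : s \subset t -> #|freeset t| = (#|freeset s| + #|freeset t :\: freeset s|)%N.
  by move=> st; rewrite -(cardsID (freeset s)) (setIidPr (frS t st)).
(* A face releasing [W] has dimension [#|freeset s| + (#|W| - 1)]: the ranks of the simplex,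
   translated by [#|freeset s|]. *)
rewrite /psi_up dE // -[#|freeset s|]addn0.
have CS0 : (0 < #|~: freeset s|)%N.
  rewrite card_gt0; apply: contra sNV => /eqP h.
  by rewrite -(setCK (freeset s)) h setC0.
have -> : fdim (@indic n) (ksets n k) = (#|freeset s| + #|~: freeset s|.-1)%N.
  have := dE V (faces_refl _ _) sVs; rewrite frV cardsT card_ord /V => h.
  by have := cardsC (freeset s); rewrite card_ord; clear -h CS0; lia.
have ltS t : t \in above (fun Y Z : {set {set 'I_n}} => Y \proper Z) (pfaces (@indic n) V) s ->
    (#|freeset s| < #|freeset t|)%N.
  move=> /memA[tF st tV]; rewrite -!dE ?subxx ?(proper_sub st) // ltnS.
  exact: fdim_face_lt V0 sF st (proper_sub tV).
rewrite (@psi_iso R0 b e _ _ _ (fun Y Z : {set 'I_n} => Y \proper Z) _ (fun W : {set 'I_n} => #|W|.-1)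
  (fun t : {set {set 'I_n}} => freeset t :\: freeset s)).
- congr (psi _ _ _ _ _ _ _); apply/setP => W; rewrite [RHS]inE; apply/imsetP/andP.
    case=> t tA ->; have [tF st tV] := memA t tA; split.
      by rewrite -card_gt0; have := ltS t tA; rewrite (cD t (proper_sub st)); clear; lia.
    rewrite properEneq setDE subsetIr andbT -setDE; apply: contraTneq tV => h.
    rewrite properE -(frE V t) ?faces_refl ?(proper_sub st) // negb_and negbK; apply/orP; right.
    by rewrite -(setID (freeset t) (freeset s)) (setIidPr (frS t (proper_sub st))) h frV setUCr.
  case=> W0 WS; have [CZ Ck kZ] := core_supp_card sF x0s.
  have sub1 : core s :\: W \subset supp s :|: W.
    by apply: subset_trans (subsetDl _ _) (subset_trans CZ (subsetUl _ _)).
  have C1 : (#|core s :\: W| < k)%N by apply: leq_ltn_trans (subset_leq_card (subsetDl _ _)) Ck.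
  have Z1 : (k < #|supp s :|: W|)%N by apply: leq_trans kZ (subset_leq_card (subsetUl _ _)).
  pose t := kitv k (core s :\: W) (supp s :|: W).
  have ct : core t = core s :\: W by rewrite core_kitv // (ltnW C1) Z1.
  have zt : supp t = supp s :|: W by rewrite supp_kitv // (ltnW Z1) C1.
  have dW x : x \in W -> x \notin freeset s.
    by move=> xW; have := subsetP (proper_sub WS) x xW; rewrite inE.
  have ft : freeset t = freeset s :|: W.
    apply/setP => x; rewrite /freeset ct zt !inE.
    by case: (x \in W); rewrite ?andbT ?orbT ?orbF.
  have ftW : freeset t :\: freeset s = W.
    apply/setP => x; rewrite ft in_setD in_setU; have := dW x.
    by case: (x \in W) => [/(_ isT) ->|_]; rewrite ?orbT // orbF andNb.
  exists t; rewrite ?ftW // inE in_setD1 -andbA; apply/and3P; split.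
  - apply: contraTneq WS => tV; rewrite -ftW tV frV setTD properxx //.
  - by apply: itv_face; rewrite kitv_neq0 // (ltnW C1) (ltnW Z1).
  - rewrite properEneq; apply/andP; split; last first.
      by rewrite -{1}(face_hull sF); apply: kitvS; [exact: subsetDl | exact: subsetUl].
    by apply: contraNneq W0 => st; rewrite -ftW -st setDv.
- exact: proper_irr.
- exact: proper_irr.
- move=> t t' /memA[tF /proper_sub st _] /memA[tF' /proper_sub st' _] h.
  have E : freeset t = freeset t'.
    by rewrite -(setID (freeset t) (freeset s)) -(setID (freeset t') (freeset s)) h !(setIidPr (frS _ _)).
  by apply/eqP; rewrite eqEsubset -(frE t t') // -(frE t' t) // E subxx.
- move=> t t' /memA[tF /proper_sub st _] /memA[tF' /proper_sub st' _].
  have E (u u' : {set {set 'I_n}}) : s \subset u -> s \subset u' ->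
      (freeset u :\: freeset s \subset freeset u' :\: freeset s) = (freeset u \subset freeset u').
    move=> su su'; apply/idP/idP => [h|]; last exact: setSD.
    rewrite -(setID (freeset u) (freeset s)) -(setID (freeset u') (freeset s)).
    by rewrite !(setIidPr (frS _ _)) // setUS.
  by rewrite !properE !E // (frE t t') // (frE t' t).
- move=> t tA; have [tF /proper_sub st _] := memA t tA; have := dE t tF st; rewrite (cD t st).
  have := ltS t tA; rewrite (cD t st); clear; lia.
Qed.
End SimplexIndex.

(** * Counting the exceptional faces *)

Section Count.
Variables (T : finType) (M : zmodType).
Implicit Types (A S X : {set T}).

(** [x.1] holds the coordinates of [X] fixed to 1 and [x.2] the free ones; the number [al] is
    strictly between the extreme numbers of chosen elements. *)
Definition spread X al (x : {set T} * {set T}) :=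
  [&& x.1 \subset X, x.2 \subset X, [disjoint x.1 & x.2], (#|x.1| < al)%N & (al < #|x.1| + #|x.2|)%N].

Lemma card_disjoint_pairs X u i :
  #|[set x : {set T} * {set T} | [&& x.1 \subset X, x.2 \subset X, [disjoint x.1 & x.2],
     #|x.1| == u & #|x.2| == i]]| = ('C(#|X|, i) * 'C(#|X| - i, u))%N.
Proof.
rewrite -sum1_card (eq_bigl (fun x : {set T} * {set T} => ((x.2 \subset X) && (#|x.2| == i)) &&
   ((x.1 \subset X :\: x.2) && (#|x.1| == u)))) => [|[A S] /=]; last first.
  rewrite inE /= subsetD; case: (A \subset X); case: (S \subset X) => //=; rewrite ?andbF //.
  by case: (#|S| == i); rewrite ?andbF // andbT.
rewrite -(pair_big_dep (fun _ => true) (fun A S => ((S \subset X) && (#|S| == i)) &&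
   ((A \subset X :\: S) && (#|A| == u))) (fun _ _ => 1%N)) /=.
rewrite (exchange_big_dep (fun S => (S \subset X) && (#|S| == i))) /=; last by move=> A S _ /andP[].
rewrite -[X in (X * _)%N](cards_draws X i) -sum1_card big_distrl /=.
rewrite [RHS](eq_bigl (fun S => (S \subset X) && (#|S| == i))) => [|S]; last by rewrite inE.
apply: eq_bigr => S /andP[SX /eqP Si].
rewrite mul1n (eq_bigl (fun A => A \in [set A : {set T} | A \subset X :\: S & #|A| == u])); last first.
  by move=> A; rewrite inE SX Si eqxx.
by rewrite sum1_card cards_draws cardsD (setIidPr SX) Si.
Qed.

(** With [p = al - #|x.1|] and [i = #|x.2|] the conditions become [1 <= p <= al] and
    [p < i <= #|X| - al + p]. The binomials choose the free elements and, among the others, the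
    fixed ones. *)
Lemma sum_spread X al (u : nat -> nat -> M) : (al <= #|X|)%N ->
  \sum_(x | spread X al x) u (al - #|x.1|)%N #|x.2| =
  \sum_(p <- iota 1 al) \sum_(i <- iota p.+1 (#|X| - al))
     u p i *+ ('C(#|X|, i) * 'C(#|X| - i, al - p)).
Proof.
move=> alX.
transitivity (\sum_(x | spread X al x) \sum_(p <- iota 1 al) \sum_(i <- iota p.+1 (#|X| - al))
    if ((al - #|x.1|)%N == p) && (#|x.2| == i) then u p i else 0).
  apply: eq_bigr => -[A S] /and5P[/= AX SX dAS Aal alAS].
  have cU : (#|A| + #|S| <= #|X|)%N.
    by move: dAS; rewrite -leq_card_setU => /eqP <-; rewrite subset_leq_card // subUset AX.
  have Ap : (al - #|A|)%N \in iota 1 al by rewrite mem_iota; clear -Aal; lia.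
  have Si : #|S| \in iota (al - #|A|).+1 (#|X| - al) by rewrite mem_iota; clear -Aal alAS cU alX; lia.
  rewrite (bigD1_seq _ Ap (iota_uniq _ _)) (bigD1_seq _ Si (iota_uniq _ _)) /=.
  rewrite !eqxx /= big1 => [|i /negbTE iS]; last by rewrite eq_sym iS.
  rewrite big1 ?addr0 // => p /negbTE pA; rewrite big1 // => i _.
  by rewrite eq_sym pA.
rewrite exchange_big /=; rewrite big_seq [RHS]big_seq; apply: eq_bigr => p; rewrite mem_iota => pal.
rewrite exchange_big /=; rewrite big_seq [RHS]big_seq; apply: eq_bigr => i; rewrite mem_iota => ip.
rewrite -big_mkcondr /= sumr_const -card_disjoint_pairs; congr (_ *+ _).
rewrite -[RHS]cardsE; rewrite cardsE; apply: eq_card => -[A S]; rewrite !inE /spread /=.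
rewrite unfold_in /= -!andbA.
do 3 congr (_ && _); clear -pal ip alX; apply/idP/idP.
  by move=> /and4P[h1 h2 /eqP h3 /eqP h4]; apply/andP; split; apply/eqP; lia.
by move=> /andP[/eqP h3 /eqP h4]; apply/and4P; split; lia.
Qed.
End Count.

Definition ecd (phi : ncpoly cdL) : abring := evab (cd_to_ab phi).

Lemma ecdE phi : ecd phi = ev (fun x => evab (cd_letter_to_ab x)) phi.
Proof. by rewrite /ecd /evab ev_cd_to_ab. Qed.

(** * The doubled faces of a given modular pair *)

Section PairFaces.
Variables (n k : nat) (R : {set {set 'I_n}}) (r : {set 'I_n} -> nat).
Implicit Types (A B C F G J : {set 'I_n}) (s : {set {set 'I_n}}).
Local Notation ind := (@indic n).
Local Notation V := (ksets n k).
Local Notation cut := (@cut n r).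
Local Notation dbl := (@dbl n k R r).
Local Notation P := (pfaces ind V).

(** The core of such a face contains [F :&: G] and its support lies in [F :|: G], so the fixed and
    free elements in the two differences determine it. *)
Definition code F G s := ((core s :&: (F :\: G), freeset s :&: (F :\: G)),
                          (core s :&: (G :\: F), freeset s :&: (G :\: F))).
Definition decode F G (x : ({set 'I_n} * {set 'I_n}) * ({set 'I_n} * {set 'I_n})) :=
  let A := F :&: G :|: x.1.1 :|: x.2.1 in kitv k A (A :|: x.1.2 :|: x.2.2).

Lemma spread_cut F G s : (#|F :&: G| <= r F)%N -> {in s, forall B, F :&: G \subset B} -> cut F s ->
  spread (F :\: G) (r F - #|F :&: G|) (core s :&: (F :\: G), freeset s :&: (F :\: G)).
Proof.
move=> lF IB /cutP[[B1 B1s h1] [B2 B2s h2]].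
have cE B : B \in s -> #|B :&: F| = (#|F :&: G| + #|B :&: (F :\: G)|)%N.
  move=> Bs; rewrite -(cardsID G (B :&: F)) -setIDA -setIA; congr (_ + _)%N.
  by congr #|pred_of_set _|; apply/setIidPr/IB.
have dCS : [disjoint core s :&: (F :\: G) & freeset s :&: (F :\: G)].
  rewrite -setI_eq0; apply/eqP/setP => x; rewrite /freeset !in_setI !in_setD in_set0.
  by case: (x \in core s); rewrite ?andbF.
apply/and5P; split; rewrite ?subsetIr //=.
  apply: leq_ltn_trans (subset_leq_card (setSI _ (core_sub B1s))) _.
  by rewrite ltn_subRL -cE.
move: dCS; rewrite -leq_card_setU => /eqP <-.
apply: leq_trans (subset_leq_card (_ : B2 :&: (F :\: G) \subset _)).
  by rewrite ltn_subLR // -cE.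
apply/subsetP => x; rewrite in_setU !in_setI => /andP[xB ->].
by rewrite !andbT /freeset in_setD (subsetP (supp_sub B2s)) // andbT orbN.
Qed.

Section Pair.
Variables (F G : {set 'I_n}).
Hypotheses (FR : F \in R) (GR : G \in R) (FG : F != G).
Hypothesis mod : (#|F :&: G| + k = r F + r G)%N.
Hypotheses (lF : (#|F :&: G| <= r F)%N) (lG : (#|F :&: G| <= r G)%N).
Hypothesis pairR : {in R &, forall F G, F != G -> #|F :&: G| + k <= r F + r G}%N.
Hypothesis ndV : ~~ dbl V.
Hypothesis kn : (0 < k < n)%N.
Local Notation al := (r F - #|F :&: G|)%N.
Local Notation be := (r G - #|F :&: G|)%N.

Lemma codeP s : s \in P -> dbl s -> cut F s -> cut G s ->
  [/\ spread (F :\: G) al (code F G s).1, spread (G :\: F) be (code F G s).2 &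
      decode F G (code F G s) = s].
Proof.
move=> sP ds cF cG; have sF := P_face sP.
have [F' [G' [_ _ _ _ [H _ cE _]]]] := dbl_pair pairR sF ds.
have IB : {in s, forall B, F :&: G \subset B /\ B \subset F :|: G}.
  have := cE F FR; have := cE G GR; rewrite cF cG !inE => /esym hG /esym hF.
  case/orP: hF hG => /eqP EF /orP[] /eqP EG; move: FG; rewrite EF EG ?eqxx // => _ B Bs.
  by rewrite (setIC G') (setUC G'); apply: H.
split.
- by apply: spread_cut => // B /IB[].
- by rewrite (setIC F G); apply: spread_cut; rewrite 1?setIC // => B /IB[].
have IC : F :&: G \subset core s by apply/bigcapsP => B /IB[].
have ZU : supp s \subset F :|: G by apply/bigcupsP => B /IB[].
have CZ : core s \subset supp s.
  have V0 : V != set0.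
    have [k0 kn'] := andP kn; have [|J [_ _ Jk]] := subset_between (sub0set [set: 'I_n]) (m := k).
      by rewrite cards0 cardsT card_ord (ltnW kn').
    by apply/set0Pn; exists J; apply/ksetsP.
  have /set0Pn[B Bs] := faces_neq0 V0 sF.
  exact: subset_trans (core_sub Bs) (supp_sub Bs).
have pt x : [&& (x \in F) && (x \in G) ==> (x \in core s), (x \in core s) ==> (x \in supp s) &
    (x \in supp s) ==> (x \in F) || (x \in G)].
  apply/and3P; split; apply/implyP.
  - by move=> h; apply: (subsetP IC); rewrite inE.
  - exact: (subsetP CZ).
  - by move/(subsetP ZU); rewrite inE.
rewrite -[RHS](face_hull sF) /hull /decode /=.
have AE : F :&: G :|: core s :&: (F :\: G) :|: core s :&: (G :\: F) = core s.
  apply/setP => x; have := pt x; rewrite !in_setU !in_setI !in_setD.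
  by case: (x \in F); case: (x \in G); case: (x \in core s); case: (x \in supp s).
rewrite AE; congr (kitv k _ _); apply/setP => x; have := pt x.
rewrite /freeset !in_setU !in_setI !in_setD.
by case: (x \in F); case: (x \in G); case: (x \in core s); case: (x \in supp s).
Qed.

Section Decode.
Variable x : ({set 'I_n} * {set 'I_n}) * ({set 'I_n} * {set 'I_n}).
Hypotheses (x1 : spread (F :\: G) al x.1) (x2 : spread (G :\: F) be x.2).
Local Notation A1 := x.1.1.
Local Notation S1 := x.1.2.
Local Notation A2 := x.2.1.
Local Notation S2 := x.2.2.
Local Notation A := (F :&: G :|: A1 :|: A2).
Local Notation Z := (A :|: S1 :|: S2).
Local Notation s := (decode F G x).

Lemma decode_pt y : [&& (y \in A1) ==> (y \in F) && (y \notin G), (y \in S1) ==> (y \in F) && (y \notin G),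
  (y \in A2) ==> (y \notin F) && (y \in G), (y \in S2) ==> (y \notin F) && (y \in G),
  ~~ ((y \in A1) && (y \in S1)) & ~~ ((y \in A2) && (y \in S2))].
Proof.
case/and5P: x1 => a1 s1 d1 _ _; case/and5P: x2 => a2 s2 d2 _ _.
have dis (C D : {set 'I_n}) : [disjoint C & D] -> ~~ ((y \in C) && (y \in D)).
  by move=> d; apply/negP => /andP[yC]; rewrite (disjointFr d yC).
rewrite !dis // !andbT; apply/and4P; split; apply/implyP.
- by move/(subsetP a1); rewrite inE andbC.
- by move/(subsetP s1); rewrite inE andbC.
- by move/(subsetP a2); rewrite inE.
- by move/(subsetP s2); rewrite inE.
Qed.

Local Ltac pointwise y := have := decode_pt y; rewrite ?(in_setU, in_setI, in_setD, in_set0);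
  case: (y \in F); case: (y \in G); case: (y \in A1); case: (y \in S1); case: (y \in A2);
  case: (y \in S2); rewrite ?andbF ?andbT ?orbF ?orbT //=.

Lemma decode_card B : A \subset B -> B \subset Z ->
  [/\ #|B| = (#|F :&: G| + #|A1| + #|A2| + #|B :&: S1| + #|B :&: S2|)%N,
      #|B :&: F| = (#|F :&: G| + #|A1| + #|B :&: S1|)%N &
      #|B :&: G| = (#|F :&: G| + #|A2| + #|B :&: S2|)%N].
Proof.
move=> AB BZ.
have E1 : B :&: F = F :&: G :|: A1 :|: B :&: S1.
  apply/setP => y; have := subsetP AB y; have := subsetP BZ y.
  rewrite ?(in_setU, in_setI); case: (y \in B); pointwise y => _ h1 h2;
    by [have := h1 isT | have := h2 isT].
have E2 : B :&: G = F :&: G :|: A2 :|: B :&: S2.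
  apply/setP => y; have := subsetP AB y; have := subsetP BZ y.
  rewrite ?(in_setU, in_setI); case: (y \in B); pointwise y => _ h1 h2;
    by [have := h1 isT | have := h2 isT].
have c3 (C D E : {set 'I_n}) : [disjoint C & D] -> [disjoint C & E] -> [disjoint D & E] ->
    #|C :|: D :|: E| = (#|C| + #|D| + #|E|)%N.
  by move=> d1 d2 d3; rewrite !cardsU setIUl !disjoint_setI0 // setU0 !cards0 !subn0.
have h1 : #|B :&: F| = (#|F :&: G| + #|A1| + #|B :&: S1|)%N.
  rewrite E1 c3 //; rewrite -setI_eq0; apply/eqP/setP => y; pointwise y.
have h2 : #|B :&: G| = (#|F :&: G| + #|A2| + #|B :&: S2|)%N.
  rewrite E2 c3 //; rewrite -setI_eq0; apply/eqP/setP => y; pointwise y.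
split=> //.
have BU : B \subset F :|: G.
  by apply/subsetP => y /(subsetP BZ); pointwise y.
have IB : F :&: G \subset B.
  by apply: subset_trans AB; rewrite -setUA subsetUl.
have := cardsUI (B :&: F) (B :&: G); rewrite -setIUr -setIIr (setIidPl BU) (setIidPr IB) h1 h2.
by clear; lia.
Qed.

Lemma decode_sub : A \subset Z. Proof. by rewrite -(setUA A) subsetUl. Qed.

Lemma decode_rank : [/\ #|A| = (#|F :&: G| + #|A1| + #|A2|)%N, (#|A| < k)%N,
  #|Z| = (#|A| + #|S1| + #|S2|)%N & (k < #|Z|)%N].
Proof.
case/and5P: x1 => _ _ _ h1 h2; case/and5P: x2 => _ _ _ h3 h4.
have AZ := decode_sub.
have [hA _ _] := decode_card (subxx _) AZ; have [hZ _ _] := decode_card AZ (subxx _).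
have E1 : A :&: S1 = set0 by apply/setP => y; pointwise y.
have E2 : A :&: S2 = set0 by apply/setP => y; pointwise y.
have E3 : Z :&: S1 = S1 by apply/setIidPr; rewrite setUAC subsetUr.
have E4 : Z :&: S2 = S2 by apply/setIidPr; rewrite subsetUr.
rewrite E1 E2 cards0 !addn0 in hA; rewrite E3 E4 -hA in hZ.
by split=> //; rewrite ?hZ hA; clear -h1 h2 h3 h4 mod lF lG; lia.
Qed.

Lemma decode_core : core s = A /\ supp s = Z.
Proof.
have [_ h1 _ h2] := decode_rank; rewrite /decode /=.
by rewrite core_kitv ?supp_kitv ?decode_sub // ?h1 ?h2 (ltnW h1, ltnW h2) ?(ltnW h2).
Qed.

Lemma decodeK : code F G s = x.
Proof.
have [cE sE] := decode_core; rewrite /code /freeset cE sE.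
rewrite [RHS]surjective_pairing [X in (X, _) = _]surjective_pairing.
rewrite [x.1]surjective_pairing [x.2]surjective_pairing /=.
by congr ((_, _), (_, _)); apply/setP => y; pointwise y.
Qed.

Lemma decode_freeset : freeset s = S1 :|: S2.
Proof.
by have [cE sE] := decode_core; rewrite /freeset cE sE; apply/setP => y; pointwise y.
Qed.

Lemma decode_face : s \in faces ind V.
Proof.
have [_ h1 _ h2] := decode_rank; apply: itv_face.
by apply: kitv_neq0; rewrite ?decode_sub // (ltnW h1) (ltnW h2).
Qed.

Lemma decode_exists j1 j2 : (#|A1| <= j1 <= #|A1| + #|S1|)%N -> (#|A2| <= j2 <= #|A2| + #|S2|)%N ->
  (j1 + j2 = al + be)%N ->
  exists2 B, B \in s & #|B :&: F| = (#|F :&: G| + j1)%N /\ #|B :&: G| = (#|F :&: G| + j2)%N.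
Proof.
move=> h1 h2 h3.
have [|J1 [_ J1S J1c]] := subset_between (sub0set S1) (m := (j1 - #|A1|)%N).
  by rewrite cards0; clear -h1; lia.
have [|J2 [_ J2S J2c]] := subset_between (sub0set S2) (m := (j2 - #|A2|)%N).
  by rewrite cards0; clear -h2; lia.
pose B := A :|: J1 :|: J2.
have AB : A \subset B by rewrite /B -(setUA A) subsetUl.
have BZ : B \subset Z by rewrite setUSS // setUSS.
have [hB hF hG] := decode_card AB BZ.
have E1 : B :&: S1 = J1.
  apply/setP => y; have := subsetP J1S y; have := subsetP J2S y.
  rewrite /B 2!inE [y \in _ :|: J1]inE.
  case: (y \in J1); case: (y \in J2); pointwise y => _ h5 h6;
    by [have := h5 isT | have := h6 isT].
have E2 : B :&: S2 = J2.
  apply/setP => y; have := subsetP J1S y; have := subsetP J2S y.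
  rewrite /B 2!inE [y \in _ :|: J1]inE.
  case: (y \in J1); case: (y \in J2); pointwise y => _ h5 h6;
    by [have := h5 isT | have := h6 isT].
rewrite E1 E2 in hB hF hG.
exists B; last by split; rewrite ?hF ?hG; clear -h1 h2 J1c J2c; lia.
by apply/kitvP; split=> //; rewrite hB; clear -h1 h2 h3 J1c J2c mod lF lG; lia.
Qed.

Lemma decode_cut : cut F s /\ cut G s.
Proof.
case/and5P: x1 => _ _ _ h1 h2; case/and5P: x2 => _ _ _ h3 h4.
(* Trading one element between the two differences keeps the size [k] and leaves both hyperplanes,
   towards opposite sides. *)
have [|||B Bs [BF BG]] := @decode_exists al.-1 be.+1; try by clear -h1 h2 h3 h4; lia.
have [|||C Cs [CF CG]] := @decode_exists al.+1 be.-1; try by clear -h1 h2 h3 h4; lia.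
by split; apply/cutP; split; [exists B|exists C|exists C|exists B]; rewrite ?BF ?BG ?CF ?CG //;
  clear -h1 h2 h3 h4; lia.
Qed.

Lemma decode_dbl : dbl s.
Proof.
apply/exists_inP; exists F => //; have [cF cG] := decode_cut; rewrite cF /=.
apply: (pair_dbl FR GR decode_face cF mod) => B /kitvP[_ AB BZ]; split.
  by apply: subset_trans AB; rewrite -setUA subsetUl.
by apply/subsetP => y /(subsetP BZ); pointwise y.
Qed.

Lemma decode_P : s \in P.
Proof. exact (dbl_P ndV decode_face decode_dbl). Qed.

(** A vertex of the trace has [al] elements in [F :\: G] and [be] in [G :\: F]; discounting the
    fixed ones leaves the parameters of the two hypersimplices. *)
Lemma decode_Psi (R0 : pzRingType) (b e : R0) : Psi b e ind (s :&: cutQ k R r) =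
  Psi b e (prod_pts (hyp_pts (al - #|A1|) #|S1|) (hyp_pts (be - #|A2|) #|S2|)) setT.
Proof.
have [cF _] := decode_cut; rewrite (dbl_trace pairR decode_face decode_dbl FR cF).
case/and5P: x1 => _ _ _ h1 h2; case/and5P: x2 => _ _ _ h3 h4.
rewrite (@Psi_prod _ b e _ A S1 S2); first last.
- by rewrite -setI_eq0; apply/eqP/setP => y; pointwise y.
- by rewrite -setI_eq0; apply/eqP/setP => y; pointwise y.
- by rewrite -setI_eq0; apply/eqP/setP => y; pointwise y.
congr (Psi _ _ _ _); apply/setP => B; rewrite traceP [RHS]inE.
have [hA _ _ _] := decode_rank.
apply/andP/and4P => [[/kitvP[Bk AB BZ] /eqP BF]|[AB BZ /eqP B1 /eqP B2]].
  have [E1 E2 E3] := decode_card AB BZ; rewrite Bk in E1.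
  by split=> //; apply/eqP; clear -E1 E2 E3 BF mod lF lG h1 h3; lia.
have [E1 E2 E3] := decode_card AB BZ; rewrite B1 B2 in E1 E2 E3.
split; last by rewrite E2; apply/eqP; clear -h1 h3 lF lG; lia.
by apply/kitvP; split=> //; rewrite E1; clear -h1 h3 lF lG mod; lia.
Qed.

Lemma decode_up (R0 : pzRingType) (b e : R0) :
  psi_up k b e s = Psi b e (@indic (n - #|S1| - #|S2|)) (ksets (n - #|S1| - #|S2|) 1).
Proof.
case/and5P: x1 => _ _ d1 h1 h2.
have /card_gt0P[y yS] : (0 < #|S1|)%N by clear -h1 h2; lia.
rewrite (psi_up_simplex _ _ (x0 := y)) ?decode_P //; last first.
  by rewrite decode_freeset inE yS.
rewrite decode_freeset; suff -> : (n - #|S1 :|: S2|)%N = (n - #|S1| - #|S2|)%N by [].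
rewrite cardsU; have -> : S1 :&: S2 = set0 by apply/setP => z; pointwise z.
by rewrite cards0 subn0 subnDA.
Qed.

End Decode.

End Pair.

End PairFaces.

Section PairSum.
Variables (R0 : pzRingType) (b e : R0) (n k : nat) (R : {set {set 'I_n}}) (r : {set 'I_n} -> nat).
Variables (F G : {set 'I_n}).
Hypotheses (FR : F \in R) (GR : G \in R) (FG : F != G).
Hypothesis mod : (#|F :&: G| + k = r F + r G)%N.
Hypotheses (lF : (#|F :&: G| <= r F <= #|F|)%N) (lG : (#|F :&: G| <= r G <= #|G|)%N).
Hypothesis pairR : {in R &, forall F G, F != G -> #|F :&: G| + k <= r F + r G}%N.
Hypothesis ndV : ~~ dbl k R r (ksets n k).
Hypothesis kn : (0 < k < n)%N.
Local Notation al := (r F - #|F :&: G|)%N.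
Local Notation be := (r G - #|F :&: G|)%N.
Local Notation ind := (@indic n).

Definition pair_term (d : R0) p i q j := Psi b e (prod_pts (hyp_pts p i) (hyp_pts q j)) setT * d *
  Psi b e (hyp_pts 1 (n - i - j)) setT.

(** The codes range over a product, so [sum_spread] applies to each difference separately. *)
Lemma sum_pair (d : R0) :
  \sum_(s in pfaces ind (ksets n k) | [&& dbl k R r s, cut r F s & cut r G s])
     Psi b e ind (s :&: cutQ k R r) * d * psi_up k b e s =
  \sum_(p <- iota 1 al) \sum_(q <- iota 1 be) \sum_(i <- iota p.+1 (#|F :\: G| - al))
    \sum_(j <- iota q.+1 (#|G :\: F| - be)) pair_term d p i q j *+
      ('C(#|F :\: G|, i) * 'C(#|G :\: F|, j) * 'C(#|F :\: G| - i, al - p) * 'C(#|G :\: F| - j, be - q)).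
Proof.
have [lF1 lF2] := andP lF; have [lG1 lG2] := andP lG.
have alX : (al <= #|F :\: G|)%N by have := cardsID G F; clear -lF1 lF2; lia.
have beY : (be <= #|G :\: F|)%N by have := cardsID F G; rewrite setIC; clear -lG1 lG2; lia.
rewrite (reindex_onto (decode k F G) (code F G)) /=; last first.
  by move=> s /andP[sP /and3P[ds cF cG]]; case: (codeP FR GR FG lF1 lG1 pairR kn sP ds cF cG).
transitivity (\sum_(x1 | spread (F :\: G) al x1) \sum_(x2 | spread (G :\: F) be x2)
   pair_term d (al - #|x1.1|) #|x1.2| (be - #|x2.1|) #|x2.2|).
  rewrite pair_big /=; apply: eq_big => [x|x /andP[/andP[xP /and3P[xd xF xG]] /eqP xK]].
    apply/andP/andP => [[/andP[xP /and3P[xd xF xG]] /eqP xK]|[x1 x2]].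
      by have [h1 h2 _] := codeP FR GR FG lF1 lG1 pairR kn xP xd xF xG; rewrite xK in h1 h2.
    have xd := decode_dbl FR GR mod lF1 lG1 x1 x2.
    have [cF cG] := decode_cut mod lF1 lG1 x1 x2.
    by rewrite (decode_P FR GR mod lF1 lG1 ndV x1 x2) xd cF cG (decodeK mod lF1 lG1 x1 x2).
  have [x1 x2 _] := codeP FR GR FG lF1 lG1 pairR kn xP xd xF xG; rewrite xK in x1 x2.
  rewrite (decode_Psi FR GR mod lF1 lG1 pairR x1 x2) (decode_up FR GR mod lF1 lG1 ndV kn x1 x2).
  rewrite /pair_term; congr (_ * _ * _); apply/esym; apply: Psi_sig => B.
  by rewrite inE.
transitivity (\sum_(x1 | spread (F :\: G) al x1) \sum_(q <- iota 1 be)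
    \sum_(j <- iota q.+1 (#|G :\: F| - be)) pair_term d (al - #|x1.1|) #|x1.2| q j *+
      ('C(#|G :\: F|, j) * 'C(#|G :\: F| - j, be - q))).
  by apply: eq_bigr => x1 _; apply: sum_spread beY.
rewrite (sum_spread (fun p i => \sum_(q <- iota 1 be)
    \sum_(j <- iota q.+1 (#|G :\: F| - be)) pair_term d p i q j *+
      ('C(#|G :\: F|, j) * 'C(#|G :\: F| - j, be - q))) alX).
apply: eq_bigr => p _ /=; under eq_bigr => i _ do rewrite -sumrMnl.
rewrite exchange_big; apply: eq_bigr => q _; apply: eq_bigr => i _; rewrite -sumrMnl.
apply: eq_bigr => j _; rewrite -mulrnA; congr (_ *+ _).
by rewrite mulnC -!mulnA; congr (_ * _)%N; rewrite mulnCA.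
Qed.
End PairSum.

Lemma ecd_W n al be a b : ecd (Wterm n al be a b) =
  \sum_(p <- iota 1 al) \sum_(q <- iota 1 be) \sum_(i <- iota p.+1 (a - al))
    \sum_(j <- iota q.+1 (b - be)) pair_term bb (aa - bb) n (aa * bb + bb * aa) p i q j *+
      ('C(a, i) * 'C(b, j) * 'C(a - i, al - p) * 'C(b - j, be - q)).
Proof.
rewrite ecdE ev_sum big_map; apply: eq_bigr => p _.
rewrite ev_sum big_map; apply: eq_bigr => q _.
rewrite ev_sum big_map; apply: eq_bigr => i _.
rewrite ev_sum big_map; apply: eq_bigr => j _.
rewrite ev_scale ev_prod !big_cons big_nil mulr1 ev_letter -!ecdE /ecd !evab_Psi_cd mulrA pmulrn.
by rewrite /pair_term /PsiA /cd_letter_to_ab /evab ev_add !ev_mul !ev_letter.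
Qed.

(** * Grouping sums by parameters *)

Section SeqPartition.
Variable M : zmodType.

Lemma sum_seq_pick (I : eqType) (s : seq I) (i0 : I) (c : pred I) (v : I -> M) :
  uniq s -> i0 \in s ->
  \sum_(i <- s) (if (i == i0) && c i then v i else 0) = if c i0 then v i0 else 0.
Proof.
move=> us i0s; rewrite (bigD1_seq i0) //= eqxx /= big1 ?addr0 // => i /negbTE ->.
by [].
Qed.

Lemma partition_seq (I : finType) (J : eqType) (P : pred I) (f : I -> J) (s : seq J) (F : I -> M) :
  uniq s -> (forall i, P i -> f i \in s) ->
  \sum_(i | P i) F i = \sum_(j <- s) \sum_(i | P i && (f i == j)) F i.
Proof.
move=> us fs; under [RHS]eq_bigr => j _ do rewrite big_mkcondr.
rewrite exchange_big /=; apply: eq_bigr => i Pi.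
rewrite -[LHS](sum_seq_pick predT (fun _ => F i) us (fs i Pi)) /=.
by apply: eq_bigr => j _; rewrite andbT eq_sym.
Qed.

Lemma sum_by_params (I : finType) (P : pred I) (f g : I -> nat) n (u : nat -> nat -> M) :
  (forall i, P i -> 0 < f i < g i /\ g i < n)%N ->
  \sum_(i | P i) u (f i) (g i) = \sum_(r <- iota 0 n) \sum_(h <- iota 0 n)
    if (0 < r < h)%N then u r h *+ #|[set i | [&& P i, f i == r & g i == h]]| else 0.
Proof.
move=> H; rewrite (partition_seq (f := f) _ (iota_uniq 0 n)) => [|i /H[/andP[_ h1] h2]]; last first.
  by rewrite mem_iota add0n (ltn_trans h1 h2).
apply: eq_bigr => r _; rewrite (partition_seq (f := g) _ (iota_uniq 0 n)) => [|i /andP[/H[_ h2] _]]; last first.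
  by rewrite mem_iota.
apply: eq_bigr => h _.
rewrite (eq_bigr (fun=> u r h)) => [|i /andP[/andP[_ /eqP ->] /eqP ->]] //.
rewrite sumr_const; case: ifP => [_|rh].
  by congr (_ *+ _); apply: eq_card => i; rewrite inE unfold_in /= andbA.
rewrite eq_card0 // => i; apply/negP; rewrite unfold_in /= => /andP[/andP[/H[h1 _] /eqP E1] /eqP E2].
by rewrite E1 E2 rh in h1.
Qed.
End SeqPartition.

(** * Split matroids as cut hypersimplices *)

Section SplitIndex.
Variables (n k : nat) (Bs : {set {set 'I_n}}).
Hypotheses (matB : is_matroid Bs) (rkB : has_rank Bs k) (splitB : split_matroid Bs k).
Implicit Types (A B F G X : {set 'I_n}) (s : {set {set 'I_n}}).
Local Notation r := (rk Bs).
Local Notation R := (relaxed k Bs).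
Local Notation ind := (@indic n).
Local Notation V := (ksets n k).

Lemma relaxed_bounds F : F \in R -> [/\ (0 < r F)%N, (r F < #|F|)%N, (r F < k)%N,
  (#|F| < n)%N & (k - r F < n - #|F|)%N].
Proof.
move=> sF; have [h1 h2] := relaxed_rk sF; have h3 := relaxed_rk_gt0 matB rkB splitB sF.
have h4 := relaxed_contr_card matB rkB splitB sF; have h5 := cardsC F; rewrite card_ord in h5.
by split=> //; clear -h2 h4 h5; lia.
Qed.

Lemma relaxed_kn F : F \in R -> (0 < k < n)%N.
Proof. by case/relaxed_bounds; clear; lia. Qed.

Lemma relaxed_pairR : {in R &, forall F G, F != G -> #|F :&: G| + k <= r F + r G}%N.
Proof. by move=> F G FR GR FG; case: (relaxed_pair matB rkB splitB FR GR FG). Qed.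

Lemma ksets_neq0 : V != set0.
Proof.
case: matB => /set0Pn[B BB] _; apply/set0Pn; exists B; apply/ksetsP; exact: rkB.
Qed.

Lemma split_cutQ : Bs = cutQ k R r.
Proof. by apply/setP => B; rewrite (bases_relaxed rkB splitB) 2!inE. Qed.

Lemma exists_inter F j1 j2 : (j1 <= #|F|)%N -> (j2 <= #|~: F|)%N ->
  exists B : {set 'I_n}, #|B| = (j1 + j2)%N /\ #|B :&: F| = j1.
Proof.
move=> h1 h2.
have [|J1 [_ J1F J1c]] := subset_between (sub0set F) (m := j1); first by rewrite cards0.
have [|J2 [_ J2F J2c]] := subset_between (sub0set (~: F)) (m := j2); first by rewrite cards0.
exists (J1 :|: J2); have E : (J1 :|: J2) :&: F = J1.
  rewrite setIUl (setIidPl J1F); apply/setUidPl/subsetP => y; rewrite inE => /andP[/(subsetP J2F)].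
  by rewrite inE => /negbTE ->.
split; last by rewrite E.
rewrite -(cardsID F) E J1c; congr (_ + _)%N; rewrite -J2c; congr #|pred_of_set _|.
apply/setP => y; rewrite in_setD in_setU; case: (boolP (y \in F)) => yF /=.
  by apply/esym/negbTE; apply: contraL yF => /(subsetP J2F); rewrite inE.
by case: (boolP (y \in J1)) => //= /(subsetP J1F); rewrite (negbTE yF).
Qed.

(** The strict bounds from connectedness leave room for [k]-sets with [rk F - 1] and with [rk F + 1]
    elements in [F]. *)
Lemma relaxed_cut : {in R, forall F, cut r F V}.
Proof.
move=> F FR; have [h1 h2 h3 h4 h5] := relaxed_bounds FR.
have cF := cardsC F; rewrite card_ord in cF.
have [||B [Bk BF]] := @exists_inter F (r F).-1 (k - r F).+1; try by clear -h1 h2 h3 h4 h5 cF; lia.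
have [||C [Ck CF]] := @exists_inter F (r F).+1 (k - r F).-1; try by clear -h1 h2 h3 h4 h5 cF; lia.
apply/cutP; split; [exists B|exists C]; try apply/ksetsP; rewrite ?BF ?CF ?Bk ?Ck;
  by clear -h1 h3; lia.
Qed.

(** The intersection of [F] with its partner would lie in all [k]-sets and the union would contain
    them all, so the two flats would be complementary, against connectedness. *)
Lemma ksets_not_dbl : ~~ dbl k R r V.
Proof.
apply/negP => /exists_inP[F FR /andP[cF sub]]; have /andP[k0 kn] := relaxed_kn FR.
have [G [GR GF mod H]] := dbl_partner relaxed_pairR FR (faces_refl _ _) cF sub.
have ex x (b : bool) : exists2 B, B \in V & (x \in B) = b.
  case: b.
    have [|B [xB _ Bk]] := subset_between (subsetT [set x]) (m := k).
      by rewrite cards1 cardsT card_ord k0 (ltnW kn).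
    by exists B; [apply/ksetsP | rewrite -sub1set].
  have [|B [_ Bx Bk]] := subset_between (sub0set [set~ x]) (m := k).
    by rewrite cards0 cardsC1 card_ord; clear -kn; lia.
  exists B; first exact/ksetsP; apply/negP => /(subsetP Bx).
  by rewrite !inE eqxx.
have U : F :|: G = setT.
  apply/setP => x; rewrite in_setT; have [B BV xB] := ex x true.
  by have [_ h] := H B BV; apply: (subsetP h).
have FG : F != G by rewrite eq_sym.
have /set0Pn[x xI] := modular_not_compl matB rkB splitB FR GR FG mod U.
have [B BV] := ex x false; have [h _] := H B BV.
by rewrite (subsetP h).
Qed.

Definition modpairs al be a b := [set X : {set {set 'I_n}} | [exists F, exists G,
  [&& X == [set F; G], F != G, pne_cyclic_flat Bs F, pne_cyclic_flat Bs G,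
      modular Bs F G & pair_params Bs F G == (al, be, a, b)]]].

Lemma modpairsP al be a b (X : {set {set 'I_n}}) : reflect (exists F G,
    [/\ X = [set F; G], F \in R, G \in R, F != G & (#|F :&: G| + k = r F + r G)%N /\
     [/\ al = (r F - #|F :&: G|)%N, be = (r G - #|F :&: G|)%N, a = #|F :\: G| & b = #|G :\: F|]])
  (X \in modpairs al be a b).
Proof.
rewrite inE; apply: (iffP existsP) => -[F].
  case/existsP => G /and5P[/eqP -> FG FR GR /andP[mod par]].
  rewrite !(pne_cyclic_flatE matB rkB splitB) in FR GR; exists F, G.
  rewrite (modularE matB rkB splitB FR GR FG) in mod; have [E _ _] := relaxed_pair matB rkB splitB FR GR FG.
  split=> //; split; first exact/eqP.
  by move/eqP: par; rewrite /pair_params E => -[-> -> -> ->].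
case=> G [-> FR GR FG [mod [-> -> -> ->]]]; exists F; apply/existsP; exists G.
have [E _ _] := relaxed_pair matB rkB splitB FR GR FG.
rewrite eqxx FG !(pne_cyclic_flatE matB rkB splitB) FR GR (modularE matB rkB splitB FR GR FG) mod eqxx.
by rewrite /pair_params E eqxx.
Qed.

Definition cutters s := [set F in R | cut r F s].

Definition ordered_params al be a b :=
  [&& (0 < al < a)%N, (0 < be < b)%N & ((al < be)%N || ((al == be) && (a <= b)%N))].

Lemma cutters_pair s F G : s \in pfaces ind V -> dbl k R r s -> F \in R -> G \in R -> F != G ->
  (cutters s == [set F; G]) = cut r F s && cut r G s.
Proof.
move=> sP ds FR GR FG; apply/eqP/andP => [E|[cF cG]].
  have : F \in cutters s by rewrite E set21.
  have : G \in cutters s by rewrite E set22.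
  by rewrite ![_ \in cutters s]inE => /andP[_ ->] /andP[_ ->].
have [F' [G' [F'R G'R FG' _ [_ _ cE _]]]] := dbl_pair relaxed_pairR (P_face sP) ds.
have E : cutters s = [set F'; G'].
  apply/setP => H; rewrite [LHS]inE; case: (boolP (H \in R)) => HR; first by rewrite cE.
  by apply/esym/negbTE; apply: contraNN HR; rewrite in_set2 => /orP[]/eqP ->.
apply/esym/eqP; rewrite eqEcard E !cards2 FG FG' andbT -E.
by apply/subsetP => H; rewrite in_set2 => /orP[]/eqP ->; rewrite /cutters inE ?FR ?GR.
Qed.

(** [modpairs] admits a pair in either order; the lexicographic condition selects one order, and if
    it allows both then the parameters coincide. So each doubled face belongs to exactly one
    parameter vector. *)
Lemma cutters_params s : s \in pfaces ind V -> dbl k R r s -> exists al be a b,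
  [/\ (al < n)%N, (be < n)%N, (a < n)%N & (b < n)%N] /\ forall al' be' a' b',
  ordered_params al' be' a' b' && (cutters s \in modpairs al' be' a' b') =
  [&& al' == al, be' == be, a' == a & b' == b].
Proof.
move=> sP ds.
have [F0 [G0 [F0R G0R FG0 mod0 [_ _ cE0 _]]]] := dbl_pair relaxed_pairR (P_face sP) ds.
have [F [G [FR GR FG mod [cE ord]]]] : exists F G, [/\ F \in R, G \in R, F != G,
    (#|F :&: G| + k = r F + r G)%N & (cut r F s && cut r G s) /\
    ((r F - #|F :&: G| < r G - #|F :&: G|)%N || ((r F - #|F :&: G| == r G - #|F :&: G|)%N && (#|F :\: G| <= #|G :\: F|)%N))].
  have c0 : cut r F0 s && cut r G0 s by rewrite !cE0 // set21 set22.
  have [h|h] := boolP ((r F0 - #|F0 :&: G0| < r G0 - #|F0 :&: G0|)%N ||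
     ((r F0 - #|F0 :&: G0| == r G0 - #|F0 :&: G0|)%N && (#|F0 :\: G0| <= #|G0 :\: F0|)%N)).
    by exists F0, G0.
  exists G0, F0; split=> //; rewrite ?(setIC G0); [by rewrite eq_sym | by rewrite mod0 addnC |].
  split; first by rewrite andbC.
  by move: h; move: (r F0 - _)%N (r G0 - _)%N (#|F0 :\: G0|) (#|G0 :\: F0|); clear => x y z t; lia.
have [f1 f2 f3 f4 _] := relaxed_bounds FR; have [g1 g2 g3 g4 _] := relaxed_bounds GR.
have cF := cardsID G F; have cG := cardsID F G; rewrite setIC in cG.
exists (r F - #|F :&: G|)%N, (r G - #|F :&: G|)%N, #|F :\: G|, #|G :\: F|.
split; first by split; clear -f1 f2 f3 f4 g1 g2 g3 g4 cF cG; lia.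
have EC : cutters s = [set F; G] by apply/eqP; rewrite cutters_pair.
move=> al be a b; apply/andP/and4P => [[op /modpairsP[F' [G' [E F'R G'R FG' [mod' [E1 E2 E3 E4]]]]]]|]; last first.
  case=> /eqP -> /eqP -> /eqP -> /eqP ->; split; last by apply/modpairsP; exists F, G.
  rewrite /ordered_params ord andbT; clear ord; apply/andP; split; apply/andP; split;
    clear -f1 f2 f3 f4 g1 g2 g3 g4 cF cG mod; lia.
have : (F = F' /\ G = G') \/ (F = G' /\ G = F').
  have : F \in [set F'; G'] by rewrite -E EC set21.
  have : G \in [set F'; G'] by rewrite -E EC set22.
  rewrite !inE => /orP[]/eqP EG /orP[]/eqP EF; try by [left | right].
    by move: FG; rewrite EF EG eqxx.
  by move: FG; rewrite EF EG eqxx.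
case=> -[EF EG]; rewrite -EF -EG in E1 E2 E3 E4; first by split; apply/eqP.
move: op; rewrite /ordered_params => /and3P[_ _ ord']; rewrite (setIC G) in E1 E2.
by split; apply/eqP; clear -ord ord' E1 E2 E3 E4; lia.
Qed.

End SplitIndex.

Section DoubledFaces.
Variables (n k : nat) (Bs : {set {set 'I_n}}).
Hypotheses (matB : is_matroid Bs) (rkB : has_rank Bs k) (splitB : split_matroid Bs k).
Local Notation r := (rk Bs).
Local Notation R := (relaxed k Bs).
Local Notation ind := (@indic n).
Local Notation V := (ksets n k).

Definition dbl_term s : abring := PsiA ind (s :&: cutQ k R r) * (aa * bb + bb * aa) *
  psi_up k bb (aa - bb) s.

Lemma sum_modpair al be a b (X : {set {set 'I_n}}) : X \in modpairs Bs al be a b ->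
  \sum_(s in pfaces ind V | dbl k R r s && (cutters k Bs s == X)) dbl_term s = ecd (Wterm n al be a b).
Proof.
case/(modpairsP matB rkB splitB) => F [G [-> FR GR FG [mod [-> -> -> ->]]]].
have [f1 f2 f3 f4 _] := relaxed_bounds matB rkB splitB FR.
have [g1 g2 g3 g4 _] := relaxed_bounds matB rkB splitB GR.
have lF : (#|F :&: G| <= r F <= #|F|)%N by clear -f1 f2 f3 f4 g1 g2 g3 g4 mod; lia.
have lG : (#|F :&: G| <= r G <= #|G|)%N by clear -f1 f2 f3 f4 g1 g2 g3 g4 mod; lia.
rewrite ecd_W -(sum_pair _ _ FR GR FG mod lF lG (relaxed_pairR matB rkB splitB)
  (ksets_not_dbl matB rkB splitB) (relaxed_kn matB rkB splitB FR)).
apply: eq_bigl => s; case: (boolP (s \in pfaces ind V)) => //= sP.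
by case: (boolP (dbl k R r s)) => //= ds; rewrite (cutters_pair matB rkB splitB sP ds FR GR FG).
Qed.

(** Double counting of doubled faces against parameter vectors: every face is hit once, and every
    modular pair of a vector contributes the same [Wterm]. *)
Lemma sum_dbl : \sum_(s in pfaces ind V | dbl k R r s) dbl_term s =
  \sum_(al <- iota 0 n) \sum_(be <- iota 0 n) \sum_(a <- iota 0 n) \sum_(b <- iota 0 n)
    if ordered_params al be a b then ecd (Wterm n al be a b) *+ #|modpairs Bs al be a b| else 0.
Proof.
pose hit s al be a b := ordered_params al be a b && (cutters k Bs s \in modpairs Bs al be a b).
transitivity (\sum_(s in pfaces ind V | dbl k R r s) \sum_(al <- iota 0 n) \sum_(be <- iota 0 n)
    \sum_(a <- iota 0 n) \sum_(b <- iota 0 n) if hit s al be a b then dbl_term s else 0).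
  apply: eq_bigr => s /andP[sP ds].
  have [al0 [be0 [a0 [b0 [[h1 h2 h3 h4] E]]]]] := cutters_params matB rkB splitB sP ds.
  have L i : (i < n)%N -> i \in iota 0 n by rewrite mem_iota.
  have U := iota_uniq 0 n; apply/esym.
  rewrite -[RHS](sum_seq_pick predT (fun _ => dbl_term s) U (L _ h1)) /=; apply: eq_bigr => al _.
  rewrite andbT; have [Eal|Nal] := eqVneq al al0; last first.
    by do 3 (rewrite big1 // => ? _); rewrite /hit E (negbTE Nal).
  rewrite -[RHS](sum_seq_pick predT (fun _ => dbl_term s) U (L _ h2)) /=; apply: eq_bigr => be _.
  rewrite andbT; have [Ebe|Nbe] := eqVneq be be0; last first.
    by do 2 (rewrite big1 // => ? _); rewrite /hit E (negbTE Nbe) andbF.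
  rewrite -[RHS](sum_seq_pick predT (fun _ => dbl_term s) U (L _ h3)) /=; apply: eq_bigr => a _.
  rewrite andbT; have [Ea|Na] := eqVneq a a0; last first.
    by rewrite big1 // => ? _; rewrite /hit E (negbTE Na) !andbF.
  rewrite -[RHS](sum_seq_pick predT (fun _ => dbl_term s) U (L _ h4)) /=; apply: eq_bigr => b _.
  by rewrite /hit E Eal Ebe Ea !eqxx andbT.
rewrite exchange_big; apply: eq_bigr => al _; rewrite exchange_big; apply: eq_bigr => be _.
rewrite exchange_big; apply: eq_bigr => a _; rewrite exchange_big; apply: eq_bigr => b _.
rewrite /hit; case: ifP => /= _; last by rewrite big1.
rewrite -big_mkcondr /= (partition_big (cutters k Bs) (mem (modpairs Bs al be a b))) /=; last first.
  by move=> s /andP[].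
rewrite -sumr_const; apply: eq_bigr => X XM; rewrite -(sum_modpair XM).
apply: eq_bigl => s; case: eqP => [->|]; rewrite ?andbF ?andbT //.
by rewrite XM andbT.
Qed.

End DoubledFaces.

Lemma ecd_Lam n k (F : {set 'I_n}) (r : {set 'I_n} -> nat) :
  ecd (Psi_cd (Lam_pts k n (r F) #|F|)) = PsiA (@indic n) (cutQ k [set F] r).
Proof.
rewrite /ecd evab_Psi_cd /PsiA (Psi_cuspidal _ _ _ (erefl (r F))); apply: Psi_sig => B.
by rewrite inE.
Qed.

Lemma ecd_hypersimplex n k : ecd (Psi_cd (hyp_pts k n)) = PsiA (@indic n) (ksets n k).
Proof. by rewrite /ecd evab_Psi_cd; apply: Psi_sig => B; rewrite inE. Qed.

Lemma ecd_sum_iota n (F : nat -> ncpoly cdL) :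
  ecd (ncsum [seq F i | i <- iota 0 n]) = \sum_(i <- iota 0 n) ecd (F i).
Proof.
by rewrite ecdE ev_sum big_map; apply: eq_bigr => i _; rewrite ecdE.
Qed.

Theorem mainTheorem1 (n k : nat) (Bs : {set {set 'I_n}}) :
  is_matroid Bs -> has_rank Bs k -> split_matroid Bs k ->
  nceq (Psi_cd (base_pts n Bs))
    (ncsub
      (ncadd (Psi_cd (hyp_pts k n))
        (ncsum [seq ncsum [seq
           (if (0 < r < h)%N then
              ncscale (lambda n Bs r h)%:Z
                (ncsub (Psi_cd (Lam_pts k n r h)) (Psi_cd (hyp_pts k n)))
            else [::])
           | h <- iota 0 n] | r <- iota 0 n]))
      (ncsum [seq ncsum [seq ncsum [seq ncsum [seq
           (if [&& (0 < al < a)%N, (0 < be < b)%N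
                 & ((al < be)%N || ((al == be) && (a <= b)%N))] then
              ncscale (mu n Bs al be a b)%:Z (Wterm n al be a b)
            else [::])
           | b <- iota 0 n] | a <- iota 0 n] | be <- iota 0 n] | al <- iota 0 n])).
Proof.
move=> matB rkB splitB; apply: cd_to_ab_inj; apply/nceq_evab; rewrite -!/(ecd _).
have Eab : bb + (aa - bb) = aa by rewrite addrC subrK.
have ecd0 : ecd [::] = 0 by rewrite ecdE /ev big_nil.
have -> : ecd (Psi_cd (base_pts n Bs)) = PsiA (@indic n) Bs.
  by rewrite /ecd evab_Psi_cd; apply: Psi_sig.
rewrite ecdE ev_sub ev_add -!ecdE ecd_hypersimplex {1}(split_cutQ rkB splitB).
rewrite /PsiA (Psi_cuts _ _ (relaxed_pairR matB rkB splitB) (ksets_neq0 matB rkB)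
  (relaxed_cut matB rkB splitB) (ksets_not_dbl matB rkB splitB)) -/PsiA Eab.
congr (_ + _ - _).
  pose u p h := ecd (Psi_cd (Lam_pts k n p h)) - PsiA (@indic n) (ksets n k).
  rewrite (eq_bigr (fun F => u (rk Bs F) #|F|)) => [|F _]; last by rewrite /u ecd_Lam.
  (* Every flat satisfies [0 < rk F < #|F| < n], so grouping by rank and size within these ranges
     loses none. *)
  rewrite (sum_by_params (n := n)) => [|F FR]; last first.
    by have [h1 h2 _ h3 _] := relaxed_bounds matB rkB splitB FR; rewrite h1 h2.
  rewrite ecd_sum_iota; apply: eq_bigr => p _; rewrite ecd_sum_iota; apply: eq_bigr => h _.
  case: ifP => // _; rewrite ecdE ev_scale ev_sub -!ecdE ecd_hypersimplex -pmulrn; congr (_ *+ _).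
  rewrite /lambda; apply: eq_card => F; rewrite [LHS]inE [RHS]inE.
  by rewrite (pne_cyclic_flatE matB rkB splitB) andbA.
rewrite (sum_dbl matB rkB splitB) ecd_sum_iota; apply: eq_bigr => al _.
rewrite ecd_sum_iota; apply: eq_bigr => be _; rewrite ecd_sum_iota; apply: eq_bigr => a _.
rewrite ecd_sum_iota; apply: eq_bigr => b _; rewrite /ordered_params; case: ifP => // _.
by rewrite [RHS]ecdE ev_scale -ecdE -pmulrn.
Qed.
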